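(* Let $A\subset\mathbf R^{n+1}$ be a closed set with $\mathrm{reach}(A)>0$ and let $a\in\partial^vA$ with $N(A,a)=\{u\}$, $u\in\mathbf S^n$. Then: (a) there are $\varepsilon,\delta>0$ and a semiconvex Lipschitz function $f:a+u^\perp\to\mathbf R$ with $f(a)=0$, $f$ differentiable at $a$ with $Df(a)=0$, and $$\mathrm{graph}(f)\cap U_{\varepsilon,\delta}(a,u)=\partial A\cap U_{\varepsilon,\delta}(a,u),\qquad\mathrm{epi}(f)\cap U_{\varepsilon,\delta}(a,u)=A\cap U_{\varepsilon,\delta}(a,u);$$ (b) for $f$ as in (a): $(a,\nabla\phi(u))\in\widetilde N^\phi_n(A)$ if and only if $f$ is pointwise twice differentiable at $a$. In this case every map $\nu:a+u^\perp\to\mathbf S^n$ with $\nu(b)\in N(\mathrm{epi}(f),b-f(b)u)$ for every $b\in a+u^\perp$ is differentiable at $a$ and $$D^2f(a)(\tau_1,D(\nabla\phi)(u)(\tau_2))=D(\nabla\phi\circ\nu)(a)(\tau_1)\bullet\tau_2\quad\text{for }\tau_1,\tau_2\in u^\perp.$$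
   Context: Notation. $n\ge1$; $\mathbf{R}^{n+1}$ with Euclidean inner product $\bullet$, norm $|\cdot|$, unit sphere $\mathbf S^n$; $\mathcal L^{n+1}$ Lebesgue measure. For $a\in\mathbf R^{n+1}$, $u\in\mathbf S^n$, $\varepsilon,\delta>0$: $U_{\varepsilon,\delta}(a,u)=\{x+tu:x\in a+u^\perp,|x-a|<\varepsilon,|t|<\delta\}$; for $f:a+u^\perp\to\mathbf R$, $\mathrm{graph}(f)=\{x-f(x)u:x\in a+u^\perp\}$ and $\mathrm{epi}(f)=\{x-su:x\in a+u^\perp,s\ge f(x)\}$. A function $f$ on (an open convex subset of) $a+u^\perp\cong\mathbf R^n$ is semiconvex if $x\mapsto\kappa|x|^2+f(x)$ is convex for some $\kappa\ge0$. Euclidean objects: $N(E)=\{(b,v)\in E\times\mathbf S^n:\mathrm{dist}(b+rv,E)=r$ for some $r>0\}$ with fibres $N(E,b)$, for closed $E$; $\partial^vE$ is the set of $b\in\partial E$ with $N(E,b)$ a singleton; $\mathrm{reach}(A)$ is the supremum of $\rho\ge0$ such that every point at Euclidean distance $<\rho$ from $A$ has a unique nearest point in $A$. $\phi$ is a norm on $\mathbf R^{n+1}$ of class $C^2$ on $\mathbf R^{n+1}\setminus\{0\}$, uniformly convex (there is $\gamma>0$ with $u\mapsto\phi(u)-\gamma|u|$ convex). $\phi^*(u)=\sup\{v\bullet u:\phi(v)=1\}$; $\mathcal W^\phi=\{x:\phi^*(x)\le1\}$; $\mathbf n^\phi:\partial\mathcal W^\phi\to\mathbf S^n$ its Euclidean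 exterior unit normal. For nonempty closed $A$: $\delta^\phi_A(x)=\min\{\phi^*(x-c):c\in A\}$; $\xi^\phi_A(x)=\{c\in A:\phi^*(x-c)=\delta^\phi_A(x)\}$; for $x\notin A$, $\nu^\phi_A(x)=\{\delta^\phi_A(x)^{-1}(x-c):c\in\xi^\phi_A(x)\}$. $\nu^\phi_A$ is differentiable at $x\notin A$ if $\nu^\phi_A(x)$ is a singleton and there is linear $L$ such that for every $\varepsilon>0$ there is $\delta>0$ with $|w-\nu^\phi_A(x)-L(y-x)|\le\varepsilon|y-x|$ for $y\notin A$, $|y-x|<\delta$, $w\in\nu^\phi_A(y)$; $D\nu^\phi_A(x)=L$; $\mathrm{dmn}D\nu^\phi_A$ the set of such $x$. $N^\phi(A)=\{(a,\eta)\in A\times\partial\mathcal W^\phi:\delta^\phi_A(a+r\eta)=r$ for some $r>0\}$; $\mathbf r^\phi_A(a,\eta)=\sup\{s>0:\delta^\phi_A(a+s\eta)=s\}$; for $x\notin A$, $a\in\xi^\phi_A(x)$: $\rho^\phi_A(x)=\sup\{s\ge0:\delta^\phi_A(a+s(x-a))=s\delta^\phi_A(x)\}$; $\underline{\mathbf r}^\phi_A(a,\eta)$ is the supremum of $\{0\}$ and all $\sigma r$ with $\sigma>1$, $0<r<\mathbf r^\phi_A(a,\eta)$, such that $\{x\notin A:\rho^\phi_A(x)\ge\sigma\}$ has Lebesgue density $1$ at $a+r\eta$. For $x\in\mathrm{dmn}D\nu^\phi_A$, $D\nu^\phi_A(x)$ maps $\mathbf n^\phi(\nu^\phi_A(x))^\perp$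 into itself with real eigenvalues $\chi^\phi_{A,1}(x)\le\dots\le\chi^\phi_{A,n}(x)$. $\widetilde N^\phi(A)$: $(a,\eta)\in N^\phi(A)$ with $a+r\eta\in\mathrm{dmn}D\nu^\phi_A$ for some (then all) $r\in(0,\underline{\mathbf r}^\phi_A(a,\eta))$; $\kappa^\phi_{A,i}(a,\eta)=\chi^\phi_{A,i}(a+r\eta)/(1-r\chi^\phi_{A,i}(a+r\eta))\in(-\infty,+\infty]$; $\widetilde N^\phi_n(A)$ the set of $(a,\eta)\in\widetilde N^\phi(A)$ with all $\kappa^\phi_{A,i}$ finite. *)

(* Defs.v *)
From HB Require Import structures.
From mathcomp Require Import all_boot all_order all_algebra.
From mathcomp Require Import all_classical all_reals all_analysis.
Set Implicit Arguments. Unset Strict Implicit. Unset Printing Implicit Defensive.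
Import Order.TTheory GRing.Theory Num.Theory.
Import numFieldNormedType.Exports.
Local Open Scope classical_set_scope.
Local Open Scope ring_scope.

Section Defs.
Variables (R : realType) (n : nat).
Local Notation V := 'rV[R]_(n.+1).

Definition dot (x y : V) : R := \sum_(i < n.+1) x 0 i * y 0 i.
Definition enorm (x : V) : R := Num.sqrt (dot x x).
Definition ev (i : 'I_n.+1) : V := delta_mx 0 i.
Definition perp (u : V) : set V := [set x | dot x u = 0].
Definition plane (a u : V) : set V := [set x | dot (x - a) u = 0].
Definition eball (x : V) (r : R) : set V := [set y | enorm (y - x) < r].

Definition bdry (A : set V) : set V := closure A `\` interior A.

Definition dist (E : set V) (x : V) : R := inf [set enorm (x - c) | c in E].
Definition Neuc (E : set V) : set (V * V) :=
  [set p | E p.1 /\ enorm p.2 = 1 /\ exists r, 0 < r /\ dist E (p.1 + r *: p.2) = r].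
Definition Neuc_fib (E : set V) (b : V) : set V := [set v | Neuc E (b, v)].
Definition reach (A : set V) : \bar R :=
  ereal_sup [set rho%:E | rho in [set rho : R | 0 <= rho /\
     forall x, dist A x < rho ->
       exists! c, A c /\ enorm (x - c) = dist A x]].

Definition box (l h : V) : set V := [set x | forall i, l 0 i < x 0 i < h 0 i].
Definition boxvol (l h : V) : R := \prod_(i < n.+1) Num.max (h 0 i - l 0 i) 0.
Definition lebo (S : set V) : \bar R :=
  ereal_inf [set s | exists (l h : nat -> V),
     S `<=` \bigcup_k box (l k) (h k) /\
     s = (\sum_(0 <= k <oo) (boxvol (l k) (h k))%:E)%E].
Definition density1 (S : set V) (x : V) : Prop :=
  (fun r : R => fine (lebo (S `&` eball x r)) / fine (lebo (eball x r)))
     @ 0^'+ --> (1 : R).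

Definition is_norm (phi : V -> R) : Prop :=
  [/\ forall x, 0 <= phi x, forall x, phi x = 0 -> x = 0,
      forall (t : R) x, phi (t *: x) = `|t| * phi x
    & forall x y, phi (x + y) <= phi x + phi y].
Definition convex_on (U : set V) (g : V -> R) : Prop :=
  forall x y (t : R), U x -> U y -> 0 <= t <= 1 ->
    g (t *: x + (1 - t) *: y) <= t * g x + (1 - t) * g y.
Definition unif_convex (phi : V -> R) : Prop :=
  exists gamma : R, 0 < gamma /\ convex_on setT (fun x => phi x - gamma * enorm x).
Definition C2_on (U : set V) (f : V -> R) : Prop :=
  [/\ forall x, U x -> {for x, continuous f},
      forall i x, U x -> derivable f x (ev i) /\
                  {for x, continuous ('D_(ev i) f)}
    & forall i j x, U x -> derivable ('D_(ev i) f) x (ev j) /\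
                  {for x, continuous ('D_(ev j) ('D_(ev i) f))}].
Definition grad (f : V -> R) (x : V) : V := \row_i ('D_(ev i) f x).
(* hess f x i j = d_j d_i f (x);  D(grad f)(x)(tau) = tau *m (hess f x)^T *)
Definition hess (f : V -> R) (x : V) : 'M[R]_(n.+1) :=
  \matrix_(i, j) ('D_(ev j) ('D_(ev i) f) x).

Definition phistar (phi : V -> R) (u : V) : R :=
  sup [set dot v u | v in [set v | phi v = 1]].
Definition Wphi (phi : V -> R) : set V := [set x | phistar phi x <= 1].
Definition bdW (phi : V -> R) : set V := [set x | phistar phi x = 1].
(* Euclidean exterior unit normal of W^phi at eta (unique for our phi) *)
Definition ext_normal (phi : V -> R) (eta nn : V) : Prop :=
  enorm nn = 1 /\ forall x, Wphi phi x -> dot (x - eta) nn <= 0.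
Definition deltaA (phi : V -> R) (A : set V) (x : V) : R :=
  inf [set phistar phi (x - c) | c in A].
Definition xiA (phi : V -> R) (A : set V) (x : V) : set V :=
  [set c | A c /\ phistar phi (x - c) = deltaA phi A x].
Definition nuA (phi : V -> R) (A : set V) (x : V) : set V :=
  [set (deltaA phi A x)^-1 *: (x - c) | c in xiA phi A x].
Definition is_Dnu (phi : V -> R) (A : set V) (x v : V) (L : 'M[R]_(n.+1)) : Prop :=
  ~ A x /\ nuA phi A x = [set v] /\
  forall eps : R, 0 < eps -> exists d : R, 0 < d /\
    forall y w, ~ A y -> enorm (y - x) < d -> nuA phi A y w ->
      enorm (w - v - (y - x) *m L) <= eps * enorm (y - x).
Definition dmnDnu (phi : V -> R) (A : set V) (x : V) : Prop :=
  exists v L, is_Dnu phi A x v L.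
Definition Nphi (phi : V -> R) (A : set V) : set (V * V) :=
  [set p | A p.1 /\ bdW phi p.2 /\
     exists r, 0 < r /\ deltaA phi A (p.1 + r *: p.2) = r].
Definition rphi (phi : V -> R) (A : set V) (a eta : V) : \bar R :=
  ereal_sup [set s%:E | s in [set s : R | 0 < s /\ deltaA phi A (a + s *: eta) = s]].
Definition rhoA (phi : V -> R) (A : set V) (x : V) : \bar R :=
  ereal_sup [set s%:E | s in [set s : R | 0 <= s /\
     exists a, xiA phi A x a /\
       deltaA phi A (a + s *: (x - a)) = s * deltaA phi A x]].
Definition rlow (phi : V -> R) (A : set V) (a eta : V) : \bar R :=
  ereal_sup ([set 0%E] `|`
    [set e | exists sigma r : R, [/\ 1 < sigma, 0 < r, (r%:E < rphi phi A a eta)%E,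
        density1 [set x | ~ A x /\ (sigma%:E <= rhoA phi A x)%E] (a + r *: eta)
      & e = (sigma * r)%:E]]).
Definition Ntilde (phi : V -> R) (A : set V) : set (V * V) :=
  [set p | Nphi phi A p /\ exists r, 0 < r /\ (r%:E < rlow phi A p.1 p.2)%E /\
     dmnDnu phi A (p.1 + r *: p.2)].
(* all kappa_i finite  <=>  no eigenvalue chi_i of D nu on n^phi(nu)^perp equals 1/r *)
Definition Ntilde_n (phi : V -> R) (A : set V) : set (V * V) :=
  [set p | Nphi phi A p /\ exists r, 0 < r /\ (r%:E < rlow phi A p.1 p.2)%E /\
     exists v L, is_Dnu phi A (p.1 + r *: p.2) v L /\
       forall nn, ext_normal phi v nn ->
         forall w, dot w nn = 0 -> w *m L = r^-1 *: w -> w = 0].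

Definition Ucyl (a u : V) (eps del : R) : set V :=
  [set y | exists x (t : R), [/\ plane a u x, enorm (x - a) < eps, `|t| < del
     & y = x + t *: u]].
Definition graphf (a u : V) (f : V -> R) : set V :=
  [set y | exists x, plane a u x /\ y = x - f x *: u].
Definition epif (a u : V) (f : V -> R) : set V :=
  [set y | exists x (s : R), [/\ plane a u x, f x <= s & y = x - s *: u]].
Definition semiconvex_on (U : set V) (f : V -> R) : Prop :=
  exists kappa : R, 0 <= kappa /\ convex_on U (fun x => kappa * enorm x ^+ 2 + f x).
Definition lipschitz_on (U : set V) (f : V -> R) : Prop :=
  exists K : R, forall x y, U x -> U y -> `|f x - f y| <= K * enorm (x - y).
Definition diff_zero (f : V -> R) (a u : V) : Prop :=
  forall eps : R, 0 < eps -> exists d : R, 0 < d /\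
    forall v, perp u v -> enorm v < d -> `|f (a + v) - f a| <= eps * enorm v.
Definition plane_deriv (g : V -> V) (a u : V) (L : 'M[R]_(n.+1)) : Prop :=
  forall eps : R, 0 < eps -> exists d : R, 0 < d /\
    forall v, perp u v -> enorm v < d ->
      enorm (g (a + v) - g a - v *m L) <= eps * enorm v.
Definition plane_diff (g : V -> V) (a u : V) : Prop := exists L, plane_deriv g a u L.
Definition twice_at (f : V -> R) (a u p : V) (M : 'M[R]_(n.+1)) : Prop :=
  forall eps : R, 0 < eps -> exists d : R, 0 < d /\
    forall v, perp u v -> enorm v < d ->
      `|f (a + v) - f a - dot p v - 2^-1 * dot (v *m M) v| <= eps * enorm v ^+ 2.
Definition ptw_twice_diff (f : V -> R) (a u : V) : Prop :=
  exists p M, M^T = M /\ twice_at f a u p M.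

Definition graph_rep (A : set V) (a u : V) (eps del : R) (f : V -> R) : Prop :=
  [/\ 0 < eps, 0 < del, semiconvex_on (plane a u) f, lipschitz_on (plane a u) f
    & [/\ f a = 0, diff_zero f a u,
      graphf a u f `&` Ucyl a u eps del = bdry A `&` Ucyl a u eps del
    & epif a u f `&` Ucyl a u eps del = A `&` Ucyl a u eps del]].
End Defs.

(* Main.v *)
(** Positive reach lets every proximal normal of [A] be prolonged to a fixed length [rho]: at a
    point where the distance is maximal on a ball around the end of a normal segment, the
    segment to the nearest point runs along the old one.  Hence limits of normals are normals,
    the normals at points near [a] are close to [u], and every [x] outside [A] with nearest
    point [q] and normal [w] satisfies [2 rho (c - q).w <= |c - q|^2] for [c] in [A], which
    forces narrow cones around [-u] into [A].  So [A] is locally an epigraph, and its normals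
    give paraboloids of uniform opening below the graph.

    For the equivalence, put [eta = grad phi u].  A point [y] near [a + r eta] has a nearest
    point [b - f(b) u] with [y - (b - f(b) u) = delta(y) grad phi v], and [v / (v.u)] is a
    subgradient of [f] at [b] up to a fixed parabola.  If [nu] is differentiable at [a + r eta],
    then [b] and this subgradient have first-order expansions in [y]; finiteness of the
    curvatures makes the expansion of [b] invertible, so the subgradients are known to first
    order at points [b] close to every point near [a], and integrating them along segments
    expands [f] to second order.  Conversely, a second-order expansion of a semiconvex
    function expands all its subgradients to first order; for small [r] the equation for
    [y] can then be solved for [b], hence for [nu].  The density condition in the definition of
    the lower reach function is only used to transport [delta(a + r eta) = r] from nearby points. *)

Require Import Defs.
From HB Require Import structures.
From mathcomp Require Import all_boot all_order all_algebra.
From mathcomp Require Import all_classical all_reals all_analysis.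
From mathcomp Require Import ring lra.
Import Order.TTheory GRing.Theory Num.Theory.
Import numFieldNormedType.Exports.
Local Open Scope classical_set_scope.
Local Open Scope ring_scope.
Set Implicit Arguments. Unset Strict Implicit. Unset Printing Implicit Defensive.

(** The working variable is the Euclidean conormal. [grad phi] maps the unit sphere onto the
    boundary of the Wulff shape, so each contact direction is written [grad phi v]. Uniform
    convexity enters mainly through [phi_support], which yields injectivity of that map, coercivity
    of [hess phi u] on [perp u], tangent balls and stability of contacts.

    Passing from the normal map to [f] meets two obstacles. The differential is known at one point
    of the ray only; its tangential increments suffice, because along them the distance is
    stationary and only foot and slope move. Moreover the feet [b] need not fill a neighbourhood of
    [a]: they come within e|h| of each a + h. A subgradient at [b] bounds [f] from below, so the
    upper bound at a + h is taken from convexity, at the price of e times a value of [f] further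
    out. This is harmless only if [f] grows at most quadratically, which needs a scaling argument of
    its own.

    In the other direction the equation for the foot is the identity perturbed by a multiple of r,
    so one small r settles its solvability and excludes the eigenvalue 1/r, that is, infinite
    curvatures. *)

Local Ltac row_ring := apply/rowP => ?; rewrite !mxE; ring.

(** * Euclidean space *)

Section Euclidean.
Variables (R : realType) (n : nat).
Local Notation V := 'rV[R]_n.+1.
Implicit Types (x y z u v : V) (e r s t : R).

Lemma dotC x y : dot x y = dot y x.
Proof. by apply: eq_bigr => i _; rewrite mulrC. Qed.

Lemma dotDl x y z : dot (x + y) z = dot x z + dot y z.
Proof. by rewrite -big_split; apply: eq_bigr => i _; rewrite !mxE mulrDl. Qed.

Lemma dotDr x y z : dot z (x + y) = dot z x + dot z y.
Proof. by rewrite dotC dotDl !(dotC z). Qed.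

Lemma dotZl t x y : dot (t *: x) y = t * dot x y.
Proof. by rewrite /dot mulr_sumr; apply: eq_bigr => i _; rewrite mxE mulrA. Qed.

Lemma dotZr t x y : dot x (t *: y) = t * dot x y.
Proof. by rewrite dotC dotZl dotC. Qed.

Lemma dotNl x y : dot (- x) y = - dot x y.
Proof. by rewrite -scaleN1r dotZl mulN1r. Qed.

Lemma dotNr x y : dot x (- y) = - dot x y.
Proof. by rewrite dotC dotNl dotC. Qed.

Lemma dot0l x : dot 0 x = 0.
Proof. by rewrite -(scale0r 0) dotZl mul0r. Qed.

Lemma dot0r x : dot x 0 = 0.
Proof. by rewrite dotC dot0l. Qed.

Definition dotE := (dotDl, dotDr, dotNl, dotNr, dotZl, dotZr, dot0l, dot0r).

Lemma dot_ge0 x : 0 <= dot x x.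
Proof. by apply: sumr_ge0 => i _; rewrite -expr2 sqr_ge0. Qed.

Lemma dot_eq0 x : dot x x = 0 -> x = 0.
Proof.
move=> x0; apply/rowP => i; rewrite mxE; apply/eqP; rewrite -sqrf_eq0 expr2.
have /psumr_eq0P H : forall j, true -> 0 <= x 0 j * x 0 j.
  by move=> j _; rewrite -expr2 sqr_ge0.
by apply/eqP; apply: (H x0).
Qed.

Lemma enorm_ge0 x : 0 <= enorm x.
Proof. exact: sqrtr_ge0. Qed.

Lemma enorm_sqr x : enorm x ^+ 2 = dot x x.
Proof. by rewrite sqr_sqrtr // dot_ge0. Qed.

Lemma dotxx x : dot x x = enorm x * enorm x.
Proof. by rewrite -enorm_sqr expr2. Qed.

Lemma enorm0 : enorm (0 : V) = 0.
Proof. by rewrite /enorm dot0l sqrtr0. Qed.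

Lemma enorm0_eq0 x : enorm x = 0 -> x = 0.
Proof. by move=> h; apply: dot_eq0; rewrite dotxx h mul0r. Qed.

Lemma enorm_gt0 x : (0 < enorm x) = (x != 0).
Proof.
rewrite lt_def enorm_ge0 andbT; apply/idP/idP; apply: contraNN => /eqP.
  by move->; rewrite enorm0.
by move/enorm0_eq0 ->.
Qed.

Lemma enormZ t x : enorm (t *: x) = `|t| * enorm x.
Proof. by rewrite /enorm !dotE mulrA -expr2 sqrtrM ?sqr_ge0 // sqrtr_sqr. Qed.

Lemma enormN x : enorm (- x) = enorm x.
Proof. by rewrite -scaleN1r enormZ normrN normr1 mul1r. Qed.

Lemma enormB x y : enorm (x - y) = enorm (y - x).
Proof. by rewrite -enormN opprB. Qed.

Lemma cauchy_schwarz x y : `|dot x y| <= enorm x * enorm y.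
Proof.
have [->|x0] := eqVneq x 0; first by rewrite dot0l normr0 enorm0 mul0r.
have xx : 0 < dot x x by rewrite dotxx mulr_gt0 // enorm_gt0.
rewrite -(@ler_pXn2r _ 2) ?nnegrE ?mulr_ge0 ?enorm_ge0 //.
rewrite real_normK ?num_real // exprMn !enorm_sqr.
have := dot_ge0 (dot x x *: y - dot x y *: x).
rewrite !dotE (dotC y x) => h.
rewrite -(ler_pM2l xx); nra.
Qed.

Lemma dot_le x y : dot x y <= enorm x * enorm y.
Proof. exact: le_trans (ler_norm _) (cauchy_schwarz _ _). Qed.

Lemma dot_ge x y : - (enorm x * enorm y) <= dot x y.
Proof. by have := cauchy_schwarz x y; rewrite ler_norml => /andP[]. Qed.

Lemma enorm_le x t : 0 <= t -> dot x x <= t * t -> enorm x <= t.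
Proof.
by move=> t0 h; rewrite -(@ler_pXn2r _ 2) ?nnegrE ?enorm_ge0 // enorm_sqr expr2.
Qed.

Lemma enormD x y : enorm (x + y) <= enorm x + enorm y.
Proof.
apply: enorm_le; first by rewrite addr_ge0 ?enorm_ge0.
by rewrite !dotE (dotC y x) !dotxx; have := dot_le x y; nra.
Qed.

Lemma enorm_tri x y z : enorm (x - z) <= enorm (x - y) + enorm (y - z).
Proof. by have := enormD (x - y) (y - z); rewrite addrA subrK. Qed.

Lemma enorm_triB x y : enorm x <= enorm y + enorm (x - y).
Proof. by have := enormD y (x - y); rewrite addrC subrK. Qed.

Lemma enormBD x y : enorm (x - y) <= enorm x + enorm y.
Proof. by have := enormD x (- y); rewrite enormN. Qed.

Lemma coord_le_enorm x i : `|x 0 i| <= enorm x.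
Proof.
rewrite -(@ler_pXn2r _ 2) ?nnegrE ?enorm_ge0 // real_normK ?num_real //.
rewrite enorm_sqr /dot (bigD1 i) //= expr2 lerDl.
by apply: sumr_ge0 => j _; rewrite -expr2 sqr_ge0.
Qed.

Lemma dot_ev x i : dot x (ev R i) = x 0 i.
Proof.
rewrite /dot (bigD1 i) //= big1 ?addr0 => [|j ji]; rewrite !mxE ?eqxx ?mulr1 //.
by rewrite (negbTE ji) mulr0.
Qed.

Lemma enorm_ev i : enorm (ev R i : V) = 1.
Proof. by rewrite /enorm dot_ev mxE !eqxx sqrtr1. Qed.

Lemma row_sum_ev x : x = \sum_i x 0 i *: ev R i.
Proof. exact: row_sum_delta. Qed.

Lemma enorm_sum (I : finType) (F : I -> V) : enorm (\sum_i F i) <= \sum_i enorm (F i).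
Proof.
elim/big_ind2: _ => // [|x1 x2 y1 y2 h1 h2]; first by rewrite enorm0.
by apply: le_trans (enormD _ _) _; rewrite lerD.
Qed.

Lemma enorm_le_sum x : enorm x <= \sum_i `|x 0 i|.
Proof.
rewrite {1}(row_sum_ev x); apply: le_trans (enorm_sum _) _.
by apply: ler_sum => i _; rewrite enormZ enorm_ev mulr1.
Qed.

Lemma enorm_max x t : 0 <= t -> (forall i, `|x 0 i| <= t) -> enorm x <= t *+ n.+1.
Proof.
move=> t0 h; apply: le_trans (enorm_le_sum x) _.
by rewrite -[leRHS](_ : \sum_(i < n.+1) t = _) ?ler_sum // sumr_const card_ord.
Qed.

Lemma unit_dir x : x != 0 -> exists v, enorm v = 1 /\ x = enorm x *: v.
Proof.
rewrite -enorm_gt0 => x0; exists ((enorm x)^-1 *: x); split.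
  by rewrite enormZ gtr0_norm ?invr_gt0 // mulVf // gt_eqF.
by rewrite scalerA mulfV ?scale1r // gt_eqF.
Qed.

Lemma dot_unit_dist u v : enorm u = 1 -> enorm v = 1 ->
  dot (u - v) (u - v) = 2 * (1 - dot u v).
Proof. by move=> u1 v1; rewrite !dotE !(dotxx u, dotxx v) u1 v1 (dotC v u); ring. Qed.

Lemma plane_add a u v : perp u v -> plane a u (a + v).
Proof. by rewrite /plane /perp /= addrC addKr. Qed.

Lemma mulmx_bound (K : 'M[R]_n.+1) :
  exists C : R, 0 < C /\ forall x, enorm (x *m K) <= C * enorm x.
Proof.
exists (1 + \sum_i enorm (row i K)); split.
  by rewrite ltr_wpDr // sumr_ge0 // => i _; exact: enorm_ge0.
move=> x; rewrite mulmx_sum_row; apply: le_trans (enorm_sum _) _.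
rewrite mulrDl mul1r mulr_suml; apply: (@le_trans _ _ (\sum_i enorm (row i K) * enorm x)).
  apply: ler_sum => i _; rewrite enormZ mulrC.
  by apply: ler_wpM2l; rewrite ?enorm_ge0 // coord_le_enorm.
by rewrite lerDr enorm_ge0.
Qed.

Lemma mulmx_comb r t x y (K : 'M[R]_n.+1) :
  (r *: x + t *: y) *m K = r *: (x *m K) + t *: (y *m K).
Proof. by rewrite mulmxDl !scalemxAl. Qed.

Lemma dot_mulmx_tr x y (K : 'M[R]_n.+1) : dot (x *m K) y = dot x (y *m K^T).
Proof.
have E v w : dot v w = (v *m w^T) 0 0.
  by rewrite /dot mxE; apply: eq_bigr => i _; rewrite !mxE.
by rewrite !E trmx_mul trmxK mulmxA.
Qed.

(* The orthogonal projection onto [perp u], in the row convention [x |-> x *m pmx u]. *)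
Definition pmx u : 'M[R]_n.+1 := 1%:M - u^T *m u.

Lemma mul_pmx u x : x *m pmx u = x - dot x u *: u.
Proof.
rewrite mulmxBr mulmx1 mulmxA; congr (_ - _).
rewrite [x *m _]mx11_scalar mul_scalar_mx; congr (_ *: _).
by rewrite mxE; apply: eq_bigr => i _; rewrite !mxE.
Qed.

Lemma pmx_perp u x : perp u x -> x *m pmx u = x.
Proof. by rewrite mul_pmx => ->; rewrite scale0r subr0. Qed.

Lemma pmxP u x : enorm u = 1 -> perp u (x *m pmx u).
Proof. by move=> u1; rewrite /perp /= mul_pmx !dotE dotxx u1; ring. Qed.

Lemma dot_pmx u x y : perp u y -> dot (x *m pmx u) y = dot x y.
Proof. by move=> h; rewrite mul_pmx !dotE (dotC u) h mulr0 subr0. Qed.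

Lemma enorm_pmx u x : enorm u = 1 -> enorm (x *m pmx u) <= enorm x.
Proof.
move=> u1; apply: enorm_le; rewrite ?enorm_ge0 // -dotxx mul_pmx !dotE (dotxx u) u1 (dotC u x).
by have := sqr_ge0 (dot x u); nra.
Qed.

Lemma unitmx_inj (K : 'M[R]_n.+1) : (forall x, x *m K = 0 -> x = 0) -> K \in unitmx.
Proof.
move=> h; rewrite -row_free_unit -kermx_eq0; apply/eqP/row_matrixP => i.
by rewrite row0; apply: h; rewrite -row_mul mulmx_ker row0.
Qed.

End Euclidean.

(** * Euclidean balls, continuity and compactness *)

Section Topology.
Variables (R : realType) (n : nat).
Local Notation V := 'rV[R]_n.+1.
Implicit Types (x y z u v : V) (e r s t : R).

Lemma norm_le_enorm x : `|x| <= enorm x.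
Proof.
rewrite [leLHS]/Num.norm /= mx_normrE; apply/bigmax_leP; split=> [|[i j] _] /=.
  exact: enorm_ge0.
by rewrite ord1 coord_le_enorm.
Qed.

Lemma enorm_le_norm x : enorm x <= `|x| *+ n.+1.
Proof.
apply: enorm_max => // i; rewrite [leRHS]/Num.norm /= mx_normrE.
by apply/bigmax_geP; right; exists (0, i).
Qed.

(** Row vectors carry the maximum norm, which is comparable with [enorm] up to the factor n+1.
    Through this equivalence all later limits are stated with [enorm]. *)
Lemma nbhs_enorm x (P : set V) :
  nbhs x P <-> exists d : R, 0 < d /\ forall y, enorm (y - x) < d -> P y.
Proof.
split=> [/nbhs_normP[d /= d0 h]|[d [d0 h]]].
  exists d; split=> // y yx; apply: h; rewrite /ball_ /=.
  by rewrite distrC; apply: le_lt_trans yx; exact: norm_le_enorm.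
apply: (nbhs_normP x P).2; exists (d / n.+1%:R) => /=; first by rewrite divr_gt0.
move=> y /=; rewrite distrC => yx; apply: h; apply: le_lt_trans (enorm_le_norm _) _.
by rewrite -mulr_natr -ltr_pdivlMr.
Qed.

Lemma cvg_enorm (f : V -> R) x : {for x, continuous f} <->
  forall e : R, 0 < e -> exists d : R, 0 < d /\
    forall y, enorm (y - x) < d -> `|f y - f x| < e.
Proof.
split=> [fx e e0|h].
  have /fx : nbhs (f x) [set r | `|r - f x| < e].
    by apply/nbhs_normP; exists e => //= y /=; rewrite distrC.
  by rewrite nbhs_simpl => /nbhs_enorm.
apply: (@cvgrPdist_lt R R^o V (nbhs x) (nbhs_filter x) f (f x)).2 => e e0.
apply/nbhs_enorm; have [d [d0 hd]] := h e e0.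
by exists d; split=> // y /hd; rewrite distrC.
Qed.

Lemma interior_enorm (A : set V) x : interior A x <->
  exists d : R, 0 < d /\ forall y, enorm (y - x) < d -> A y.
Proof. exact: nbhs_enorm. Qed.

Lemma bdryP (A : set V) x : closed A ->
  bdry A x <-> A x /\ forall d, 0 < d -> exists y, enorm (y - x) < d /\ ~ A y.
Proof.
move=> Acl; have -> : bdry A = A `\` interior A by rewrite /bdry -(closure_id _).1.
split=> [[Ax nint]|[Ax h]]; split=> //.
  move=> d d0; apply: contrapT => /forallNP h; apply: nint; apply/interior_enorm.
  by exists d; split=> // y yd; apply: contrapT => nA; apply: (h y).
by move=> /interior_enorm[d [d0 hd]]; have [y [/hd]] := h d d0.
Qed.

Lemma closed_enorm (A : set V) x : closed A ->
  (forall d, 0 < d -> exists y, A y /\ enorm (y - x) < d) -> A x.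
Proof.
move=> Acl h; apply: Acl => B /nbhs_enorm[d [d0 hd]].
by have [y [Ay yd]] := h d d0; exists y; split=> //; apply: hd.
Qed.

Lemma enorm_continuous : continuous (@enorm R n).
Proof.
move=> x; apply/cvg_enorm => e e0; exists e; split=> // y; apply: le_lt_trans.
have := enorm_triB y x; have := enorm_triB x y; rewrite (enormB x y).
by rewrite ler_norml => *; apply/andP; split; lra.
Qed.

Lemma compact_eball x t (B : set V) : closed B -> compact (B `&` [set y | enorm (y - x) <= t]).
Proof.
move=> Bcl; apply: bounded_closed_compact.
  exists (enorm x + t); split; first exact: num_real.
  move=> M hM y [_ /= yx]; apply: le_trans (norm_le_enorm _) _.
  by have := enorm_triB y x; lra.
apply: closedI => //.
have -> : [set y | enorm (y - x) <= t] = (fun y => enorm (y - x)) @^-1` [set r | r <= t] by [].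
apply: closed_comp; last exact: closed_le.
move=> y _; apply: continuous_comp; last exact: enorm_continuous.
by apply: continuousB; [exact: id|exact: cst_continuous].
Qed.

Lemma within_continuousW (A : set V) (f : V -> R) :
  (forall x, A x -> {for x, continuous f}) -> {within A, continuous f}.
Proof.
by move=> h; apply: continuous_in_subspaceT => x; rewrite inE => /h.
Qed.

(** A cluster point in a closed ball gives a selection with a rate. [h] need not increase:
    [k <= h k] is what lets conditions valid from some index on pass to the selected terms. *)
Lemma bounded_subseq (x : nat -> V) t : (forall k, enorm (x k) <= t) ->
  exists p (h : nat -> nat), (forall k, (k <= h k)%N) /\
    forall k, enorm (x (h k) - p) < k.+1%:R^-1.
Proof.
move=> xt.
have cK := @compact_eball 0 t setT closedT.
have [p [_ hp]] : (setT `&` [set y | enorm (y - 0) <= t]) `&` cluster (x @ \oo) !=set0.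
  by apply: cK; exists 0%N => // k _ /=; split=> //=; rewrite subr0.
have H k : {m | (k <= m)%N /\ enorm (x m - p) < k.+1%:R^-1}.
  apply: cid; have := hp [set x m | m in [set m | (k <= m)%N]] [set y | enorm (y - p) < k.+1%:R^-1].
  case.
  - by exists k => // m /= km; exists m.
  - by apply/nbhs_enorm; exists k.+1%:R^-1; split.
  - by move=> _ [[m km <-] ?]; exists m.
exists p, (fun k => sval (H k)); split=> k; by case: (svalP (H k)).
Qed.

Lemma inv_archi t : 0 < t -> exists k, k.+1%:R^-1 < t.
Proof.
move=> t0; have [k _ hk] := @nbhs_infty_gtr R t^-1.
exists k; rewrite invf_plt ?posrE //; apply: lt_trans (hk k (leqnn _)) _.
by rewrite ltr_nat.
Qed.

End Topology.

(** * Partial derivatives *)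

Section Calculus.
Variables (R : realType) (n : nat).
Local Notation V := 'rV[R]_n.+1.
Local Notation ev := (ev R).
Implicit Types (g : V -> R) (x y z u v : V) (e r s t : R).

Lemma min_gt0 (s t : R) : 0 < s -> 0 < t -> exists2 r : R, 0 < r & r < s /\ r < t.
Proof.
move=> s0 t0; exists (Num.min s t / 2); first by rewrite divr_gt0 // lt_min s0 t0.
have : Num.min s t <= s by rewrite ge_min lexx.
have : Num.min s t <= t by rewrite ge_min lexx orbT.
have : 0 < Num.min s t by rewrite lt_min s0 t0.
by move=> *; split; lra.
Qed.

Lemma lt_all (s : seq R) : all (fun q : R => 0 < q) s ->
  exists2 r : R, 0 < r & all (fun q : R => r < q) s.
Proof.
elim: s => [_|q s IH /= /andP[x0 /IH[r r0 rs]]]; first by exists 1.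
have [t t0 [tx tr]] := min_gt0 x0 r0; exists t; rewrite // tx /=.
by apply: sub_all rs => y; exact: lt_trans.
Qed.

Lemma is_derive_line g x v t : derivable g (x + t *: v) v ->
  is_derive t (1 : R) (fun s => g (x + s *: v)) ('D_v g (x + t *: v)).
Proof.
have E : (fun h : R => h^-1 *: (((fun s => g (x + s *: v)) \o shift t) (h *: (1 : R))
    - g (x + t *: v))) =
  (fun h => h^-1 *: ((g \o shift (x + t *: v)) (h *: v) - g (x + t *: v))).
  apply/funext => h /=; congr (_ *: (g _ - _)).
  by rewrite [h *: 1]mulr1 scalerDl addrCA addrC.
by move=> d; apply: DeriveDef; rewrite /derivable /derive E.
Qed.

Lemma is_derive_shift g x v z : derivable g (x + z) v ->
  is_derive x v (fun y => g (y + z)) ('D_v g (x + z)).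
Proof.
have E : (fun h : R => h^-1 *: (((fun y => g (y + z)) \o shift x) (h *: v) - g (x + z))) =
  (fun h => h^-1 *: ((g \o shift (x + z)) (h *: v) - g (x + z))).
  by apply/funext => h /=; rewrite addrA.
by move=> d; apply: DeriveDef; rewrite /derivable /derive E.
Qed.

Lemma MVT_line g x v t :
  (forall s : R, `|s| <= `|t| -> derivable g (x + s *: v) v) ->
  exists s : R, `|s| <= `|t| /\ g (x + t *: v) - g x = t * 'D_v g (x + s *: v).
Proof.
move=> H; pose F (s : R) := g (x + s *: v); pose dF (s : R) : R := 'D_v g (x + s *: v).
have dd (s : R) : `|s| <= `|t| -> is_derive s 1 F (dF s) by move=> /H /is_derive_line.
have ct s : `|s| <= `|t| -> {for s, continuous F}.
  by move=> /dd ?; apply/differentiable_continuous/derivable1_diffP.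
have F0 : F 0 = g x by rewrite /F scale0r addr0.
have [t0|t0] := leP 0 t.
  have [||s] := @MVT_segment R F dF 0 t t0.
  - move=> s; rewrite in_itv /= => /andP[s0 st]; apply: dd.
    by rewrite !ger0_norm // ltW.
  - apply: continuous_in_subspaceT => s; rewrite inE /= in_itv /= => /andP[s0 st].
    by apply: ct; rewrite !ger0_norm.
  rewrite in_itv /= F0 subr0 => /andP[s0 st] E; exists s.
  by rewrite !ger0_norm // E mulrC.
have [||s] := @MVT_segment R F dF t 0 (ltW t0).
- move=> s; rewrite in_itv /= => /andP[ts s0]; apply: dd.
  by rewrite !ltr0_norm // lerN2 ltW.
- apply: continuous_in_subspaceT => s; rewrite inE /= in_itv /= => /andP[ts s0].
  by apply: ct; rewrite (ltr0_norm t0) ler0_norm // lerN2.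
rewrite in_itv /= F0 sub0r mulrN => /andP[ts s0] E; exists s; split.
  by rewrite (ltr0_norm t0) ler0_norm // lerN2.
by move: E; rewrite -/(F t) -/(dF s); lra.
Qed.

(** A staircase from [y'] to [y]: one coordinate changes at each step, so the mean value theorem
    along a basis vector controls each increment. *)
Definition splice y' y (k : nat) : V := \row_j (if (j < k)%N then y 0 j else y' 0 j).

Lemma spliceS y' y (k : 'I_n.+1) :
  splice y' y k.+1 = splice y' y k + (y - y') 0 k *: ev k.
Proof.
apply/rowP => j; rewrite !mxE eqxx ltnS leq_eqVlt /= -val_eqE /=.
have [E|jk] := eqVneq (val j) (val k) => /=; last by ring.
rewrite E ltnn (val_inj E) /=; ring.
Qed.

Lemma splice_dist x y' y k :
  enorm (splice y' y k - x) <= enorm (y - x) + enorm (y' - x).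
Proof.
apply: enorm_le; first by rewrite addr_ge0 ?enorm_ge0.
apply: (@le_trans _ _ (dot (y - x) (y - x) + dot (y' - x) (y' - x))).
  rewrite /dot -big_split /=; apply: ler_sum => i _; rewrite !mxE.
  case: ifP => _; rewrite -!expr2; first by rewrite lerDl sqr_ge0.
  by rewrite lerDr sqr_ge0.
by rewrite !dotxx; have := enorm_ge0 (y - x); have := enorm_ge0 (y' - x); nra.
Qed.

(* Continuity of the partial derivatives at a point gives differentiability there
   in the strict sense: both endpoints of the increment may vary. *)
Lemma strict_diff g x (p : V) :
  (forall e : R, 0 < e -> exists d : R, 0 < d /\ forall z, enorm (z - x) < d ->
     forall i, derivable g z (ev i) /\ `|'D_(ev i) g z - p 0 i| <= e) ->
  forall e : R, 0 < e -> exists d : R, 0 < d /\ forall y y',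
     enorm (y - x) < d -> enorm (y' - x) < d ->
     `|g y - g y' - dot p (y - y')| <= e * enorm (y - y').
Proof.
move=> H e e0; have N0 : 0 < n.+1%:R :> R by rewrite ltr0n.
have [d [d0 hd]] := H (e / n.+1%:R) (divr_gt0 e0 N0).
exists (d / 4); split; first by rewrite divr_gt0.
move=> y y' yd y'd; pose G k := g (splice y' y k).
have -> : g y - g y' = \sum_(k < n.+1) (G k.+1 - G k).
  rewrite -(big_mkord xpredT (fun k => G k.+1 - G k)) telescope_sumr //.
  congr (g _ - g _); apply/rowP => j; rewrite mxE ?ltn_ord //.
have -> : dot p (y - y') = \sum_(k < n.+1) p 0 k * (y - y') 0 k by [].
rewrite -sumrB; apply: le_trans (ler_norm_sum _ _ _) _.
apply: (@le_trans _ _ (\sum_(k < n.+1) e / n.+1%:R * enorm (y - y'))); last first.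
  rewrite sumr_const card_ord -mulr_natr le_eqVlt; apply/orP; left; apply/eqP.
  by field; rewrite addr_eq0 gt_eqF // (lt_le_trans _ (ler0n _ _)) // oppr_lt0.
apply: ler_sum => k _; rewrite /G spliceS; set q := splice y' y k; set t := (y - y') 0 k.
have tk : `|t| <= enorm (y - y') by exact: coord_le_enorm.
have yy : enorm (y - y') < d / 2.
  by have := enorm_tri y x y'; rewrite (enormB x y'); lra.
have near s : `|s| <= `|t| -> enorm (q + s *: ev k - x) < d.
  move=> st; have := enormD (q - x) (s *: ev k).
  have -> : q - x + s *: ev k = q + s *: ev k - x by rewrite addrAC.
  rewrite enormZ enorm_ev mulr1; have := splice_dist x y' y k; rewrite -/q; lra.
have [s [st ->]] := @MVT_line g q (ev k) t (fun s st => (hd _ (near s st) k).1).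
rewrite (_ : _ - _ = t * ('D_(ev k) g (q + s *: ev k) - p 0 k)); last by ring.
rewrite normrM mulrC ler_pM // ; exact: (hd _ (near s st) k).2.
Qed.

(** The second difference of [g] over a square of side t is symmetric in the two directions. The
    mean value theorem, applied in one direction to the increment in the other, makes it t^2 H k l
    up to o(t^2), for which strict differentiability of the first partials at [x] suffices. *)
Lemma mixed_partials g x (H : 'M[R]_n.+1) (d0 : R) : 0 < d0 ->
  (forall z i, enorm (z - x) < d0 -> derivable g z (ev i)) ->
  (forall i (e : R), 0 < e -> exists d : R, 0 < d /\ forall y y',
     enorm (y - x) < d -> enorm (y' - x) < d ->
     `|'D_(ev i) g y - 'D_(ev i) g y' - dot (row i H) (y - y')| <= e * enorm (y - y')) ->
  forall i j, H i j = H j i.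
Proof.
move=> d00 Hd Hs i j.
have key k l (e : R) : 0 < e -> exists d : R, 0 < d /\ forall t, 0 < t -> t < d ->
    `|g (x + t *: ev l + t *: ev k) - g (x + t *: ev k) - g (x + t *: ev l) + g x
       - t ^+ 2 * H k l| <= e * t ^+ 2.
  move=> e0; have [d [dp hd]] := Hs k e e0.
  have [d' d'0 [dd0 dd]] := min_gt0 d00 dp; exists (d' / 2); split; first by rewrite divr_gt0.
  move=> t t0 td; have {}td0 : t < d0 / 2 by lra.
  have {}td : t < d / 2 by lra.
  have En r s : enorm (x + r *: ev l + s *: ev k - x) <= `|r| + `|s|.
    rewrite (_ : _ - x = r *: ev l + s *: ev k); last by rewrite addrAC [x + _]addrC addrK.
    by apply: le_trans (enormD _ _) _; rewrite !enormZ !enorm_ev !mulr1.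
  pose G z := g (z + t *: ev l) - g z.
  have D s : `|s| <= `|t| -> is_derive (x + s *: ev k) (ev k) G
      ('D_(ev k) g (x + t *: ev l + s *: ev k) - 'D_(ev k) g (x + s *: ev k)).
    move=> st; have st0 : `|s| <= t by rewrite (gtr0_norm t0) in st.
    have d1 : derivable g (x + t *: ev l + s *: ev k) (ev k).
      by apply: Hd; apply: le_lt_trans (En _ _) _; rewrite (gtr0_norm t0); lra.
    have d2 : derivable g (x + s *: ev k) (ev k).
      have := En 0 s; rewrite scale0r addr0 normr0 => h; apply: Hd; lra.
    have /is_derive_shift h1 : derivable g (x + s *: ev k + t *: ev l) (ev k) by rewrite addrAC.
    by rewrite (addrAC x) in h1; apply: is_deriveB; exact/derivableP.
  have [s [st Es]] := @MVT_line G x (ev k) t (fun s st => @ex_derive _ _ _ _ _ _ _ (D s st)).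
  have st0 : `|s| <= t by rewrite (gtr0_norm t0) in st.
  have := Es; rewrite (@derive_val _ _ _ _ _ _ _ (D s st)) /G.
  rewrite (addrAC x (t *: ev k)) => E.
  have -> : g (x + t *: ev l + t *: ev k) - g (x + t *: ev k) - g (x + t *: ev l) + g x
      - t ^+ 2 * H k l = t * ('D_(ev k) g (x + t *: ev l + s *: ev k)
       - 'D_(ev k) g (x + s *: ev k) - t * H k l) by move: E; rewrite expr2; lra.
  have n1 : enorm (x + t *: ev l + s *: ev k - x) < d.
    by apply: le_lt_trans (En _ _) _; rewrite (gtr0_norm t0); lra.
  have n2 : enorm (x + s *: ev k - x) < d.
    have := En 0 s; rewrite scale0r addr0 normr0 => h; lra.
  have := hd _ _ n1 n2.
  rewrite (_ : x + t *: ev l + s *: ev k - _ = t *: ev l); last first.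
    by row_ring.
  rewrite dotZr dot_ev mxE enormZ enorm_ev mulr1 normrM (gtr0_norm t0) => h.
  by rewrite expr2 mulrCA ler_pM2l // mulrC.
apply/eqP; rewrite -subr_eq0 -normr_le0; apply/ler_addgt0Pr => e e0; rewrite add0r.
have e20 : 0 < e / 2 by rewrite divr_gt0.
have [d1 [d10 h1]] := key i j _ e20; have [d2 [d20 h2]] := key j i _ e20.
have [t t0 [td1 td2]] := min_gt0 d10 d20.
move: (h1 t t0 td1) (h2 t t0 td2); rewrite (addrAC x (t *: ev i)) => k1 k2.
have tt : 0 < t ^+ 2 by rewrite exprn_gt0.
rewrite -(ler_pM2l tt) -{1}(gtr0_norm tt) -normrM.
by move: k1 k2; rewrite !ler_norml => /andP[? ?] /andP[? ?]; apply/andP; split; lra.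
Qed.

End Calculus.

(** * Outer measure and density points *)

Section Lebesgue.
Variables (R : realType) (n : nat).
Local Notation V := 'rV[R]_n.+1.
Implicit Types (x y z l h : V) (S : set V) (d r s t : R).

Lemma boxvol_ge0 l h : 0 <= boxvol l h.
Proof. by apply: prodr_ge0 => i _; rewrite le_max lexx orbT. Qed.

Lemma lebo_ge0 S : (0 <= lebo S)%E.
Proof.
apply: le_ereal_inf_tmp => _ [l [h [_ ->]]].
by apply: nneseries_ge0 => k _ _; rewrite lee_fin boxvol_ge0.
Qed.

Lemma boxvol00 : boxvol (0 : V) 0 = 0.
Proof. by rewrite /boxvol big_ord_recl mxE subrr maxxx mul0r. Qed.

Lemma lebo0 : lebo (set0 : set V) = 0%E.
Proof.
apply/eqP; rewrite eq_le lebo_ge0 andbT; apply: ereal_inf_lbound.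
exists (fun=> 0), (fun=> 0); split; first exact: sub0set.
by rewrite eseries0 // => k _ _; rewrite boxvol00.
Qed.

Lemma lebo_eball_fin x t : (lebo (eball x t) < +oo)%E.
Proof.
pose l := \row_i (x 0 i - t); pose h := \row_i (x 0 i + t).
apply: (@le_lt_trans _ _ (boxvol l h)%:E); last exact: ltry.
apply: ereal_inf_lbound.
exists (fun k => if k == 0%N then l else 0), (fun k => if k == 0%N then h else 0); split.
  move=> y /= yx; exists 0%N => //= i; rewrite !mxE.
  have := le_lt_trans (coord_le_enorm (y - x) i) yx; rewrite !mxE ltr_norml.
  by move=> /andP[? ?]; apply/andP; split; lra.
rewrite (@nneseries_split _ _ 0%N 1%N) ?add0n; last first.
  by move=> k _; rewrite lee_fin boxvol_ge0.
rewrite big_nat1 /= eseries0 ?adde0 // => k k1 _.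
by rewrite (gtn_eqF k1) boxvol00.
Qed.

(** Counts grid indices in an open interval. The auxiliary bound forgets the right end; it is used
    at indices N below [q], where N - p is already less than q - p. *)
Lemma count_between N (p q : R) :
  \sum_(j < N) ((p < j%:R < q)%R%:R : R) <= Num.max (q - p) 0 + 1.
Proof.
have H M : \sum_(j < M) ((p < j%:R < q)%R%:R : R) <= Num.max (M%:R - p) 0.
  elim: M => [|M IH]; first by rewrite big_ord0 le_max lexx orbT.
  rewrite big_ord_recr /=; case: (leP M%:R p) => pN.
    rewrite /= addr0; apply: le_trans IH _.
    by rewrite max_r ?le_max ?lexx ?orbT // subr_le0.
  have Mp : 0 <= M%:R - p by rewrite subr_ge0 ltW.
  move: IH; rewrite (max_l Mp) => IH.
  apply: (@le_trans _ _ (M.+1%:R - p)); last by rewrite le_max lexx.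
  by rewrite -natr1; case: (M%:R < q); rewrite /= ?andbT ?andbF; lra.
elim: N => [|N IH]; first by rewrite big_ord0 addr_ge0 // le_max lexx orbT.
rewrite big_ord_recr /=; have [/andP[pN Nq]|_] := boolP (p < N%:R < q); last first.
  by rewrite addr0.
rewrite lerD2r; apply: le_trans (H N) _.
rewrite max_l; last by rewrite subr_ge0 ltW.
by rewrite le_max lerD2r ltW.
Qed.

(** Volume by counting: the cube holds (N+1)^(n+1) points of a grid of step c = 2s/(N+1), each lies
    in some box, and a box with sides m_i holds at most the product of the m_i/c + 1 of them.
    Multiply by c^(n+1) and let N grow. *)
Lemma grid_cover K (l h : nat -> V) x s : 0 < s ->
  (forall y, (forall i, `|y 0 i - x 0 i| <= s) -> exists2 k, (k < K)%N & box (l k) (h k) y) ->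
  (2 * s) ^+ n.+1 <= \sum_(k < K) boxvol (l k) (h k).
Proof.
move=> s0 cov; pose m k i := Num.max (h k 0 i - l k 0 i) 0.
have step N : (2 * s) ^+ n.+1 <= \sum_(k < K) \prod_i (m k i + 2 * s * N.+1%:R^-1).
  pose y (g : {ffun 'I_n.+1 -> 'I_N.+1}) : V := \row_i (x 0 i - s + 2 * s * (g i)%:R / N.+1%:R).
  have N0 : 0 < N.+1%:R :> R by rewrite ltr0n.
  have S2 : 0 < 2 * s by rewrite mulr_gt0.
  pose c := 2 * s / N.+1%:R; have c0 : 0 < c by rewrite divr_gt0.
  have E i (g : {ffun 'I_n.+1 -> 'I_N.+1}) : y g 0 i = x 0 i - s + c * (g i)%:R.
    by rewrite mxE /c; congr (_ + _); rewrite mulrAC.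
  have yQ g i : `|y g 0 i - x 0 i| <= s.
    have gN : c * (g i)%:R <= 2 * s.
      rewrite /c mulrAC ler_pdivrMr // ler_pM2l // ler_nat; exact/ltnW/ltn_ord.
    have g0 : 0 <= c * (g i)%:R by rewrite mulr_ge0 // ltW.
    by rewrite E ler_norml; apply/andP; split; lra.
  pose b k i (j : 'I_N.+1) : R := (l k 0 i < x 0 i - s + c * j%:R < h k 0 i)%R%:R.
  have H1 : N.+1%:R ^+ n.+1 <= \sum_(k < K) \prod_i \sum_(j < N.+1) b k i j.
    under [leRHS]eq_bigr => k _ do rewrite bigA_distr_bigA /=.
    rewrite exchange_big /=.
    have -> : N.+1%:R ^+ n.+1 = \sum_(g : {ffun 'I_n.+1 -> 'I_N.+1}) (1 : R).
      by rewrite sumr_const card_ffun !card_ord natrX.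
    apply: ler_sum => g _; have [k kK bk] := cov (y g) (yQ g).
    rewrite (bigD1 (Ordinal kK)) //= big1 => [|i _].
      rewrite lerDl; apply: sumr_ge0 => k' _; apply: prodr_ge0 => i _; exact: ler0n.
    by have := bk i; rewrite E /b => ->.
  have H2 k i : \sum_(j < N.+1) b k i j <= (m k i + c) / c.
    pose p := (l k 0 i - x 0 i + s) / c; pose q := (h k 0 i - x 0 i + s) / c.
    have -> : (m k i + c) / c = Num.max (q - p) 0 + 1.
      rewrite mulrDl divff ?gt_eqF //; congr (_ + _).
      rewrite /m maxr_pMl ?invr_ge0 ?ltW // mul0r; congr (Num.max _ _).
      by rewrite /p /q; field; rewrite gt_eqF.
    apply: le_trans (count_between N.+1 p q); rewrite le_eqVlt; apply/orP; left; apply/eqP.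
    apply: eq_bigr => j _; rewrite /b /p /q ltr_pdivrMr // ltr_pdivlMr //; congr ((_ && _)%:R).
      by apply/idP/idP; lra.
    by apply/idP/idP; lra.
  have H3 : N.+1%:R ^+ n.+1 <= \sum_(k < K) \prod_i ((m k i + c) / c).
    apply: le_trans H1 _; apply: ler_sum => k _; apply: ler_prod => i _.
    by rewrite H2 andbT sumr_ge0 // => j _; exact: ler0n.
  have -> : \sum_(k < K) \prod_i (m k i + c) =
      c ^+ n.+1 * \sum_(k < K) \prod_i ((m k i + c) / c).
    rewrite mulr_sumr; apply: eq_bigr => k _.
    rewrite -[in c ^+ _](card_ord n.+1) -prodr_const -big_split /=.
    by apply: eq_bigr => i _; rewrite mulrC divfK // gt_eqF.
  have -> : 2 * s = c * N.+1%:R by rewrite /c divfK // gt_eqF.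
  by rewrite exprMn ler_pM2l // exprn_gt0.
have F : \sum_(k < K) \prod_(i < n.+1) (m k i + 2 * s * N.+1%:R^-1)
    @[N --> \oo] --> \sum_(k < K) \prod_(i < n.+1) (m k i + 2 * s * (0 : R)).
  apply: cvg_big => [|k _]; first exact: add_continuous.
  apply: cvg_big => [|i _]; first exact: mul_continuous.
  apply: cvgD; first exact: cvg_cst.
  by apply: cvgMr; exact: cvg_harmonic.
have -> : \sum_(k < K) boxvol (l k) (h k) =
    \sum_(k < K) \prod_(i < n.+1) (m k i + 2 * s * (0 : R)).
  by apply: eq_bigr => k _; apply: eq_bigr => i _; rewrite mulr0 addr0.
rewrite -(cvg_lim _ F) //; apply: limr_ge; first by apply/cvg_ex; eexists; exact: F.
exact: nearW.
Qed.

Lemma box_nbhs l h x : box l h x ->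
  exists d : R, 0 < d /\ forall y, enorm (y - x) < d -> box l h y.
Proof.
move=> bx; pose g i := Num.min (x 0 i - l 0 i) (h 0 i - x 0 i).
exists (\big[Num.min/1]_i g i); split.
  elim/big_ind: _ => // [p q p0 q0|i _]; first by rewrite lt_min p0 q0.
  by have /andP[? ?] := bx i; rewrite lt_min !subr_gt0; apply/andP.
move=> y yx i; have := le_lt_trans (coord_le_enorm (y - x) i) yx.
rewrite (bigD1 i) //= lt_min => /andP[+ _]; rewrite /g lt_min !mxE !ltr_norml.
by move=> /andP[/andP[? ?] /andP[? ?]]; apply/andP; split; lra.
Qed.

(** The density quotient divides by this measure, and division by 0 would give 0. The ball contains
    a closed cube; if no finite number of boxes covered it, points missed by the first K boxes would
    accumulate at a point of the cube, whose own open box they would have to enter. Then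
    [grid_cover] applies. *)
Lemma lebo_eball_gt0 x t : 0 < t -> (0 < lebo (eball x t))%E.
Proof.
move=> t0; have N0 : 0 < n.+1%:R :> R by rewrite ltr0n.
pose s := t / 2 / n.+1%:R; have s0 : 0 < s by rewrite !divr_gt0.
have sN : s *+ n.+1 = t / 2 by rewrite -mulr_natr /s divfK // gt_eqF.
have s2 : 0 < (2 * s) ^+ n.+1 by rewrite exprn_gt0 // mulr_gt0.
apply: (@lt_le_trans _ _ ((2 * s) ^+ n.+1)%:E); first by rewrite lte_fin.
apply: le_ereal_inf_tmp => _ [l [h [cov ->]]].
have Qb y : (forall i, `|y 0 i - x 0 i| <= s) -> enorm (y - x) <= t / 2.
  move=> yQ; rewrite -sN; apply: enorm_max; first exact: ltW.
  by move=> i; rewrite !mxE.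
have [K hK] : exists K, forall y, (forall i, `|y 0 i - x 0 i| <= s) ->
    exists2 k, (k < K)%N & box (l k) (h k) y.
  apply: contrapT => /forallNP hN.
  have H K : {y : V | (forall i, `|y 0 i - x 0 i| <= s) /\
      forall k, (k < K)%N -> ~ box (l k) (h k) y}.
    apply: cid; have /existsNP[y /not_implyP[yQ hy]] := hN K.
    by exists y; split=> // k kK bk; apply: hy; exists k.
  pose y K := sval (H K).
  have yQ K := (svalP (H K)).1.
  have yb K : enorm (y K) <= enorm x + t / 2.
    by have := enorm_triB (y K) x; have := Qb _ (yQ K); rewrite /y; lra.
  have [p [g [gk hp]]] := bounded_subseq yb.
  have pQ i : `|p 0 i - x 0 i| <= s.
    apply/ler_addgt0Pr => e e0; have [k ke] := inv_archi e0.
    have := coord_le_enorm (y (g k) - p) i; rewrite !mxE => h1.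
    have h2 : `|y (g k) 0 i - x 0 i| <= s := yQ (g k) i; have h3 := hp k.
    have -> : p 0 i - x 0 i = (y (g k) 0 i - x 0 i) - (y (g k) 0 i - p 0 i) by ring.
    by apply: le_trans (ler_normB _ _) _; rewrite lerD // (le_trans h1) // ltW // (lt_trans h3).
  have [k _ bk] : (\bigcup_k box (l k) (h k)) p.
    apply: cov; apply: le_lt_trans (Qb p pQ) _; lra.
  have [d [d0 hd]] := box_nbhs bk; have [k' k'd] := inv_archi d0.
  pose j := (maxn k k').+1.
  apply: ((svalP (H (g j))).2 k).
    by apply: leq_trans (gk j); rewrite ltnS leq_maxl.
  apply: hd; apply: lt_trans (hp j) _; apply: lt_trans k'd.
  by rewrite ltf_pV2 ?posrE // ltr_nat !ltnS leq_maxr.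
have := grid_cover s0 hK; rewrite -lee_fin => /le_trans; apply.
rewrite -sumEFin -(big_mkord xpredT (fun k => (boxvol (l k) (h k))%:E)).
by apply: nneseries_lim_ge => k _; rewrite lee_fin boxvol_ge0.
Qed.

(** If [S] missed a ball around [x], the quotient would vanish for all small radii. This is the only
    form in which a density hypothesis is used. *)
Lemma density1_nonempty S x : density1 S x ->
  forall d, 0 < d -> exists y, S y /\ enorm (y - x) < d.
Proof.
move=> dS d d0; apply: contrapT => /forallNP hN.
have Z r : 0 < r -> r < d -> S `&` eball x r = set0.
  move=> r0 rd; apply/seteqP; split=> // y [Sy /= yr].
  by apply: (hN y); split=> //; apply: lt_trans rd.
have /cvgrPdist_lt /(_ 1 ltr01) H := dS.
have F : \forall r \near (0 : R)^'+, False.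
  near=> r; have : `|1 - fine (lebo (S `&` eball x r)) / fine (lebo (eball x r))| < 1.
    by near: r.
  rewrite Z; last 2 first.
  - by near: r; exact: nbhs_right_gt.
  - by near: r; exact: nbhs_right_lt.
  by rewrite lebo0 mul0r subr0 normr1 ltxx.
by case: (filter_ex F).
Unshelve. all: by end_near.
Qed.

Lemma density1_near S x d : 0 < d -> (forall y, enorm (y - x) < d -> S y) -> density1 S x.
Proof.
move=> d0 hd; apply: cvg_near_cst; near=> r.
have r0 : 0 < r by near: r; exact: nbhs_right_gt.
have rd : r < d by near: r; exact: nbhs_right_lt.
have -> : S `&` eball x r = eball x r.
  by apply/seteqP; split=> [y []//|y /= yr]; split=> //; apply: hd; apply: lt_trans rd.
rewrite divff // gt_eqF // fine_gt0 // lebo_eball_gt0 //=.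
exact: lebo_eball_fin.
Unshelve. all: by end_near.
Qed.

End Lebesgue.
(** Support from below by a parabola whose opening [C] is common to all points. Only increments
    within the plane are tested, so the component of [g] along [u] is free. *)
Definition prox_sub (R : realType) (n : nat) (C : R) (f : 'rV[R]_n.+1 -> R)
    (a u b g : 'rV[R]_n.+1) :=
  forall z, plane a u z -> f b + dot g (z - b) - C * dot (z - b) (z - b) <= f z.

(** * Semiconvex functions *)

Section Semiconvex.
Variables (R : realType) (n : nat).
Local Notation V := 'rV[R]_n.+1.
Implicit Types (x y z v w b g h : V) (d e r s t C : R) (f : V -> R).

Lemma plane_comb (a u : V) x y t : plane a u x -> plane a u y ->
  plane a u (t *: x + (1 - t) *: y).
Proof.
rewrite /plane /= => hx hy.
have -> : t *: x + (1 - t) *: y - a = t *: (x - a) + (1 - t) *: (y - a).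
  by row_ring.
by rewrite dotDl !dotZl hx hy !mulr0 addr0.
Qed.

Lemma perpD (u : V) x y : perp u x -> perp u y -> perp u (x + y).
Proof. by rewrite /perp /= dotDl => -> ->; rewrite addr0. Qed.

Lemma perpZ (u : V) t x : perp u x -> perp u (t *: x).
Proof. by rewrite /perp /= dotZl => ->; rewrite mulr0. Qed.

Lemma perpB (u : V) x y : perp u x -> perp u y -> perp u (x - y).
Proof. by rewrite /perp /= dotDl dotNl => -> ->; rewrite subr0. Qed.

Lemma perp_planeB (a u : V) x y : plane a u x -> plane a u y -> perp u (x - y).
Proof.
move=> hx hy; have -> : x - y = (x - a) - (y - a) by row_ring.
exact: perpB.
Qed.

Lemma plane_addr (a u : V) x v : plane a u x -> perp u v -> plane a u (x + v).
Proof. by move=> hx hv; rewrite /plane /= addrAC; exact: perpD. Qed.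

Lemma plane_base (a u : V) : plane a u a.
Proof. by rewrite /plane /= subrr dot0l. Qed.

Lemma semiconvex_ineq f (a u : V) C : convex_on (plane a u) (fun x => C * enorm x ^+ 2 + f x) ->
  forall x y t, plane a u x -> plane a u y -> 0 <= t <= 1 ->
    f (t *: x + (1 - t) *: y) <=
      t * f x + (1 - t) * f y + C * (t * (1 - t)) * dot (x - y) (x - y).
Proof.
move=> cf x y t hx hy t01; have := cf x y t hx hy t01.
rewrite !enorm_sqr !dotE (dotC y x); lra.
Qed.

(** For a semiconvex function a local subgradient is global: compare the local bound at t z + (1-t)
    b with semiconvexity on the segment, divide by t and let t tend to 0. The opening of the
    parabola is the semiconvexity constant. *)
Lemma prox_sub_of_local f (a u : V) C b g : plane a u b ->
  convex_on (plane a u) (fun x => C * enorm x ^+ 2 + f x) ->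
  (forall e, 0 < e -> exists d, 0 < d /\ forall z, plane a u z -> enorm (z - b) < d ->
    f b + dot g (z - b) - e * enorm (z - b) <= f z) ->
  prox_sub C f a u b g.
Proof.
move=> hb /semiconvex_ineq cf loc z hz; apply/ler_addgt0Pr => e e0.
pose D := enorm (z - b); have D0 : 0 <= D by exact: enorm_ge0.
have D1 : 0 < D + 1 by rewrite ltr_wpDl.
have e1 : 0 < e / 2 / (D + 1) by rewrite !divr_gt0.
have [d [d0 hd]] := loc _ e1.
have CD : 0 < `|C| * (D * D) + 1 by rewrite ltr_wpDl // mulr_ge0 // mulr_ge0.
have [t1 t10 [t1d t11]] := min_gt0 (divr_gt0 d0 D1) (@ltr01 R).
have [t t0 [tt te]] := min_gt0 t10 (divr_gt0 (divr_gt0 e0 (ltr0Sn R 1)) CD).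
have t01 : 0 <= t <= 1 by rewrite !ltW //= (lt_trans tt).
have Ez : t *: z + (1 - t) *: b - b = t *: (z - b).
  by row_ring.
have zd : enorm (t *: z + (1 - t) *: b - b) < d.
  rewrite Ez enormZ gtr0_norm // -/D.
  move: t1d; rewrite ltr_pdivlMr //; nra.
have := cf z b t hz hb t01; have := hd _ (plane_comb t hz hb) zd.
rewrite Ez enormZ (gtr0_norm t0) dotZr dotxx -/D => h1 h2.
have h3 : e / 2 / (D + 1) * (t * D) <= t * (e / 2).
  rewrite mulrCA ler_pM2l // mulrAC ler_pdivrMr // ler_pM2l ?divr_gt0 //; lra.
have h4 : t * (`|C| * (D * D)) <= e / 2.
  move: te; rewrite ltr_pdivlMr // mulrDr; lra.
have h5 : C * (D * D) * - t <= `|C| * (D * D) * t.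
  have := ler_norm (- C); rewrite normrN => hC.
  have : 0 <= D * D * t by rewrite !mulr_ge0 // ltW.
  nra.
rewrite -(ler_pM2l t0).
have : t * (C * (D * D) * - t) <= t * (e / 2) by rewrite ler_pM2l //; lra.
nra.
Qed.

Lemma prox_sub0 f (a u : V) C : convex_on (plane a u) (fun x => C * enorm x ^+ 2 + f x) ->
  diff_zero f a u -> prox_sub C f a u a 0.
Proof.
move=> cf df; apply: prox_sub_of_local => //; first exact: plane_base.
move=> e e0; have [d [d0 hd]] := df e e0; exists d; split=> // z hz zd.
have := hd (z - a) hz zd; have -> : a + (z - a) = z by rewrite addrC subrK.
rewrite dot0l ler_norml => /andP[? _]; lra.
Qed.

Lemma graph_bound f (u : V) (K : R) x y : enorm u = 1 -> 0 <= K ->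
  `|f x - f y| <= K * enorm (x - y) ->
  enorm (x - y - (f x - f y) *: u) <= (1 + K) * enorm (x - y).
Proof.
move=> u1 K0 h; apply: le_trans (enormBD _ _) _; rewrite enormZ u1 mulr1 mulrDl mul1r.
by rewrite lerD2l.
Qed.

(** The epigraph lies on the side of -u, so an outward normal has a positive component along [u].
    The normal inequality at graph points, divided by [dot v u], is then a local subgradient
    inequality, since Lipschitz continuity makes distances on the graph comparable with |z - b|. *)
Lemma prox_sub_of_normal f (a u : V) C (K c0 d : R) b v : enorm u = 1 -> enorm v = 1 ->
  plane a u b -> 0 < d -> 0 <= K -> 0 <= c0 ->
  (forall x y, plane a u x -> plane a u y -> `|f x - f y| <= K * enorm (x - y)) ->
  convex_on (plane a u) (fun x => C * enorm x ^+ 2 + f x) ->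
  (forall y, epif a u f y -> enorm (y - (b - f b *: u)) < d ->
     dot (y - (b - f b *: u)) v <= c0 * dot (y - (b - f b *: u)) (y - (b - f b *: u))) ->
  0 < dot v u /\ prox_sub C f a u b ((dot v u)^-1 *: v).
Proof.
move=> u1 v1 hb d0 K0 c00 lip cf nrm.
have K1 : 0 < 1 + K by lra.
(* Test with the points displaced from the graph by -t u, which belong to the epigraph. *)
have vert : 0 <= dot v u.
  apply/ler_addgt0Pr => e e0; have [t t0 [td te]] := min_gt0 d0 (divr_gt0 e0 (ltr_wpDl c00 (@ltr01 R))).
  have ep : epif a u f (b - (f b + t) *: u) by exists b, (f b + t); split=> //; lra.
  have := nrm _ ep; have -> : b - (f b + t) *: u - (b - f b *: u) = - (t *: u).
    by row_ring.
  rewrite enormN enormZ u1 gtr0_norm // mulr1 !dotE (dotxx u) u1 (dotC u v) => /(_ td) h.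
  move: te; rewrite ltr_pdivlMr ?ltr_wpDl // => te.
  rewrite -(ler_pM2l t0); nra.
have slope z : plane a u z -> enorm (z - b) < d / (1 + K) ->
    dot (z - b) v - (f z - f b) * dot v u <= c0 * (1 + K) ^+ 2 * dot (z - b) (z - b).
  move=> hz zd; have gb := graph_bound u1 K0 (lip z b hz hb).
  have ep : epif a u f (z - f z *: u) by exists z, (f z).
  have E : z - f z *: u - (b - f b *: u) = z - b - (f z - f b) *: u.
    by row_ring.
  have := nrm _ ep; rewrite E => H.
  have {H} := H (le_lt_trans gb _); rewrite mulrC -ltr_pdivlMr // => /(_ zd).
  rewrite (dotDl _ _ v) dotNl dotZl (dotC u v) => /le_trans; apply.
  rewrite -mulrA ler_wpM2l // !dotxx expr2.
  have := enorm_ge0 (z - b); have := enorm_ge0 (z - b - (f z - f b) *: u); nra.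
(* If [v] were orthogonal to [u], moving from [b] along [v] inside the plane would give t <= const
   t^2 for all small t. *)
have vu : 0 < dot v u.
  rewrite lt_def vert andbT; apply/eqP => vu0.
  have [t t0 [td tc]] := min_gt0 (divr_gt0 d0 K1)
    (divr_gt0 (@ltr01 R) (ltr_wpDl (mulr_ge0 c00 (sqr_ge0 (1 + K))) (@ltr01 R))).
  have hz : plane a u (b + t *: v) by apply: plane_addr => //; exact: perpZ.
  have := slope _ hz; rewrite addrAC subrr add0r enormZ v1 gtr0_norm // mulr1 => /(_ td).
  rewrite !dotE dotxx v1 vu0 => h; move: tc; rewrite ltr_pdivlMr; last first.
    by rewrite ltr_wpDl // mulr_ge0 ?sqr_ge0.
  have := mulr_ge0 c00 (sqr_ge0 (1 + K)); nra.
split=> //; apply: prox_sub_of_local => // e e0.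
have dK := divr_gt0 d0 K1; have c1 : 0 < c0 * (1 + K) ^+ 2 + 1.
  by rewrite ltr_wpDl // mulr_ge0 ?sqr_ge0.
have [d1 d10 [d1d d1e]] := min_gt0 dK (divr_gt0 (mulr_gt0 e0 vu) c1).
exists d1; split=> // z hz zd; have := slope z hz (lt_trans zd d1d).
rewrite dotZl (dotC (z - b) v) dotxx => h.
have h1 : c0 * (1 + K) ^+ 2 * (enorm (z - b) * enorm (z - b)) <= e * dot v u * enorm (z - b).
  rewrite mulrA ler_wpM2r ?enorm_ge0 //; move: d1e; rewrite ltr_pdivlMr // => d1e.
  have := mulr_ge0 c00 (sqr_ge0 (1 + K)); have := enorm_ge0 (z - b); nra.
have E : dot v u * ((dot v u)^-1 * dot v (z - b)) = dot v (z - b).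
  by rewrite mulrA mulfV ?mul1r ?gt_eqF.
rewrite -(ler_pM2l vu) mulrBr mulrDr E; lra.
Qed.

Lemma twice_at_slope f (a u p : V) (M : 'M[R]_n.+1) : f a = 0 -> diff_zero f a u ->
  twice_at f a u p M -> forall v, perp u v -> dot p v = 0.
Proof.
move=> fa df tw v hv; apply/eqP; rewrite -normr_le0; apply/ler_addgt0Pr => e e0; rewrite add0r.
have [m [m0 hm]] := mulmx_bound M.
pose N := enorm v + 1; have N0 : 0 < N by rewrite ltr_wpDl // enorm_ge0.
have vN : enorm v <= N by rewrite /N; lra.
have e1 : 0 < e / (2 * N) by rewrite divr_gt0 // mulr_gt0.
have [d1 [d10 h1]] := df _ e1; have [d2 [d20 h2]] := tw 1 ltr01.
have [d d0 [dd1 dd2]] := min_gt0 d10 d20.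
have [t t0 [td te]] := min_gt0 (divr_gt0 d0 N0)
  (divr_gt0 e0 (mulr_gt0 (ltr0Sn R 1) (mulr_gt0 (addr_gt0 m0 (@ltr01 R)) (mulr_gt0 N0 N0)))).
have tv : enorm (t *: v) = t * enorm v by rewrite enormZ gtr0_norm.
have vd : enorm (t *: v) < d.
  by rewrite tv; move: td; rewrite ltr_pdivlMr //; have := enorm_ge0 v; nra.
have := h1 _ (perpZ t hv) (lt_trans vd dd1); have := h2 _ (perpZ t hv) (lt_trans vd dd2).
rewrite fa !subr0 tv !dotZr -scalemxAl dotZl => k2 k1.
have q : `|dot (v *m M) v| <= m * (N * N).
  apply: le_trans (cauchy_schwarz _ _) _.
  apply: le_trans (ler_wpM2r (enorm_ge0 v) (hm v)) _.
  by rewrite -mulrA ler_pM2l // ler_pM ?enorm_ge0.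
have k3 : e / (2 * N) * (t * enorm v) <= t * (e / 2).
  rewrite (_ : e / (2 * N) * (t * enorm v) = t * (e / 2 * (enorm v / N))); last by field; rewrite gt_eqF.
  rewrite ler_pM2l // -[leRHS]mulr1 ler_pM2l ?divr_gt0 // ler_pdivrMr // mul1r //.
move: te; rewrite ltr_pdivlMr; last by rewrite !mulr_gt0 // addr_gt0.
move=> te; have k4 : t * (t * ((m + 1) * (N * N))) <= t * (e / 2) by rewrite ler_pM2l //; lra.
have k5 : enorm v ^+ 2 <= N * N by rewrite expr2; have := enorm_ge0 v; nra.
have k6 : t ^+ 2 * enorm v ^+ 2 <= t ^+ 2 * (N * N) by rewrite ler_wpM2l // sqr_ge0.
have k7 : `|t ^+ 2 * dot (v *m M) v| <= t ^+ 2 * (m * (N * N)).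
  by rewrite normrM ger0_norm ?sqr_ge0 // ler_wpM2l // sqr_ge0.
rewrite -(ler_pM2l t0) -{1}(gtr0_norm t0) -normrM ler_norml.
rewrite exprMn in k2; rewrite expr2 in k2 k6 k7.
move: k1 k2 k7; rewrite !ler_norml => /andP[? ?] /andP[? ?] /andP[? ?].
by apply/andP; split; lra.
Qed.

(** Test the subgradient at a + h with an increment of length s|h| in the direction of the defect
    [D]. The expansions at h and h + k leave |D| at most s (m + C)|h| plus the remainder divided by
    s|h|. The ratio [s] is fixed first, then the remainder is made small against it. *)
Lemma prox_sub_expand f (a u p : V) C (M : 'M[R]_n.+1) : enorm u = 1 -> 0 <= C ->
  M^T = M -> (forall v, perp u v -> dot p v = 0) -> twice_at f a u p M ->
  forall e, 0 < e -> exists d, 0 < d /\ forall h g, perp u h -> enorm h < d ->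
    prox_sub C f a u (a + h) g -> enorm ((g - h *m M) *m pmx u) <= e * enorm h.
Proof.
move=> u1 C0 MT p0 tw e e0; have [m [m0 hm]] := mulmx_bound M.
have mC : 0 < m + C by lra.
have [s s0 [s1 se]] := min_gt0 (@ltr01 R) (divr_gt0 (divr_gt0 e0 (ltr0Sn R 1)) mC).
(* Both remainders together are at most 5 e s |h|^2 / 10, which is e|h|/2 after division by s|h|. *)
have e10 : 0 < e * s / 10 by rewrite divr_gt0 // mulr_gt0.
have [d [d0 hd]] := tw _ e10; exists (d / 2); split; first by rewrite divr_gt0.
move=> h g hh hdl sub; set D := _ *m pmx u.
have hD : perp u D by exact: pmxP.
have quad k : `|dot (k *m M) k| <= m * enorm k ^+ 2.
  apply: le_trans (cauchy_schwarz _ _) _; rewrite expr2 mulrA ler_wpM2r ?enorm_ge0 //.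
have main k : perp u k -> enorm k < d / 2 ->
    dot D k <= (m / 2 + C) * enorm k ^+ 2 + e * s / 10 * (enorm (h + k) ^+ 2 + enorm h ^+ 2).
  move=> hk kd; have hkd : enorm (h + k) < d by have := enormD h k; lra.
  have hhd : enorm h < d by lra.
  have t1 := hd _ (perpD hh hk) hkd; have t2 := hd _ hh hhd.
  have := sub (a + h + k) (plane_addr (plane_add a hh) hk).
  rewrite [a + h + k - _]addrAC subrr add0r -enorm_sqr.
  rewrite (p0 _ hh) subr0 in t2; rewrite (p0 _ (perpD hh hk)) subr0 (addrA a) in t1.
  have sy : dot (k *m M) h = dot (h *m M) k by rewrite dot_mulmx_tr MT dotC.
  rewrite /D dot_pmx // dotDl dotNl.
  move: t1 t2 (quad k); rewrite mulmxDl dotDl !dotDr sy !ler_norml.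
  by move=> /andP[? ?] /andP[? ?] /andP[? ?] ?; lra.
have [D0|D0] := eqVneq D 0; first by rewrite D0 enorm0 mulr_ge0 ?enorm_ge0 // ltW.
have [v [v1 Ev]] := unit_dir D0.
have hv : perp u v.
  by move: hD; rewrite Ev /perp /= dotZl => /eqP; rewrite mulf_eq0 gt_eqF ?enorm_gt0 //= => /eqP.
(* At [a] itself there is no scale |h|; increments tending to 0 show that the defect vanishes. *)
have [h0|h0] := eqVneq h 0.
  rewrite {1}h0 enorm0 mulr0; apply/ler_addgt0Pr => r r0; rewrite add0r.
  have c0 : 0 < m + C + e * s by rewrite addr_gt0 // mulr_gt0.
  have [t t0 [td tr]] := min_gt0 (divr_gt0 d0 (ltr0Sn R 1)) (divr_gt0 r0 c0).
  have := main _ (perpZ t hv); rewrite enormZ v1 gtr0_norm // mulr1 => /(_ td).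
  rewrite h0 add0r enorm0 enormZ v1 (gtr0_norm t0) mulr1 expr0n addr0 {1}Ev dotZl dotZr dotxx v1.
  move: tr; rewrite ltr_pdivlMr // => tr k1.
  have : t * enorm D <= t * (t * (m + C + e * s)) by have := mulr_gt0 e0 s0; nra.
  by rewrite ler_pM2l //; lra.
have hp : 0 < enorm h by rewrite enorm_gt0.
have shd : enorm ((s * enorm h) *: v) < d / 2.
  by rewrite enormZ v1 mulr1 gtr0_norm ?mulr_gt0 //; nra.
have := main _ (perpZ _ hv) shd; rewrite {1}Ev dotZl dotZr dotxx v1 !mulr1.
have n1 : enorm ((s * enorm h) *: v) = s * enorm h.
  by rewrite enormZ v1 mulr1 gtr0_norm ?mulr_gt0.
have n2 : enorm (h + (s * enorm h) *: v) <= 2 * enorm h.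
  by apply: le_trans (enormD _ _) _; rewrite n1; nra.
have n3 : enorm (h + (s * enorm h) *: v) ^+ 2 <= 4 * enorm h ^+ 2.
  by have := enorm_ge0 (h + (s * enorm h) *: v); rewrite !expr2; nra.
rewrite n1 => k1.
have k2 : enorm D * (s * enorm h) <= (s * (m + C) + e / 2) * enorm h * (s * enorm h).
  apply: (le_trans k1).
  have k3 : e * s / 10 * (enorm (h + (s * enorm h) *: v) ^+ 2 + enorm h ^+ 2) <= e * s / 10 * (5 * enorm h ^+ 2).
    by rewrite ler_pM2l //; lra.
  have : (m / 2 + C) * (s * enorm h) ^+ 2 <= (m + C) * (s * enorm h) ^+ 2.
    by rewrite ler_wpM2r ?sqr_ge0 //; lra.
  rewrite !expr2 in k3 *; lra.
rewrite ler_pM2r ?mulr_gt0 // in k2; apply: (le_trans k2); rewrite ler_pM2r //.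
by move: se; rewrite ltr_pdivlMr //; lra.
Qed.

(* Second-order differentiability at [a] of a semiconvex [f] from proximal subgradients
   that are known to first order at points [b] dense enough near [a]. *)
Section TwiceFromSubgradients.
Variables (f : V -> R) (a u : V) (C K : R) (S : 'M[R]_n.+1).
Hypotheses (C_ge0 : 0 <= C) (K_ge0 : 0 <= K) (fa : f a = 0)
  (f_sc : forall x y t, plane a u x -> plane a u y -> 0 <= t <= 1 ->
    f (t *: x + (1 - t) *: y) <=
      t * f x + (1 - t) * f y + C * (t * (1 - t)) * dot (x - y) (x - y))
  (f_lip : forall x y, plane a u x -> plane a u y -> `|f x - f y| <= K * enorm (x - y))
  (f_sub0 : prox_sub C f a u a 0).

Definition approx_sub e h b g :=
  [/\ plane a u b, enorm (b - (a + h)) <= e * enorm h, enorm (g - h *m S) <= e * enorm h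
    & prox_sub C f a u b g].

Hypothesis (S_sub : forall e, 0 < e -> exists d, 0 < d /\ forall h, perp u h -> enorm h < d ->
   exists b g, approx_sub e h b g).

Local Ltac keep_section := clear -C_ge0 K_ge0 fa f_sc f_lip f_sub0 S_sub.

(** A subgradient at [b] bounds [f] near a + h only from below. For an upper bound write a + h =
    (1-e) b + e p: since |a + h - b| <= e|h|, the point [p] on the prolonged segment stays within
    3|h| of [a]. *)
Lemma approx_sub_interp e h b g : 0 < e <= 1 -> perp u h -> approx_sub e h b g ->
  exists p, [/\ plane a u p, enorm (p - a) <= 3 * enorm h &
    f (a + h) <= (1 - e) * f b + e * f p + C * e * enorm h ^+ 2].
Proof.
move=> /andP[e0 e1] hh [hb be _ _]; pose w := (a + h) - b.
have wE : enorm (e^-1 *: w) <= enorm h.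
  rewrite enormZ gtr0_norm ?invr_gt0 // -(ler_pM2l e0) mulrA mulfV ?gt_eqF // mul1r.
  by rewrite /w enormB.
have hw : perp u w by apply: (perp_planeB (a := a)) => //; exact: plane_add.
exists (b + e^-1 *: w); split.
- by apply: plane_addr => //; exact: perpZ.
- have -> : b + e^-1 *: w - a = (b - (a + h)) + h + e^-1 *: w.
    by row_ring.
  apply: le_trans (enormD _ _) _; have := enormD (b - (a + h)) h.
  have := enorm_ge0 h; nra.
have e01 : 0 <= e <= 1 by rewrite ltW.
have hp : plane a u (b + e^-1 *: w) by apply: plane_addr => //; exact: perpZ.
have := f_sc hp hb e01.
have -> : e *: (b + e^-1 *: w) + (1 - e) *: b = a + h.
  by apply/rowP => i; rewrite !mxE; field; rewrite gt_eqF.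
have -> : b + e^-1 *: w - b = e^-1 *: w by rewrite addrAC subrr add0r.
rewrite dotxx => /le_trans; apply; rewrite addrC [e * _ + _]addrC addrC lerD2l.
have XX : enorm (e^-1 *: w) * enorm (e^-1 *: w) <= enorm h ^+ 2.
  by rewrite expr2 ler_pM ?enorm_ge0.
have ee : 0 <= e * (1 - e) by rewrite mulr_ge0 ?subr_ge0 // ltW.
apply: le_trans (ler_wpM2l (mulr_ge0 C_ge0 ee) XX) _.
rewrite ler_wpM2r ?sqr_ge0 // ler_wpM2l //; nra.
Qed.

(** The Lipschitz bound gives only f = O(|h|), too weak for the term e f(p) of the interpolation.
    With e = 1/36 and |p - a| <= 3|h|, the ratio f/|h|^2 at scale |h| is at most a constant plus
    9/36 of that at scale 3|h|, and the factor 1/4 keeps the iteration up to a fixed scale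
    bounded. *)
Lemma quadratic_growth : exists c d : R, [/\ 0 < d, 0 <= c &
  forall h, perp u h -> enorm h < d -> f (a + h) <= c * enorm h ^+ 2].
Proof.
have C0 := C_ge0; have [m [m0 hm]] := mulmx_bound S.
have e0 : 0 < (36^-1 : R) by rewrite invr_gt0.
have e1 : 0 < (36^-1 : R) <= 1 by apply/andP; split; lra.
have [d [d0 hd]] := S_sub e0.
pose c2 := 2 * (m + 1) + 5 * C; have c20 : 0 < c2 by rewrite /c2; lra.
have step h : perp u h -> enorm h < d -> exists p, [/\ plane a u p, enorm (p - a) <= 3 * enorm h &
    f (a + h) <= c2 * enorm h ^+ 2 + 36^-1 * f p].
  move=> hh hdl; have [b [g abg]] := hd h hh hdl.
  have [p [hp pa fp]] := approx_sub_interp e1 hh abg; exists p; split=> //.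
  have [hb be gS sub] := abg; have nh := enorm_ge0 h.
  apply: (le_trans fp); have := sub a (plane_base a u); rewrite fa => fb.
  have ba : enorm (a - b) <= 2 * enorm h.
    rewrite enormB; have -> : b - a = (b - (a + h)) + h by row_ring.
    by apply: le_trans (enormD _ _) _; lra.
  have gn : enorm g <= (m + 1) * enorm h.
    by have := enorm_triB g (h *m S); have := hm h; lra.
  have gd : - (2 * (m + 1) * enorm h ^+ 2) <= dot g (a - b).
    apply: le_trans (dot_ge _ _); rewrite lerN2 expr2.
    have -> : 2 * (m + 1) * (enorm h * enorm h) = (m + 1) * enorm h * (2 * enorm h) by ring.
    by rewrite ler_pM ?enorm_ge0.
  have bb : C * dot (a - b) (a - b) <= 4 * C * enorm h ^+ 2.
    rewrite dotxx expr2 (mulrC 4) -!mulrA ler_wpM2l //; have := enorm_ge0 (a - b); nra.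
  have fb2 : f b <= (2 * (m + 1) + 4 * C) * enorm h ^+ 2 by lra.
  have q0 : 0 <= enorm h ^+ 2 by exact: sqr_ge0.
  have q1 : 0 <= (m + 1) * enorm h ^+ 2 by rewrite mulr_ge0 //; lra.
  have q2 : 0 <= C * enorm h ^+ 2 by rewrite mulr_ge0.
  rewrite /c2; lra.
pose d' := d / 2; have d'0 : 0 < d' by rewrite divr_gt0.
(* [K d'] starts the induction at scale [d']; the second term ensures c2 d'^2 + B/4 <= B. *)
pose B := K * d' + 2 * c2 * d' ^+ 2.
have B0 : 0 <= B.
  apply: addr_ge0; first exact: mulr_ge0 K_ge0 (ltW d'0).
  by rewrite mulr_ge0 ?sqr_ge0 //; lra.
have Q k : forall h, perp u h -> 3 ^+ k * enorm h <= d' -> 9 ^+ k * f (a + h) <= B.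
  elim: k => [|k IH] h hh.
    rewrite !mul1r => hk; have := f_lip (plane_add a hh) (plane_base a u).
    rewrite fa subr0 addrAC subrr add0r => /(le_trans (ler_norm _)) h1.
    have h2 : K * enorm h <= K * d' by rewrite ler_wpM2l.
    have h3 : 0 <= 2 * c2 * d' ^+ 2 by rewrite mulr_ge0 ?sqr_ge0 //; lra.
    by rewrite /B; lra.
  move=> hk; have hdl : enorm h < d.
    have : enorm h <= d'; last by rewrite /d'; lra.
    apply: le_trans hk; rewrite ler_peMl ?enorm_ge0 // exprn_ege1 //; lra.
  have [p [hp pa fp]] := step h hh hdl.
  have k9 : 0 < 9 ^+ k.+1 :> R by rewrite exprn_gt0.
  have k3 : 0 < 3 ^+ k :> R by rewrite exprn_gt0.
  have fpB : 9 ^+ k * f p <= B.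
    have -> : p = a + (p - a) by row_ring.
    by apply: IH => //; apply: le_trans hk; rewrite exprSr -mulrA ler_pM2l.
  rewrite -(ler_pM2l k9) in fp; apply: (le_trans fp).
  have h1 : 9 ^+ k.+1 * enorm h ^+ 2 <= d' ^+ 2.
    have -> : (9 : R) = 3 ^+ 2 by ring.
    rewrite -exprM mulnC exprM -exprMn; apply: lerXn2r => //; rewrite nnegrE; last exact: ltW.
    by rewrite mulr_ge0 ?enorm_ge0 // exprn_ge0.
  have h2 : 9 ^+ k.+1 * (36^-1 * f p) <= B / 4.
    have -> : 9 ^+ k.+1 * (36^-1 * f p) = (9 ^+ k * f p) / 4 by rewrite exprS; field.
    by lra.
  have h3 : c2 * (9 ^+ k.+1 * enorm h ^+ 2) <= c2 * d' ^+ 2 by rewrite ler_pM2l.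
  have h4 : 0 <= K * d' by exact: mulr_ge0 K_ge0 (ltW d'0).
  rewrite mulrDr [9 ^+ _ * (c2 * _)]mulrCA; apply: le_trans (lerD h3 h2) _.
  have h5 : 0 <= c2 * d' ^+ 2 by rewrite mulr_ge0 ?sqr_ge0 ?(ltW c20).
  by rewrite /B; lra.
exists (9 * B / d' ^+ 2), d'; split=> // [|h hh hdl].
  by rewrite divr_ge0 ?sqr_ge0 // mulr_ge0.
have [->|h0] := eqVneq h 0; first by rewrite addr0 fa enorm0 expr0n mulr0.
have hp : 0 < enorm h by rewrite enorm_gt0.
(* The least such exponent is some k + 1: then k triplings stay within [d'], while 9^(k+1)|h|^2
   already exceeds d'^2. *)
have ex : exists k, d' < 3 ^+ k * enorm h.
  have [k hk] := inv_archi (divr_gt0 hp d'0); exists k.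
  move: hk; rewrite invf_plt ?posrE ?divr_gt0 // invf_div ltr_pdivrMr // => /lt_le_trans; apply.
  rewrite ler_pM2r // -natrX ler_nat; exact: ltn_expl.
case: (ex_minnP ex) => -[|k] hk mink; first by move: hk; rewrite mul1r; lra.
have h1 : 3 ^+ k * enorm h <= d' by rewrite leNgt; apply/negP => /mink; rewrite ltnn.
have k9 : 0 < 9 ^+ k :> R by rewrite exprn_gt0.
rewrite -(ler_pM2l k9); apply: le_trans (Q k h hh h1) _.
have -> : 9 ^+ k * (9 * B / d' ^+ 2 * enorm h ^+ 2) = B * (9 ^+ k.+1 * enorm h ^+ 2 / d' ^+ 2).
  by rewrite (exprS 9 k); move: (B) (d' ^- 2) (9 ^+ k) (enorm h ^+ 2) => p0 p1 p2 p3; ring.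
rewrite ler_peMr // ler_pdivlMr ?exprn_gt0 // mul1r.
have -> : (9 : R) = 3 ^+ 2 by ring.
rewrite -exprM mulnC exprM -exprMn; apply: lerXn2r; rewrite ?nnegrE; try exact: ltW.
by rewrite mulr_ge0 ?enorm_ge0 // exprn_ge0.
Qed.

Lemma step_bound (m e s t : R) h g x : (forall y, enorm (y *m S) <= m * enorm y) -> 0 <= m ->
  0 < e <= 1 -> 0 <= s <= 1 -> 0 <= t <= 1 ->
  enorm (g - t *: (h *m S)) <= e * enorm h -> enorm (x - s *: h) <= 2 * e * enorm h ->
  `|dot g x - t * s * dot (h *m S) h| <= (2 * m + 3) * e * enorm h ^+ 2 /\
  dot x x <= (s + 2 * e) ^+ 2 * enorm h ^+ 2.
Proof.
move=> hm m0 /andP[e0 e1] /andP[s0 s1] /andP[t0 t1] hg hx.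
have H0 := enorm_ge0 h; have hS := hm h; have S0 := enorm_ge0 (h *m S).
split; last first.
  rewrite dotxx -exprMn expr2.
  have : enorm x <= (s + 2 * e) * enorm h.
    have := enorm_triB x (s *: h); rewrite enormZ ger0_norm //; lra.
  by move=> k; rewrite ler_pM ?enorm_ge0.
set r := g - _ in hg; set y := x - _ in hx.
have -> : g = t *: (h *m S) + r by rewrite /r addrC subrK.
have -> : x = s *: h + y by rewrite /y addrC subrK.
have -> : dot (t *: (h *m S) + r) (s *: h + y) - t * s * dot (h *m S) h =
   t * dot (h *m S) y + s * dot r h + dot r y by rewrite !dotDl !dotDr !dotZl !dotZr; ring.
have b1 : `|t * dot (h *m S) y| <= 2 * m * e * enorm h ^+ 2.
  rewrite normrM (ger0_norm t0); apply: (@le_trans _ _ (1 * (m * enorm h * (2 * e * enorm h)))).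
    rewrite ler_pM //; apply: le_trans (cauchy_schwarz _ _) _.
    by rewrite ler_pM ?enorm_ge0.
  by rewrite expr2 le_eqVlt; apply/orP; left; apply/eqP; ring.
have b2 : `|s * dot r h| <= e * enorm h ^+ 2.
  rewrite normrM (ger0_norm s0) -[leRHS]mul1r ler_pM //.
  by apply: le_trans (cauchy_schwarz _ _) _; rewrite expr2 mulrA ler_wpM2r.
have b3 : `|dot r y| <= 2 * e * enorm h ^+ 2.
  apply: le_trans (cauchy_schwarz _ _) _.
  apply: (@le_trans _ _ (1 * enorm h * (2 * e * enorm h))); last first.
    by rewrite expr2 le_eqVlt; apply/orP; left; apply/eqP; ring.
  rewrite ler_pM ?enorm_ge0 //; apply: (le_trans hg); by rewrite ler_wpM2r.
have n1 := ler_normD (t * dot (h *m S) y + s * dot r h) (dot r y).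
have n2 := ler_normD (t * dot (h *m S) y) (s * dot r h).
apply: (le_trans n1); move: n2 b1 b2 b3; lra.
Qed.

(** Cut the segment to a + h into N pieces. Subgradients at consecutive approximate points squeeze
    the increment of [f] from both sides, and their sum is a Riemann sum of t dot(hS, h), whence the
    factor 1/2. Discretisation costs |dot(hS, h)|/(2N); the errors from [e] and from the parabolas
    accumulate N times. *)
Lemma chain_bound (m e d : R) h (N : nat) : (forall y, enorm (y *m S) <= m * enorm y) -> 0 <= m ->
  0 < e <= 1 -> (0 < N)%N -> perp u h -> enorm h < d ->
  (forall k, perp u k -> enorm k < d -> exists b g, approx_sub e k b g) ->
  exists b g, approx_sub e h b g /\
   `|f b - 2^-1 * dot (h *m S) h| <=
   N%:R * (((2 * m + 3) * e + C * (N%:R^-1 + 2 * e) ^+ 2) * enorm h ^+ 2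
     + N%:R^-1 ^+ 2 * `|dot (h *m S) h| / 2).
Proof.
move=> hm m0 e01 N0 hh hdl fam; pose s : R := N%:R^-1.
have Np : 0 < N%:R :> R by rewrite ltr0n.
have s0 : 0 < s by rewrite invr_gt0.
have s1 : s <= 1 by rewrite invf_le1 // ler1n.
have s01 : 0 <= s <= 1 by rewrite s1 ltW.
set q := dot (h *m S) h; set E := (_ + _) * _; rewrite -/s.
have [e0 e1] := andP e01; have H0 := enorm_ge0 h.
have IH i : (i <= N)%N -> exists b g, [/\ approx_sub e ((i%:R * s) *: h) b g,
    enorm (b - (a + (i%:R * s) *: h)) <= e * enorm h,
    enorm (g - (i%:R * s) *: (h *m S)) <= e * enorm h &
    `|f b - 2^-1 * (i%:R * s) ^+ 2 * q| <= i%:R * (E + s ^+ 2 * `|q| / 2)].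
  elim: i => [_|i IH iN].
    exists a, 0; rewrite !mul0r !scale0r !addr0 subrr subr0 enorm0 fa.
    have eH : 0 <= e * enorm h by rewrite mulr_ge0 // ltW.
    split=> //; last by rewrite expr0n mulr0 mul0r subrr normr0.
    split; rewrite ?addr0 ?subrr ?mul0mx ?subr0 ?enorm0 ?mulr0 //.
    exact: plane_base.
  have [b [g [[hb _ _ sb] bE gE fb]]] := IH (ltnW iN).
  have t01 j : (j <= N)%N -> 0 <= j%:R * s <= 1.
    move=> jN; apply/andP; split; first by rewrite mulr_ge0 // ltW.
    by rewrite /s ler_pdivrMr // mul1r ler_nat.
  have [t'0 t'1] := andP (t01 _ iN).
  have th : enorm ((i.+1%:R * s) *: h) <= enorm h.
    by rewrite enormZ ger0_norm // ler_piMl.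
  have [b' [g' ab]] := fam _ (perpZ (i.+1%:R * s) hh) (le_lt_trans th hdl).
  have [hb' b'E g'E sb'] := ab; rewrite -scalemxAl in g'E.
  have {}b'E : enorm (b' - (a + (i.+1%:R * s) *: h)) <= e * enorm h.
    by apply: (le_trans b'E); rewrite ler_pM2l.
  have {}g'E : enorm (g' - (i.+1%:R * s) *: (h *m S)) <= e * enorm h.
    by apply: (le_trans g'E); rewrite ler_pM2l.
  exists b', g'; split=> //.
  have dE : enorm (b' - b - s *: h) <= 2 * e * enorm h.
    have -> : b' - b - s *: h = (b' - (a + (i.+1%:R * s) *: h)) - (b - (a + (i%:R * s) *: h)).
      by apply/rowP => j; rewrite !mxE -natr1; ring.
    by apply: le_trans (enormBD _ _) _; lra.
  have [k1 k2] := step_bound hm m0 e01 s01 (t01 _ (ltnW iN)) gE dE.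
  have [k3 _] := step_bound hm m0 e01 s01 (t01 _ iN) g'E dE.
  have up := sb b' hb'; have lo := sb' b hb.
  have Eb : b - b' = - (b' - b) by rewrite opprB.
  rewrite Eb dotNr dotNl dotNr opprK in lo.
  have k4 : C * dot (b' - b) (b' - b) <= C * ((s + 2 * e) ^+ 2 * enorm h ^+ 2) by rewrite ler_wpM2l.
  rewrite -/q in k1 k3; rewrite -natr1 in k3 *.
  have EE : E = (2 * m + 3) * e * enorm h ^+ 2 + C * ((s + 2 * e) ^+ 2 * enorm h ^+ 2).
    by rewrite /E -/s; ring.
  have X1 : (i%:R + 1) * s * s * q = i%:R * s * s * q + s ^+ 2 * q by ring.
  have X2 : 2^-1 * ((i%:R + 1) * s) ^+ 2 * q =
    2^-1 * (i%:R * s) ^+ 2 * q + i%:R * s * s * q + s ^+ 2 * q / 2 by field.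
  have X3 : `|s ^+ 2 * q| <= s ^+ 2 * `|q| by rewrite normrM ger0_norm // sqr_ge0.
  rewrite X1 in k3; rewrite X2.
  have X4 : (i%:R + 1) * (E + s ^+ 2 * `|q| / 2) = i%:R * (E + s ^+ 2 * `|q| / 2) + E + s ^+ 2 * `|q| / 2.
    by ring.
  rewrite X4; move: fb up lo k1 k3 k4 X3; rewrite {X1 X2 X4} EE !ler_norml.
  set P := i%:R * s * s * q; set P2 := 2^-1 * (i%:R * s) ^+ 2 * q; set P3 := i%:R * (_ + _).
  set P4 := s ^+ 2 * q; set P5 := s ^+ 2 * `|q|; set P6 := C * (_ * _); set P7 := C * dot _ _.
  set P8 := _ * e * _; move: P P2 P3 P4 P5 P6 P7 P8 (f b) (f b') (dot g _) (dot g' _).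
  clear -C_ge0 K_ge0 fa f_sc f_lip f_sub0 S_sub; move=> P P2 P3 P4 P5 P6 P7 P8 F F' G G'.
  by move=> /andP[? ?] ? ? /andP[? ?] /andP[? ?] ? /andP[? ?]; apply/andP; split; lra.
have [b [g [ab _ _ fb]]] := IH N (leqnn N).
have NS : N%:R * s = 1 by rewrite /s mulfV // gt_eqF.
by move: ab fb; rewrite NS scale1r expr1n mulr1 => ab fb; exists b, g.
Qed.

(** Only the quadratic form of [S] enters, hence its symmetric part. N is chosen from [r], to beat
    the errors of order 1/N, then [e] from N, then the radius from [e]. *)
Lemma twice_of_subgradients : twice_at f a u 0 (2^-1 *: (S + S^T)).
Proof.
have C0 := C_ge0; have [m [m0 hm]] := mulmx_bound S; have m0' := ltW m0.
have CmC : 0 < C + m + C by lra.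
have [c [d1 [d10 c0 grow]]] := quadratic_growth.
move=> r r0.
have [k hk] := inv_archi (divr_gt0 (divr_gt0 r0 (ltr0Sn R 3)) CmC).
have [N [N0 EN]] : exists N : R, 0 < N /\ k.+1%:R = N by exists k.+1%:R; rewrite ltr0n.
rewrite EN in hk.
(* [W] dominates all coefficients of [e] in the final estimate. *)
pose W := N * (2 * m + 3) + 8 * N * C + m + 1 + 6 * C + 9 * c + 1.
have NC : 0 <= N * C by rewrite mulr_ge0 // ltW.
have Nm : 0 < N * (2 * m + 3) by rewrite mulr_gt0 //; lra.
have W0 : 0 < W by rewrite /W; lra.
have [e e0 [e1 eW]] := min_gt0 (@ltr01 R) (divr_gt0 (divr_gt0 r0 (ltr0Sn R 3)) W0).
have e01 : 0 < e <= 1 by rewrite e0 ltW.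
have [d2 [d20 fam]] := S_sub e0.
have [d d0 [dd1 dd2]] := min_gt0 d10 d20.
exists (d / 3); split; first by rewrite divr_gt0.
move=> h hh hdl; have hd2 : enorm h < d2 by have := enorm_ge0 h; lra.
have [b [g [ab fb]]] := chain_bound hm m0' e01 (ltn0Sn k) hh hd2 fam; rewrite EN in fb.
have [p [hp pa fp]] := approx_sub_interp e01 hh ab.
have H0 := enorm_ge0 h; have q0 := sqr_ge0 (enorm h).
have {grow} gp : f p <= 9 * c * enorm h ^+ 2.
  have -> : p = a + (p - a) by rewrite addrC subrK.
  apply: le_trans (grow (p - a) (perp_planeB hp (plane_base a u)) _) _; first lra.
  have : enorm (p - a) ^+ 2 <= 9 * enorm h ^+ 2 by have := enorm_ge0 (p - a); rewrite !expr2; nra.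
  by move=> k1; rewrite mulrAC mulrC ler_wpM2r.
have [hb be gS sb] := ab.
have ba : enorm (b - a) <= 2 * enorm h.
  have -> : b - a = (b - (a + h)) + h by row_ring.
  apply: le_trans (enormD _ _) _; have := ler_wpM2r H0 (ltW e1); lra.
have fb0 : - (4 * C * enorm h ^+ 2) <= f b.
  have := f_sub0 hb; rewrite fa dot0l dotxx.
  have : C * (enorm (b - a) * enorm (b - a)) <= C * (4 * enorm h ^+ 2).
    by rewrite ler_wpM2l // expr2; have := enorm_ge0 (b - a); nra.
  lra.
have up : f (a + h) <= f b + e * (5 * C + 9 * c) * enorm h ^+ 2.
  apply: (le_trans fp).
  have : e * - f b <= e * (4 * C * enorm h ^+ 2) by rewrite ler_pM2l //; lra.
  have : e * f p <= e * (9 * c * enorm h ^+ 2) by rewrite ler_pM2l.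
  lra.
have lo : f b - e * (m + 1 + C) * enorm h ^+ 2 <= f (a + h).
  apply: le_trans (sb _ (plane_add a hh)).
  have w1 : enorm (a + h - b) <= e * enorm h by rewrite enormB.
  have gn : enorm g <= (m + 1) * enorm h.
    have := enorm_triB g (h *m S); have := hm h; have := ler_wpM2r H0 (ltW e1); lra.
  have k1 : - ((m + 1) * enorm h * (e * enorm h)) <= dot g (a + h - b).
    by apply: le_trans (dot_ge _ _); rewrite lerN2 ler_pM ?enorm_ge0.
  have k2 : C * dot (a + h - b) (a + h - b) <= C * (e * enorm h ^+ 2).
    rewrite ler_wpM2l // dotxx expr2.
    have k3 : enorm (a + h - b) <= 1 * enorm h by apply: (le_trans w1); rewrite ler_wpM2r // ltW.
    rewrite mul1r in k3; rewrite mulrA ler_pM ?enorm_ge0 //.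
  by move: k1 k2; rewrite expr2; keep_section; move=> *; lra.
have qb : `|dot (h *m S) h| <= m * enorm h ^+ 2.
  by apply: le_trans (cauchy_schwarz _ _) _; rewrite expr2 mulrA ler_wpM2r.
have -> : dot (h *m (2^-1 *: (S + S^T))) h = dot (h *m S) h.
  rewrite -scalemxAr dotZl mulmxDr dotDl (dot_mulmx_tr h h S^T) trmxK (dotC h).
  by field.
rewrite fa dot0l !subr0.
have sE : N * N^-1 = 1 by rewrite mulfV // gt_eqF.
have NE : N * (((2 * m + 3) * e + C * (N^-1 + 2 * e) ^+ 2) * enorm h ^+ 2
     + N^-1 ^+ 2 * `|dot (h *m S) h| / 2) <=
   (e * (N * (2 * m + 3) + 8 * N * C) + N^-1 * (C + m + C)) * enorm h ^+ 2.
  have s2 : (N^-1 + 2 * e) ^+ 2 <= 2 * N^-1 ^+ 2 + 8 * e.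
    move: (N^-1) => y; have := sqr_ge0 (y - 2 * e); have : e * e <= e * 1 by rewrite ler_pM2l // ltW.
    by rewrite !expr2; lra.
  have c1 : N * C * (N^-1 + 2 * e) ^+ 2 <= N * C * (2 * N^-1 ^+ 2 + 8 * e) by rewrite ler_wpM2l.
  have c2 : N * C * (2 * N^-1 ^+ 2 + 8 * e) = 2 * N^-1 * C + 8 * e * (N * C).
    by field; rewrite gt_eqF.
  have c3 : N * (N^-1 ^+ 2 * `|dot (h *m S) h| / 2) = N^-1 * `|dot (h *m S) h| / 2.
    by field; rewrite gt_eqF.
  have N'0 : 0 <= N^-1 by rewrite invr_ge0 ltW.
  have c4 : N^-1 * `|dot (h *m S) h| <= N^-1 * (m * enorm h ^+ 2) by rewrite ler_wpM2l.
  rewrite c2 in c1; have c5 := ler_wpM2r q0 c1.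
  have c6 : 0 <= N^-1 * (m * enorm h ^+ 2) by rewrite mulr_ge0 // mulr_ge0.
  by rewrite mulrDr c3; move: c4 c5 c6; keep_section; move=> *; lra.
have {}fb := le_trans fb NE.
move: hk; rewrite ltr_pdivlMr; last by lra.
move=> hk; have hk' : N^-1 * (C + m + C) * enorm h ^+ 2 <= r / 4 * enorm h ^+ 2.
  by rewrite ler_wpM2r // ltW.
move: eW; rewrite ltr_pdivlMr // => eW.
have eW' : e * W * enorm h ^+ 2 <= r / 4 * enorm h ^+ 2 by rewrite ler_wpM2r // ltW.
have z1 : 0 <= e * m * enorm h ^+ 2 by rewrite !mulr_ge0 // ltW.
have z2 : 0 <= e * C * enorm h ^+ 2 by rewrite !mulr_ge0 // ltW.
have z3 : 0 <= e * c * enorm h ^+ 2 by rewrite !mulr_ge0 // ltW.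
have z4 : 0 <= e * enorm h ^+ 2 by rewrite !mulr_ge0 // ltW.
have z5 : 0 <= r * enorm h ^+ 2 by rewrite !mulr_ge0 // ltW.
rewrite /W in eW'; move: fb up lo eW' hk' z1 z2 z3 z4 z5; rewrite !ler_norml.
by keep_section; move=> /andP[? ?] *; apply/andP; split; lra.
Qed.

End TwiceFromSubgradients.

End Semiconvex.

(** * Euclidean distance and proximal normals *)

Section EuclideanNormals.
Variables (R : realType) (n : nat).
Local Notation V := 'rV[R]_n.+1.
Implicit Types (E : set V) (x y b c v : V) (r : R).

Lemma dist_le E x c : E c -> dist E x <= enorm (x - c).
Proof.
move=> Ec; apply: ge_inf; last by exists c.
by exists 0 => _ [b _ <-]; exact: enorm_ge0.
Qed.

Lemma dist_ge E x r : E !=set0 -> (forall c, E c -> r <= enorm (x - c)) -> r <= dist E x.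
Proof.
move=> [c Ec] h; apply: lb_le_inf; last by move=> _ [b Eb <-]; exact: h.
by exists (enorm (x - c)), c.
Qed.

(** Squaring turns the tangent ball condition into a polynomial inequality in [c], [v] and [y], the
    form in which it passes to limits. *)
Lemma ball_proximal c v y r : enorm v = 1 -> 0 <= r ->
  (r <= enorm (c + r *: v - y)) = (2 * r * dot (y - c) v <= dot (y - c) (y - c)).
Proof.
move=> v1 r0; have -> : c + r *: v - y = r *: v - (y - c).
  by row_ring.
rewrite -(@ler_pXn2r _ 2) ?nnegrE ?enorm_ge0 // enorm_sqr.
move: (y - c) => z; rewrite !dotE (dotxx v) v1 (dotC v z) expr2.
by apply/idP/idP; lra.
Qed.

Lemma Neuc_proximal E c v : Neuc E (c, v) ->
  enorm v = 1 /\ exists r, 0 < r /\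
    forall y, E y -> 2 * r * dot (y - c) v <= dot (y - c) (y - c).
Proof.
move=> [/= Ec [v1 [r [r0 dr]]]]; split=> //; exists r; split=> // y Ey.
have /= := dist_le (c + r *: v) Ey; rewrite -(ball_proximal c y v1 (ltW r0)).
by rewrite dr.
Qed.

End EuclideanNormals.

(** * Uniformly convex norms *)

Section UniformlyConvexNorm.
Local Set Default Proof Using "All".
Variables (R : realType) (n : nat).
Local Notation V := 'rV[R]_n.+1.
Local Notation ev := (ev R).
Variables (phi : V -> R) (gamma : R).
Hypotheses (phi_norm : is_norm phi) (phi_C2 : C2_on [set x | x != 0] phi).
Hypotheses (gamma_gt0 : 0 < gamma)
  (phi_uc : convex_on setT (fun x => phi x - gamma * enorm x)).
Implicit Types (x y z u v w : V) (e r s t : R).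

Lemma phi_ge0 x : 0 <= phi x.
Proof. by case: phi_norm. Qed.

Lemma phiZ t x : phi (t *: x) = `|t| * phi x.
Proof. by case: phi_norm. Qed.

Lemma phiD x y : phi (x + y) <= phi x + phi y.
Proof. by case: phi_norm. Qed.

Lemma phi0 : phi 0 = 0.
Proof. by rewrite -(scale0r 0) phiZ normr0 mul0r. Qed.

Lemma phiN x : phi (- x) = phi x.
Proof. by rewrite -scaleN1r phiZ normrN1 mul1r. Qed.

Lemma phi_lb x : gamma * enorm x <= phi x.
Proof.
have := phi_uc (x := x) (y := - x) (t := 2^-1) I I; rewrite scalerN.
have -> : 2^-1 *: x - (1 - 2^-1) *: x = 0.
  by rewrite -scalerBl (_ : _ - _ = 0) ?scale0r //; field.
rewrite phi0 enorm0 enormN phiN => h.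
have : 0 <= (2^-1 : R) <= 1 by lra.
by move/h; lra.
Qed.

Lemma phi_gt0 x : x != 0 -> 0 < phi x.
Proof.
by rewrite -enorm_gt0 => x0; apply: lt_le_trans (phi_lb x); rewrite mulr_gt0.
Qed.

Lemma phi_ub : exists c : R, 0 < c /\ forall x, phi x <= c * enorm x.
Proof.
exists (1 + \sum_i phi (ev i)); split.
  by rewrite ltr_wpDr // sumr_ge0 // => i _; exact: phi_ge0.
move=> x; apply: (@le_trans _ _ (\sum_i phi (x 0 i *: ev i))).
  rewrite {1}(row_sum_ev x); elim/big_ind2: _ => // [|x1 x2 y1 y2 h1 h2].
    by rewrite phi0.
  by apply: le_trans (phiD _ _) _; rewrite lerD.
rewrite mulrDl mul1r mulr_suml; apply: (@le_trans _ _ (\sum_i phi (ev i) * enorm x)).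
  apply: ler_sum => i _; rewrite phiZ mulrC.
  by apply: ler_wpM2l; rewrite ?phi_ge0 // coord_le_enorm.
by rewrite lerDr enorm_ge0.
Qed.

Lemma nonzero_near v : v != 0 -> exists d : R, 0 < d /\ forall y, enorm (y - v) < d -> y != 0.
Proof.
rewrite -enorm_gt0 => v0; exists (enorm v); split=> // y.
by apply: contraTneq => ->; rewrite sub0r enormN ltxx.
Qed.

Lemma partials_near (f : V -> R) (p v : V) (D : V -> Prop) :
  (exists d : R, 0 < d /\ forall y, enorm (y - v) < d -> D y) ->
  (forall y i, D y -> derivable f y (ev i)) ->
  (forall i, {for v, continuous ('D_(ev i) f)}) ->
  (forall i, p 0 i = 'D_(ev i) f v) ->
  forall e : R, 0 < e -> exists d : R, 0 < d /\ forall y, enorm (y - v) < d ->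
     forall i, derivable f y (ev i) /\ `|'D_(ev i) f y - p 0 i| <= e.
Proof.
move=> [d0 [d00 hd0]] df cf pE e e0.
have H i : {d : R | 0 < d /\ forall y, enorm (y - v) < d -> `|'D_(ev i) f y - 'D_(ev i) f v| < e}.
  by apply: cid; have /cvg_enorm := cf i; apply.
have [d [d1 hd]] : exists d : R, 0 < d /\ forall i, d <= sval (H i).
  exists (\big[Num.min/1]_i sval (H i)); split.
    elim/big_ind: _ => // [x y x0 y0|i _]; first by rewrite lt_min x0 y0.
    by case: (svalP (H i)).
  by move=> i; rewrite (bigD1 i) //= ge_min lexx.
have [d' d'0 [dd0 dd1]] := min_gt0 d00 d1.
exists d'; split=> // y yd i; split.
  by apply/df/hd0/(lt_trans yd).
rewrite pE; apply: ltW; apply: (svalP (H i)).2.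
by apply: lt_trans yd _; apply: lt_le_trans dd1 (hd i).
Qed.

Lemma phi_strict v : v != 0 -> forall e : R, 0 < e -> exists d : R, 0 < d /\ forall y y',
  enorm (y - v) < d -> enorm (y' - v) < d ->
  `|phi y - phi y' - dot (grad phi v) (y - y')| <= e * enorm (y - y').
Proof.
move=> v0; apply: strict_diff; case: phi_C2 => _ C1 _.
apply: (partials_near (nonzero_near v0)) => [y i y0|i|i].
- by case: (C1 i y y0).
- by case: (C1 i v v0).
- by rewrite mxE.
Qed.

Lemma gradi_strict v i : v != 0 -> forall e : R, 0 < e -> exists d : R, 0 < d /\ forall y y',
  enorm (y - v) < d -> enorm (y' - v) < d ->
  `|'D_(ev i) phi y - 'D_(ev i) phi y' - dot (row i (hess phi v)) (y - y')| <= e * enorm (y - y').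
Proof.
move=> v0; apply: strict_diff; case: phi_C2 => _ _ C2.
apply: (partials_near (nonzero_near v0)) => [y j y0|j|j].
- by case: (C2 i j y y0).
- by case: (C2 i j v v0).
- by rewrite !mxE.
Qed.

Lemma grad_strict v : v != 0 -> forall e : R, 0 < e -> exists d : R, 0 < d /\ forall y y',
  enorm (y - v) < d -> enorm (y' - v) < d ->
  enorm (grad phi y - grad phi y' - (y - y') *m (hess phi v)^T) <= e * enorm (y - y').
Proof.
move=> v0 e e0; have N0 : 0 < n.+1%:R :> R by rewrite ltr0n.
have H i := cid (gradi_strict i v0 (divr_gt0 e0 N0)).
have [d [d1 hd]] : exists d : R, 0 < d /\ forall i, d <= sval (H i).
  exists (\big[Num.min/1]_i sval (H i)); split.
    elim/big_ind: _ => // [x y x0 y0|i _]; first by rewrite lt_min x0 y0.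
    by case: (svalP (H i)).
  by move=> i; rewrite (bigD1 i) //= ge_min lexx.
exists d; split=> // y y' yd y'd.
have c0 := divr_gt0 e0 N0; have cN : e / n.+1%:R * n.+1%:R = e by rewrite divfK ?gt_eqF.
move: c0 cN (H) (hd) => /=; set c := e / _ => c0 <- {hd} {}H hd.
rewrite mulrAC mulr_natr; apply: enorm_max => [|i].
  by rewrite mulr_ge0 ?enorm_ge0 // ltW.
 have := (svalP (H i)).2 y y' (lt_le_trans yd (hd i)) (lt_le_trans y'd (hd i)).
congr (_ <= _); congr `|_|; rewrite !mxE; congr (_ - _).
by apply: eq_bigr => j _; rewrite !mxE mulrC.
Qed.

Lemma hess_sym v : v != 0 -> (hess phi v)^T = hess phi v.
Proof.
move=> v0; have [d [d0 hd]] := nonzero_near v0; case: phi_C2 => _ C1 _.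
apply/matrixP => i j; rewrite mxE; apply: (@mixed_partials R n phi v _ d d0).
  by move=> z k /hd z0; case: (C1 k z z0).
by move=> k; exact: gradi_strict.
Qed.

Lemma grad_continuous v : v != 0 -> forall e : R, 0 < e -> exists d : R, 0 < d /\
  forall y, enorm (y - v) < d -> enorm (grad phi y - grad phi v) < e.
Proof.
move=> v0 e e0; have [C [C0 hC]] := mulmx_bound (hess phi v)^T.
have [d [d0 hd]] := grad_strict v0 (@ltr01 R).
have [d' d'0 [dd1 dd2]] := min_gt0 d0 (divr_gt0 e0 (addr_gt0 C0 (@ltr01 R))).
exists d'; split=> // y yd.
have := hd y v (lt_trans yd dd1); rewrite subrr enorm0 => /(_ d0) h.
have := enorm_triB (grad phi y - grad phi v) ((y - v) *m (hess phi v)^T).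
have := hC (y - v); move: yd dd2; rewrite ltr_pdivlMr ?addr_gt0 //.
have := enorm_ge0 (y - v); nra.
Qed.

Lemma euler v : v != 0 -> dot (grad phi v) v = phi v.
Proof.
move=> v0; have pv : 0 < enorm v by rewrite enorm_gt0.
apply/eqP; rewrite -subr_eq0 -normr_le0; apply/ler_addgt0Pr => e e0; rewrite add0r.
have [d [d0 hd]] := phi_strict v0 (divr_gt0 e0 pv).
have t0 : 0 < d / (2 * enorm v) by rewrite divr_gt0 // mulr_gt0.
set t := d / (2 * enorm v) in t0.
have E : v + t *: v - v = t *: v by rewrite addrAC subrr add0r.
have tv : t * enorm v = d / 2 by rewrite /t; field; rewrite gt_eqF.
have yd : enorm (v + t *: v - v) < d by rewrite E enormZ gtr0_norm // tv; lra.
have := hd _ v yd; rewrite E subrr enorm0 => /(_ d0).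
rewrite enormZ (gtr0_norm t0) tv.
rewrite (_ : v + t *: v = (1 + t) *: v); last by rewrite scalerDl scale1r.
rewrite phiZ (gtr0_norm (addr_gt0 ltr01 t0)) dotZr.
rewrite (_ : _ - _ - _ = t * (phi v - dot (grad phi v) v)); last by ring.
rewrite normrM (gtr0_norm t0) distrC => h; rewrite -(ler_pM2l t0); apply: le_trans h _.
by rewrite le_eqVlt /t; apply/orP; left; apply/eqP; field; rewrite gt_eqF.
Qed.

(** [phi - gamma |.|] is convex and homogeneous, with gradient [grad phi v - gamma v] at the unit
    vector [v]; by [euler] its supporting affine function there is linear. The excess gamma (|z| -
    v.z) is the quantitative strict convexity behind the monotonicity, ball and stability
    estimates. *)
Lemma phi_support v z : enorm v = 1 ->
  dot (grad phi v) z + gamma * (enorm z - dot v z) <= phi z.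
Proof.
move=> v1; have v0 : v != 0 by rewrite -enorm_gt0 v1.
have pe := euler v0.
suff H : forall e : R, 0 < e ->
    dot (grad phi v) (z - v) - gamma * dot v (z - v) <=
    phi z - phi v - gamma * (enorm z - 1) + e.
  have: dot (grad phi v) (z - v) - gamma * dot v (z - v) <=
    phi z - phi v - gamma * (enorm z - 1) by apply/ler_addgt0Pr.
  by rewrite !dotE pe dotxx v1; lra.
move=> e e0; pose h := z - v; pose N := enorm h.
have N0 : 0 <= N by exact: enorm_ge0.
have e1 : 0 < e / (2 * (N + 1)) by rewrite divr_gt0 // mulr_gt0 // ltr_wpDl.
have [d [d0 hd]] := phi_strict v0 e1.
have [t t0 [t1 t2]] := min_gt0 (divr_gt0 d0 (ltr_wpDl N0 (@ltr01 R)))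
  (divr_gt0 (@ltr01 R) (ltr_wpDl N0 (@ltr01 R))).
have [s s0 [st s2]] := min_gt0 t0 (divr_gt0 e0 (addr_gt0 (mulr_gt0 gamma_gt0
   (ltr_wpDl (mulr_ge0 N0 N0) (@ltr01 R))) (@ltr01 R))).
have sN1 : s * (N + 1) < 1.
  by move: t2; rewrite ltr_pdivlMr ?ltr_wpDl // => t2; nra.
have sN : s * (N + 1) < d.
  by move: t1; rewrite ltr_pdivlMr ?ltr_wpDl // => t1; nra.
have E : v + s *: h - v = s *: h by rewrite addrAC subrr add0r.
have yd : enorm (v + s *: h - v) < d by rewrite E enormZ gtr0_norm // -/N; nra.
have := hd _ v yd; rewrite E subrr enorm0 enormZ (gtr0_norm s0) -/N => /(_ d0).
rewrite dotZr ler_norml => /andP[h1 _].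
(* This is sqrt(1 + x) <= 1 + x/2, used in place of a derivative of the Euclidean norm. *)
have en : enorm (v + s *: h) <= 1 + s * dot v h + s ^+ 2 * N ^+ 2 / 2.
  apply: enorm_le.
    have := dot_ge v h; rewrite v1 mul1r -/N => hh.
    have : 0 <= s ^+ 2 * N ^+ 2 by rewrite mulr_ge0 ?sqr_ge0.
    have : s * N <= 1 by nra.
    by nra.
  have -> : dot (v + s *: h) (v + s *: h) = 1 + 2 * s * dot v h + s ^+ 2 * N ^+ 2.
    rewrite enorm_sqr; move: (h) => k; rewrite !dotE (dotC k v) (dotxx v) v1; ring.
  have : 0 <= (s * dot v h + s ^+ 2 * N ^+ 2 / 2) ^+ 2 by exact: sqr_ge0.
  lra.
have s01 : 0 <= s <= 1 by apply/andP; split; nra.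
have := phi_uc (x := z) (y := v) (t := s) I I s01.
have -> : s *: z + (1 - s) *: v = v + s *: h.
  by row_ring.
rewrite v1 => h2; have := ler_wpM2l (ltW gamma_gt0) en => {}en.
have h3 : s * (dot (grad phi v) h - gamma * dot v h) <=
  s * (phi z - phi v - gamma * (enorm z - 1)) + s * (e / (2 * (N + 1)) * N + gamma * s * N ^+ 2 / 2).
  by move: h1; set k := e / _; rewrite expr2; lra.
rewrite -(ler_pM2l s0); apply: le_trans h3 _; rewrite -mulrDr ler_pM2l // lerD2l.
have : e / (2 * (N + 1)) * N <= e / 2.
  rewrite (_ : e / (2 * (N + 1)) * N = e / 2 * (N / (N + 1))); last first.
    by field; rewrite gt_eqF // ltr_wpDl.
  rewrite -[leRHS]mulr1 ler_pM2l ?divr_gt0 // ler_pdivrMr ?ltr_wpDl //; lra.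
move: s2; rewrite ltr_pdivlMr; last by rewrite addr_gt0 // mulr_gt0 // ltr_wpDl // mulr_ge0.
by rewrite expr2; nra.
Qed.

(** Add the supporting inequalities at [u] and [v]; on the sphere |u - v|^2 = 2 (1 - u.v). *)
Lemma grad_mono u v : enorm u = 1 -> enorm v = 1 ->
  gamma * dot (u - v) (u - v) <= dot (grad phi u - grad phi v) (u - v).
Proof.
move=> u1 v1; have := phi_support v u1; have := phi_support u v1.
have eu := @euler u; have ev := @euler v.
rewrite dot_unit_dist // !dotE (dotC v u) u1 v1.
rewrite eu ?ev -?enorm_gt0 ?u1 ?v1 //; lra.
Qed.

Lemma grad_expand u v : enorm u = 1 -> enorm v = 1 ->
  gamma * enorm (u - v) <= enorm (grad phi u - grad phi v).
Proof.
move=> u1 v1; have [->|uv] := eqVneq u v; first by rewrite !subrr !enorm0 mulr0.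
have uv0 : 0 < enorm (u - v) by rewrite enorm_gt0 subr_eq0.
rewrite -(ler_pM2r uv0) -mulrA -dotxx; apply: le_trans (grad_mono u1 v1) _.
exact: dot_le.
Qed.

Lemma grad_inj u v : enorm u = 1 -> enorm v = 1 -> grad phi u = grad phi v -> u = v.
Proof.
move=> u1 v1 E; have := grad_expand u1 v1; rewrite E subrr enorm0 => h.
apply/eqP; rewrite -subr_eq0; apply/eqP/enorm0_eq0/eqP.
by rewrite eq_le enorm_ge0 andbT -(ler_pM2l gamma_gt0) mulr0.
Qed.

Lemma phi_sub_le u v : enorm u = 1 -> enorm v = 1 ->
  phi v - dot (grad phi u) v <= dot (grad phi v - grad phi u) (v - u).
Proof.
move=> u1 v1; have := phi_support u v1.
rewrite !dotE !euler -?enorm_gt0 ?u1 ?v1 // (dotC v u) => h.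
have : dot u v <= 1 by have := dot_le u v; rewrite u1 v1 mulr1.
by move: gamma_gt0; nra.
Qed.

Lemma min_grad v w : v != 0 -> (forall z, dot w z <= phi z) -> dot w v = phi v ->
  w = grad phi v.
Proof.
move=> v0 wz wv; apply/eqP; rewrite -subr_eq0; set h := w - _.
apply: contraT; rewrite -enorm_gt0 => h0.
have [d [d0 hd]] := phi_strict v0 (divr_gt0 h0 (ltr0Sn R 1)).
pose t := d / (2 * enorm h); have t0 : 0 < t by rewrite divr_gt0 // mulr_gt0.
have E : v + t *: h - v = t *: h by rewrite addrAC subrr add0r.
have th : t * enorm h = d / 2 by rewrite /t; field; rewrite gt_eqF.
have yd : enorm (v + t *: h - v) < d by rewrite E enormZ gtr0_norm // th; lra.
have := hd _ v yd; rewrite subrr enorm0 E enormZ (gtr0_norm t0) dotZr => /(_ d0).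
rewrite ler_norml => /andP[_ h1].
have := wz (v + t *: h); rewrite dotDr dotZr wv => h2.
have : t * dot h h <= enorm h / 2 * (t * enorm h).
  have -> : dot h h = dot w h - dot (grad phi v) h by rewrite {1}/h dotDl dotNl.
  lra.
by rewrite dotxx; nra.
Qed.

Lemma grad_unit_scale u t : enorm u = 1 -> 0 < t -> grad phi (t *: u) = grad phi u.
Proof.
move=> u1 t0; have u0 : u != 0 by rewrite -enorm_gt0 u1.
apply/esym/min_grad; first by rewrite scaler_eq0 negb_or gt_eqF.
  move=> z; have := phi_support z u1; have := dot_le u z; rewrite u1 mul1r.
  by move: gamma_gt0; nra.
by rewrite dotZr phiZ gtr0_norm // euler.
Qed.

Lemma hess_radial u : enorm u = 1 -> u *m (hess phi u)^T = 0.
Proof.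
move=> u1; have u0 : u != 0 by rewrite -enorm_gt0 u1.
apply/eqP; apply: contraT; rewrite -enorm_gt0 => N0.
have [d [d0 hd]] := grad_strict u0 (divr_gt0 N0 (ltr0Sn R 1)).
have E t : (1 + t) *: u - u = t *: u by rewrite scalerDl scale1r addrAC subrr add0r.
have d20 : 0 < d / 2 by rewrite divr_gt0.
have yn : enorm ((1 + d / 2) *: u - u) < d by rewrite E enormZ u1 gtr0_norm //; lra.
have := hd _ u yn; rewrite subrr enorm0 => /(_ d0).
rewrite grad_unit_scale ?addr_gt0 // subrr sub0r enormN E -scalemxAl !enormZ u1.
by rewrite gtr0_norm //; nra.
Qed.

Lemma hess_range u x : enorm u = 1 -> dot (x *m (hess phi u)^T) u = 0.
Proof.
move=> u1; have u0 : u != 0 by rewrite -enorm_gt0 u1.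
by rewrite dot_mulmx_tr trmxK -(hess_sym u0) hess_radial // dot0r.
Qed.

(** Monotonicity of [grad phi] on the sphere is linearised at [u]. The competitor is u + t x
    normalised; its radial displacement is annihilated by the Hessian, so only the tangential part
    (t/s) x counts. Half of [gamma] is lost to the linearisation error. *)
Lemma hess_coercive u x : enorm u = 1 -> dot x u = 0 ->
  gamma / 2 * dot x x <= dot (x *m (hess phi u)^T) x.
Proof.
move=> u1 xu; have u0 : u != 0 by rewrite -enorm_gt0 u1.
have [d [d0 hd]] := grad_strict u0 (divr_gt0 gamma_gt0 (ltr0Sn R 1)).
pose N := enorm x + 1; have N0 : 0 < N by rewrite ltr_wpDl // enorm_ge0.
pose t := d / (2 * N); have t0 : 0 < t by rewrite divr_gt0 // mulr_gt0.
have tN : t * N = d / 2 by rewrite /t; field; rewrite gt_eqF.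
pose s := enorm (u + t *: x).
have s2 : s * s = 1 + t ^+ 2 * dot x x.
  by rewrite -dotxx !dotE (dotC u x) xu (dotxx u) u1; ring.
have s1 : 1 <= s.
  have := dot_ge0 x; have sg : 0 <= s by exact: enorm_ge0.
  move=> xx; have : 0 <= t ^+ 2 * dot x x by rewrite mulr_ge0 ?sqr_ge0.
  by nra.
have s0 : 0 < s by lra.
have [v [v1 E]] : exists v, enorm v = 1 /\ v - u = (t / s) *: x + (s^-1 - 1) *: u.
  exists (s^-1 *: (u + t *: x)); split.
    by rewrite enormZ gtr0_norm ?invr_gt0 // mulVf // gt_eqF.
  by apply/rowP => i; rewrite !mxE; field; rewrite gt_eqF.
have si : 0 < s^-1 <= 1 by rewrite invr_gt0 s0 invf_le1.
have sx : s <= 1 + t * enorm x.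
  by rewrite /s; apply: le_trans (enormD _ _) _; rewrite u1 enormZ gtr0_norm.
have vd : enorm (v - u) < d.
  rewrite E; apply: le_lt_trans (enormD _ _) _; rewrite !enormZ u1 mulr1.
  rewrite (gtr0_norm (divr_gt0 t0 s0)) ler0_norm; last lra.
  have : 1 - s^-1 <= s - 1.
    rewrite -(ler_pM2l s0) mulrBr mulfV ?gt_eqF //; nra.
  have : t / s * enorm x <= t * enorm x.
    by rewrite ler_wpM2r ?enorm_ge0 // -[leRHS]mulr1 ler_pM2l //; case/andP: si.
  have : t * enorm x < d / 2 by rewrite -tN ltr_pM2l // /N; lra.
  lra.
have := hd v u vd; rewrite subrr enorm0 => /(_ d0) h.
have := grad_mono v1 u1.
set q := dot (x *m _) x.
have Ev : (v - u) *m (hess phi u)^T = (t / s) *: (x *m (hess phi u)^T).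
  by rewrite E mulmx_comb (hess_radial u1) scaler0 addr0.
have Eq : dot ((v - u) *m (hess phi u)^T) (v - u) = (t / s) ^+ 2 * q.
  by rewrite Ev E !dotE hess_range // -/q; ring.
have Ex : dot (v - u) (v - u) = (t / s) ^+ 2 * dot x x + (s^-1 - 1) ^+ 2.
  by rewrite E !dotE (dotC u x) xu (dotxx u) u1; ring.
have := dot_le (grad phi v - grad phi u - (v - u) *m (hess phi u)^T) (v - u).
rewrite dotDl dotNl Eq => h1 h2.
have h3 : gamma / 2 * dot (v - u) (v - u) <= (t / s) ^+ 2 * q.
  have : enorm (grad phi v - grad phi u - (v - u) *m (hess phi u)^T) * enorm (v - u)
      <= gamma / 2 * dot (v - u) (v - u).
    by rewrite dotxx mulrA ler_wpM2r ?enorm_ge0.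
  lra.
have ts : 0 < (t / s) ^+ 2 by rewrite exprn_gt0 // divr_gt0.
rewrite -(ler_pM2l ts); apply: le_trans h3; rewrite Ex mulrCA.
by rewrite ler_wpM2l ?lerDl ?sqr_ge0 // ltW // divr_gt0.
Qed.

Lemma sphere_compact : compact [set z : V | enorm z = 1].
Proof.
have -> : [set z : V | enorm z = 1] =
    [set z | enorm z = 1] `&` [set y | enorm (y - 0) <= 1].
  by apply/seteqP; split=> z /= => [z1|[]//]; rewrite subr0 z1.
apply: compact_eball.
have -> : [set z : V | enorm z = 1] = (@enorm R n) @^-1` [set r | r = 1] by [].
by apply: closed_comp; [move=> y _; exact: enorm_continuous|exact: closed_eq].
Qed.

(** The supremum is attained, by compactness of the sphere. The maximiser is a dual direction of
    [x], in which inequalities for [phistar phi x] become inequalities between scalar products. *)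
Lemma phistar_spec x : exists z, enorm z = 1 /\ dot x z = phistar phi x * phi z /\
  forall y, dot x y <= phistar phi x * phi y.
Proof.
pose F (z : V) := dot x z / phi z.
have [|||z0] := @EVT_max_rV R n.+1 F [set z | enorm z = 1].
- by exists (ev ord0); exact: enorm_ev.
- exact: sphere_compact.
- apply: within_continuousW => z z1.
  have z0 : z != 0 by rewrite -enorm_gt0 z1.
  apply: continuousM; last first.
    apply: continuousV; first by rewrite gt_eqF // phi_gt0.
    by case: phi_C2 => c _ _; exact: c.
  apply/cvg_enorm => e e0; exists (e / (enorm x + 1)).
  have x0 : 0 < enorm x + 1 by rewrite ltr_wpDl // enorm_ge0.
  split; first by rewrite divr_gt0.
  move=> y; rewrite ltr_pdivlMr // -dotNr -dotDr => yz.
  apply: le_lt_trans (cauchy_schwarz _ _) _.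
  by have := enorm_ge0 (y - z); nra.
rewrite inE /= => z1 hz.
have zn : z0 != 0 by rewrite -enorm_gt0 z1.
have pz := phi_gt0 zn.
have mx y : dot x y <= F z0 * phi y.
  have [->|y0] := eqVneq y 0; first by rewrite dot0r phi0 mulr0.
  have [v [v1 ->]] := unit_dir y0.
  have vn : v != 0 by rewrite -enorm_gt0 v1.
  rewrite dotZr phiZ ger0_norm ?enorm_ge0 // mulrCA ler_wpM2l ?enorm_ge0 //.
  by rewrite -ler_pdivrMr ?phi_gt0 //; apply: hz; rewrite inE.
have E : phistar phi x = F z0.
  apply/eqP; rewrite eq_le; apply/andP; split.
    apply: ge_sup; first exists (dot (((phi z0)^-1) *: z0) x).
      exists ((phi z0)^-1 *: z0) => //=.
      by rewrite phiZ gtr0_norm ?invr_gt0 // mulVf // gt_eqF.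
    by move=> _ [y /= y1 <-]; rewrite dotC; have := mx y; rewrite y1 mulr1.
  apply: ub_le_sup.
    by exists (F z0) => _ [y /= y1 <-]; rewrite dotC; have := mx y; rewrite y1 mulr1.
  exists ((phi z0)^-1 *: z0) => /=.
    by rewrite phiZ gtr0_norm ?invr_gt0 // mulVf // gt_eqF.
  by rewrite dotZl dotC mulrC.
by exists z0; split=> //; rewrite E; split=> //; rewrite /F divfK // gt_eqF.
Qed.

Lemma dot_phistar x y : dot x y <= phistar phi x * phi y.
Proof. by have [_ [_ [_]]] := phistar_spec x. Qed.

Lemma phistar_le x t : (forall z, enorm z = 1 -> dot x z <= t * phi z) -> phistar phi x <= t.
Proof.
move=> h; have [z [z1 [E _]]] := phistar_spec x.
have z0 : z != 0 by rewrite -enorm_gt0 z1.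
by rewrite -(ler_pM2r (phi_gt0 z0)) -E h.
Qed.

Lemma phistar_ge0 x : 0 <= phistar phi x.
Proof.
have [z [z1 [E h]]] := phistar_spec x.
have z0 : z != 0 by rewrite -enorm_gt0 z1.
have := h (- z); rewrite dotNr E phiN.
by have := phi_gt0 z0; nra.
Qed.

Lemma phistarD x y : phistar phi (x + y) <= phistar phi x + phistar phi y.
Proof.
by apply: phistar_le => z _; rewrite dotDl mulrDl lerD // dot_phistar.
Qed.

Lemma phistarN x : phistar phi (- x) = phistar phi x.
Proof.
have h y : phistar phi (- y) <= phistar phi y.
  apply: phistar_le => z _; rewrite dotNl -dotNr; apply: le_trans (dot_phistar _ _) _.
  by rewrite phiN.
by apply/eqP; rewrite eq_le h /= -{1}(opprK x) h.
Qed.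

Lemma phistarZ t x : 0 <= t -> phistar phi (t *: x) = t * phistar phi x.
Proof.
move=> t0; have [z [z1 [E _]]] := phistar_spec x.
have z0 : z != 0 by rewrite -enorm_gt0 z1.
apply/eqP; rewrite eq_le; apply/andP; split.
  by apply: phistar_le => y _; rewrite dotZl -mulrA ler_wpM2l // dot_phistar.
by rewrite -(ler_pM2r (phi_gt0 z0)) -mulrA -E -dotZl dot_phistar.
Qed.

Lemma phistar0 : phistar phi 0 = 0.
Proof. by rewrite -(scale0r 0) phistarZ // mul0r. Qed.

Lemma phistar_le_enorm x : phistar phi x <= enorm x / gamma.
Proof.
apply: phistar_le => z z1; apply: le_trans (dot_le _ _) _; rewrite z1 mulr1.
rewrite -mulrA ler_peMr ?enorm_ge0 // mulrC ler_pdivlMr // mul1r.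
by have := phi_lb z; rewrite z1 mulr1.
Qed.

Lemma enorm_le_phistar : exists c : R, 0 < c /\ forall x, enorm x <= c * phistar phi x.
Proof.
have [c [c0 hc]] := phi_ub; exists c; split=> // x.
have [->|x0] := eqVneq x 0; first by rewrite enorm0 mulr_ge0 ?phistar_ge0 // ltW.
have := dot_phistar x x; rewrite dotxx.
have := hc x; have := phistar_ge0 x; move: x0; rewrite -enorm_gt0; nra.
Qed.

Lemma bdW_grad v : enorm v = 1 -> phistar phi (grad phi v) = 1.
Proof.
move=> v1; have v0 : v != 0 by rewrite -enorm_gt0 v1.
apply/eqP; rewrite eq_le; apply/andP; split.
  apply: phistar_le => z _; rewrite mul1r.
  have := phi_support z v1; have := dot_le v z; rewrite v1 mul1r.
  by move: gamma_gt0; nra.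
have := dot_phistar (grad phi v) v; rewrite euler // => h.
by rewrite -(ler_pM2r (phi_gt0 v0)) mul1r.
Qed.

(** The dual direction of [w] is where the functional [w] touches [phi], so [min_grad] identifies
    [w]. Together with [bdW_grad] this parametrises the Wulff boundary by the unit sphere, and the
    exterior normal inverts the parametrisation. *)
Lemma bdW_inv w : phistar phi w = 1 -> exists v, enorm v = 1 /\ w = grad phi v.
Proof.
move=> w1; have [v [v1 []]] := phistar_spec w; rewrite w1 mul1r => E h.
exists v; split=> //; apply: min_grad => //; first by rewrite -enorm_gt0 v1.
by move=> z; have := h z; rewrite mul1r.
Qed.

Lemma ext_normal_grad u v : enorm u = 1 -> ext_normal phi (grad phi u) v <-> v = u.
Proof.
move=> u1; split=> [[v1 h]|->].
  have v0 : v != 0 by rewrite -enorm_gt0 v1.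
  have := h (grad phi v); rewrite /Wphi /= bdW_grad // => /(_ (lexx _)).
  rewrite dotDl dotNl euler // => hv.
  apply: grad_inj => //; apply/esym/min_grad => // [z|].
    by have := dot_phistar (grad phi u) z; rewrite bdW_grad // mul1r.
  apply/eqP; rewrite eq_le; apply/andP; split; last lra.
  by have := dot_phistar (grad phi u) v; rewrite bdW_grad // mul1r.
split=> // x /= xW; rewrite dotDl dotNl euler -?enorm_gt0 ?u1 //.
have := dot_phistar x u; have := phi_ge0 u; rewrite /Wphi /= in xW; nra.
Qed.

(** * The anisotropic distance function *)

Section AnisotropicDistance.
Variable A : set V.
Hypotheses (A_closed : closed A) (A_neq0 : A !=set0).

Local Ltac keep_section := clear -phi_norm phi_C2 gamma_gt0 phi_uc A_closed A_neq0.

Lemma deltaA_le x c : A c -> deltaA phi A x <= phistar phi (x - c).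
Proof.
move=> Ac; apply: ge_inf; last by exists c.
by exists 0 => _ [b _ <-]; exact: phistar_ge0.
Qed.

Lemma deltaA_ge x t : (forall c, A c -> t <= phistar phi (x - c)) -> t <= deltaA phi A x.
Proof.
move=> h; apply: lb_le_inf; last by move=> _ [c Ac <-]; exact: h.
by have [c Ac] := A_neq0; exists (phistar phi (x - c)), c.
Qed.

Lemma deltaA_ge0 x : 0 <= deltaA phi A x.
Proof. by apply: deltaA_ge => c _; exact: phistar_ge0. Qed.

Lemma deltaA_lip x y : deltaA phi A x <= deltaA phi A y + phistar phi (x - y).
Proof.
rewrite -lerBlDr; apply: deltaA_ge => c Ac; rewrite lerBlDr.
apply: le_trans (deltaA_le x Ac) _.
rewrite (_ : x - c = (y - c) + (x - y)); first exact: phistarD.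
by row_ring.
Qed.

Lemma phistar_continuous x : {for x, continuous (phistar phi)}.
Proof.
apply/cvg_enorm => e e0; exists (e * gamma); split; first by rewrite mulr_gt0.
move=> y; rewrite -ltr_pdivrMr // => yx.
have h1 := phistarD (y - x) x; have h2 := phistarD (x - y) y.
have h3 := phistar_le_enorm (y - x); have h4 := phistar_le_enorm (x - y).
rewrite !subrK in h1 h2; rewrite enormB in h4.
by rewrite ltr_norml; apply/andP; split; lra.
Qed.

Lemma xiA_exists x : exists c, xiA phi A x c.
Proof.
have [b Ab] := A_neq0; have [k [k0 hk]] := enorm_le_phistar.
pose B := A `&` [set y | enorm (y - x) <= k * phistar phi (x - b)].
have [|||c] := @EVT_min_rV R n.+1 (fun y => phistar phi (x - y)) B.
- by exists b; split=> //=; rewrite enormB.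
- exact: compact_eball.
- apply: within_continuousW => y _; apply: continuous_comp; last exact: phistar_continuous.
  by apply: continuousB; [exact: cst_continuous|exact: id].
rewrite inE => -[Ac _] hc; exists c; split=> //.
apply/eqP; rewrite eq_le deltaA_le // andbT; apply: deltaA_ge => y Ay.
have [yx|yx] := leP (enorm (y - x)) (k * phistar phi (x - b)).
  by apply: hc; rewrite inE.
apply: (@le_trans _ _ (phistar phi (x - b))); last first.
  rewrite -(ler_pM2l k0); apply: ltW; apply: lt_le_trans yx _.
  by rewrite enormB.
apply: hc; rewrite inE; split=> //=; by rewrite enormB.
Qed.

Lemma deltaA_gt0_notin x : 0 < deltaA phi A x -> ~ A x.
Proof.
by move=> h Ax; have := deltaA_le x Ax; rewrite subrr phistar0; lra.
Qed.

Lemma xiA_normal x c : 0 < deltaA phi A x -> xiA phi A x c ->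
  exists v, enorm v = 1 /\ x - c = deltaA phi A x *: grad phi v.
Proof.
move=> d0 [Ac E]; have [|v [v1 Ev]] := @bdW_inv ((deltaA phi A x)^-1 *: (x - c)).
  by rewrite phistarZ ?E ?mulVf ?gt_eqF // invr_ge0 ltW.
by exists v; split=> //; rewrite -Ev scalerA mulfV ?scale1r // gt_eqF.
Qed.

(* The Wulff ball inside the complement contains a Euclidean ball tangent at [c]. *)
Lemma xiA_proximal x c v y : enorm v = 1 -> xiA phi A x c ->
  x - c = deltaA phi A x *: grad phi v -> A y ->
  2 * gamma * deltaA phi A x * dot (y - c) v <= dot (y - c) (y - c).
Proof.
move=> v1 [Ac E] Ev Ay; set d := deltaA phi A x in E Ev *.
have d0 : 0 <= d by exact: deltaA_ge0.
have [z [z1 [Ez _]]] := phistar_spec (x - y).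
have dz : d * phi z <= dot (x - y) z.
  by rewrite Ez ler_wpM2r ?phi_ge0 // deltaA_le.
have Exy : x - y = d *: grad phi v - (y - c).
  by rewrite -Ev; row_ring.
rewrite Exy dotDl dotNl dotZl in dz.
have sup := phi_support z v1; rewrite z1 in sup.
have h1 : gamma * d * (1 - dot v z) <= - dot (y - c) z by nra.
have vz := dot_unit_dist v1 z1.
have h2 : dot (y - c) v = dot (y - c) z + dot (y - c) (v - z) by rewrite dotDr dotNr; ring.
have h3 := dot_le (y - c) (v - z).
have h4 : gamma * d * dot (v - z) (v - z) <= - 2 * dot (y - c) z by rewrite vz; lra.
have gd : 0 <= gamma * d by rewrite mulr_ge0 // ltW.
rewrite h2 (dotxx (y - c)).
(* Young's inequality absorbs the mixed term |y - c||v - z| into the two quadratic ones. *)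
rewrite dotxx in h4; have := sqr_ge0 (enorm (y - c) - gamma * d * enorm (v - z)).
by nra.
Qed.

(** In terms of support functions: the Wulff shape lies in the Euclidean ball of radius [rho] that
    touches it at [grad phi v]. For z near [u] the C^2 bound controls the gap by |z - v|^2; for z
    away from [u] the gap is bounded and 1 - v.z stays away from 0. *)
Lemma grad_wulff_bound u : enorm u = 1 -> exists rho e : R, [/\ 0 < rho, 0 < e &
  forall v z, enorm v = 1 -> enorm z = 1 -> enorm (v - u) < e ->
    phi z - dot (grad phi v) z <= rho * (1 - dot v z)].
Proof.
move=> u1; have u0 : u != 0 by rewrite -enorm_gt0 u1.
have [d [d0 hd]] := grad_strict u0 (@ltr01 R).
have [C [C0 hC]] := mulmx_bound (hess phi u)^T.
have [k [k0 hk]] := phi_ub.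
(* First summand: |z - v|^2 = 2 (1 - v.z) near [u]. Second: the gap is at most 2k, while 1 - v.z >=
   d^2/8 when |z - u| >= d and |v - u| < d/2. *)
exists (2 * (C + 1) + 16 * k / d ^+ 2), (d / 2); split; last 1 first.
- move=> v z v1 z1 vd; have vz := dot_unit_dist v1 z1.
  have vz0 : 0 <= 1 - dot v z by have := dot_ge0 (v - z); rewrite vz; lra.
  have kd : 0 <= k / d ^+ 2 by rewrite divr_ge0 ?sqr_ge0 // ltW.
  have [zd|zd] := ltP (enorm (z - u)) d.
    have vd' : enorm (v - u) < d by lra.
    have h := phi_sub_le v1 z1; apply: (le_trans h).
    have h1 := hd z v zd vd'; have h2 := hC (z - v).
    have h3 := enorm_triB (grad phi z - grad phi v) ((z - v) *m (hess phi u)^T).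
    have h4 := dot_le (grad phi z - grad phi v) (z - v).
    have h5 : dot (z - v) (z - v) = 2 * (1 - dot v z) by rewrite dot_unit_dist // dotC.
    rewrite dotxx in h5; have := enorm_ge0 (z - v) => h6.
    have h7 : enorm (grad phi z - grad phi v) * enorm (z - v) <= (C + 1) * enorm (z - v) * enorm (z - v).
      by rewrite ler_wpM2r //; lra.
    apply: (le_trans h4); apply: (le_trans h7); rewrite -mulrA h5 -mulrA [leRHS]mulrDl.
    have : 0 <= 16 * (k / d ^+ 2) * (1 - dot v z) by rewrite mulr_ge0 // mulr_ge0.
    lra.
  have h1 : d / 2 <= enorm (z - v) by have := enorm_tri z v u; lra.
  have h2 : d ^+ 2 / 8 <= 1 - dot v z.
    have : dot (z - v) (z - v) = 2 * (1 - dot v z) by rewrite dot_unit_dist // dotC.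
    by rewrite dotxx expr2; nra.
  have h3 : phi z - dot (grad phi v) z <= 2 * k.
    have := dot_phistar (grad phi v) (- z).
    by rewrite bdW_grad // phiN dotNr; have := hk z; rewrite z1; lra.
  apply: (le_trans h3); rewrite [leRHS]mulrDl.
  have -> : 2 * k = 16 * k / d ^+ 2 * (d ^+ 2 / 8) by field; rewrite gt_eqF.
  have k1 : 0 <= 16 * k / d ^+ 2 by rewrite -mulrA mulr_ge0.
  apply: le_trans (ler_wpM2l k1 h2) _; rewrite lerDr mulr_ge0 //.
  by move: C0; keep_section; move=> *; lra.
- rewrite ltr_wpDr //; last by lra.
  by rewrite divr_ge0 ?sqr_ge0 //; lra.
- by rewrite divr_gt0.
Qed.

(** The anisotropic ball of radius [s] about c + s grad phi v lies in the Euclidean ball of radius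
    [s * rho] tangent at [c], so a set that avoids the interior of the latter is at anisotropic
    distance at least [s]. *)
Lemma deltaA_outer_ball (rho s : R) c v : enorm v = 1 -> 0 < rho -> 0 <= s ->
  (forall z, enorm z = 1 -> phi z - dot (grad phi v) z <= rho * (1 - dot v z)) ->
  A c -> (forall y, A y -> s * rho <= enorm (y - c - (s * rho) *: v)) ->
  deltaA phi A (c + s *: grad phi v) = s.
Proof.
move=> v1 r0 s0 hr Ac hb; apply/eqP; rewrite eq_le; apply/andP; split.
  by apply: le_trans (deltaA_le _ Ac) _; rewrite addrAC subrr add0r phistarZ // bdW_grad // mulr1.
apply: deltaA_ge => y Ay; have yb := hb y Ay.
have [->|s'] := eqVneq s 0; first exact: phistar_ge0.
have sp : 0 < s by rewrite lt_def s' s0.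
have pn : 0 < s * rho by rewrite mulr_gt0.
rewrite enormB in yb.
have [|z [z1 Ez]] := @unit_dir R n ((s * rho) *: v - (y - c)).
  by rewrite -enorm_gt0; lra.
have z0 : z != 0 by rewrite -enorm_gt0 z1.
rewrite -(ler_pM2r (phi_gt0 z0)); apply: le_trans (dot_phistar _ _).
have -> : c + s *: grad phi v - y = ((s * rho) *: v - (y - c)) + s *: (grad phi v - rho *: v).
  by row_ring.
rewrite {1}Ez dotDl !dotZl dotDl dotNl dotZl dotxx z1.
have := hr z z1; nra.
Qed.

Lemma deltaA_segment c w s r : phistar phi w = 1 -> A c -> deltaA phi A (c + s *: w) = s ->
  0 <= r <= s -> deltaA phi A (c + r *: w) = r.
Proof.
move=> w1 Ac E /andP[r0 rs]; apply/eqP; rewrite eq_le; apply/andP; split.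
  by apply: le_trans (deltaA_le _ Ac) _; rewrite addrAC subrr add0r phistarZ // w1 mulr1.
have := deltaA_lip (c + s *: w) (c + r *: w); rewrite E.
have -> : c + s *: w - (c + r *: w) = (s - r) *: w.
  by row_ring.
by rewrite phistarZ ?subr_ge0 // w1; lra.
Qed.

(* Strict convexity: a contact that persists up to [s > r] is stable at height [r]. *)
Lemma contact_stable c u s r : enorm u = 1 -> A c -> 0 < r -> r < s ->
  deltaA phi A (c + s *: grad phi u) = s ->
  forall e : R, 0 < e -> exists d : R, 0 < d /\ forall x, enorm (x - (c + r *: grad phi u)) < d ->
    [/\ 0 < deltaA phi A x, `|deltaA phi A x - r| < e &
    forall b v, xiA phi A x b -> enorm v = 1 -> x - b = deltaA phi A x *: grad phi v ->
      enorm (v - u) < e /\ enorm (b - c) < e].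
Proof.
move=> u1 Ac r0 rs Es e e0; have u0 : u != 0 by rewrite -enorm_gt0 u1.
have r01 : 0 <= r <= s by apply/andP; split; lra.
have Er := deltaA_segment (bdW_grad u1) Ac Es r01.
have [k [k0 hk]] := phi_ub; have [k' [k'0 hk']] := enorm_le_phistar.
have e4 : 0 < e / (4 * (r + 1)) by rewrite divr_gt0 // mulr_gt0 // addr_gt0.
have [d1 [d10 hd1]] := grad_continuous u0 e4.
have [e1 e10 [e1d e1e]] := min_gt0 d10 e0.
have sr0 : 0 < s - r by rewrite subr_gt0.
(* [m] bounds from below both [s - r] and, for [x] near the contact, the distance at [x]. *)
have [m m0 [ms mr]] := min_gt0 sr0 (divr_gt0 r0 (ltr0Sn R 1)).
have [q [q0 qk]] : exists q : R, 0 < q /\ q * k = m * gamma * ((e1 / 4) ^+ 2 / 4).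
  exists (m * gamma * (e1 / 4) ^+ 2 / (4 * k)); split; last by field; rewrite gt_eqF.
  by rewrite divr_gt0 // ?mulr_gt0 // exprn_gt0 // divr_gt0.
have [t1 t10 [t1q t1r]] := min_gt0 q0 (divr_gt0 r0 (ltr0Sn R 1)).
have [t2 t20 [t2t t2e]] := min_gt0 t10 (divr_gt0 e0 (mulr_gt0 (ltr0Sn R 3) (addr_gt0 k'0 (@ltr01 R)))).
have [t t0 [tt te]] := min_gt0 t20 e0.
exists (Num.min (t * gamma) (e / 4)); split.
  by rewrite lt_min mulr_gt0 // divr_gt0.
move=> x; rewrite lt_min -ltr_pdivrMr // => /andP[xt xe].
have [x0 Ex0] : exists x0, x0 = c + r *: grad phi u by eexists.
rewrite -Ex0 in Er xt xe.
have kx : phistar phi (x - x0) < t by apply: le_lt_trans (phistar_le_enorm _) xt.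
have kx' : phistar phi (x0 - x) < t.
  by apply: le_lt_trans (phistar_le_enorm _) _; rewrite enormB.
have l1 := deltaA_lip x x0; have l2 := deltaA_lip x0 x; rewrite Er in l1 l2.
have dlr : `|deltaA phi A x - r| < t.
  by rewrite ltr_norml; move: kx kx' l1 l2; keep_section; move=> *; apply/andP; split; lra.
have tr : t < r / 2 by apply: lt_trans t1r; apply: lt_trans t2t.
have dl2 : r / 2 < deltaA phi A x.
  by move: dlr tr; rewrite ltr_norml; keep_section; move=> /andP[? ?] ?; lra.
split; first by apply: lt_trans dl2; rewrite divr_gt0.
  exact: lt_trans te.
move=> b v [Ab Eb] v1 Ev; move: (deltaA phi A x) => dl in l1 l2 dlr dl2 Eb Ev *.
have [z [z1 [Ez _]]] := phistar_spec (c + s *: grad phi u - b).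
have z0 : z != 0 by rewrite -enorm_gt0 z1.
have pz := phi_gt0 z0.
have h1 : s * phi z <= dot (c + s *: grad phi u - b) z.
  by rewrite Ez ler_pM2r // -{1}Es deltaA_le.
have E : c + s *: grad phi u - b = (x0 - x) + (s - r) *: grad phi u + dl *: grad phi v.
  by rewrite -Ev Ex0; row_ring.
rewrite E (dotDl (x0 - x + _)) (dotDl (x0 - x)) !dotZl in h1.
have h2 := phi_support z u1; have h3 := phi_support z v1; rewrite z1 in h2 h3.
have h4 := dot_phistar (x0 - x) z.
have pk : phi z <= k by have := hk z; rewrite z1 mulr1.
have uz := dot_unit_dist u1 z1; have vz := dot_unit_dist v1 z1.
have uz0 := dot_ge0 (u - z); have vz0 := dot_ge0 (v - z).
have dm : m <= dl by apply: ltW; apply: lt_trans dl2.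
have dl0 : 0 < dl by exact: lt_le_trans dm.
have g1 : 0 <= gamma * (1 - dot u z).
  by rewrite pmulr_rge0 //; move: uz0; rewrite uz; keep_section; move=> *; lra.
have g2 : 0 <= gamma * (1 - dot v z).
  by rewrite pmulr_rge0 //; move: vz0; rewrite vz; keep_section; move=> *; lra.
(* The vector c + s grad phi u - b is a small error plus multiples of [grad phi u] and [grad phi v]
   with weights adding up to almost [s], yet its dual norm is at least [s]. Near equality in the
   triangle inequality forces [u] and [v] close to the dual direction [z]. *)
have h5 : (s - r) * (gamma * (1 - dot u z)) + dl * (gamma * (1 - dot v z)) <= 2 * t * phi z.
  have k1 : dot (x0 - x) z <= t * phi z by apply: le_trans h4 _; rewrite ler_pM2r // ltW.
  have k2 : (s - r) * dot (grad phi u) z <= (s - r) * (phi z - gamma * (1 - dot u z)).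
    by rewrite ler_pM2l // lerBrDr.
  have k3 : dl * dot (grad phi v) z <= dl * (phi z - gamma * (1 - dot v z)).
    by rewrite ler_pM2l // lerBrDr.
  have k4 : dl * phi z <= (r + t) * phi z.
    by rewrite ler_pM2r //; move: dlr; rewrite ltr_norml; keep_section; move=> /andP[? ?]; lra.
  by move: h1 k1 k2 k3 k4; keep_section; move=> *; lra.
have h6 : 2 * t * phi z <= m * gamma * ((e1 / 4) ^+ 2 / 2).
  have tq : t <= q by apply: ltW; apply: lt_trans t1q; apply: lt_trans t2t.
  have : t * phi z <= q * k by rewrite ler_pM // ltW.
  by rewrite qk; keep_section; move=> *; lra.
have mg : 0 < m * gamma by rewrite mulr_gt0.
have close w : enorm w = 1 -> m * gamma * (1 - dot w z) <= m * gamma * ((e1 / 4) ^+ 2 / 2) ->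
    enorm (w - z) <= e1 / 4.
  move=> w1; rewrite ler_pM2l // => hw; apply: enorm_le; first by rewrite divr_ge0 // ltW.
  by rewrite dot_unit_dist // -expr2; move: hw; keep_section; move=> *; lra.
have cu : enorm (u - z) <= e1 / 4.
  apply: close => //; apply: le_trans h6; apply: le_trans h5; rewrite -mulrA.
  have k1 : m * (gamma * (1 - dot u z)) <= (s - r) * (gamma * (1 - dot u z)).
    by rewrite ler_wpM2r // ltW.
  have k2 : 0 <= dl * (gamma * (1 - dot v z)) by rewrite mulr_ge0 // ltW.
  by move: k1 k2; keep_section; move=> *; lra.
have cv : enorm (v - z) <= e1 / 4.
  apply: close => //; apply: le_trans h6; apply: le_trans h5; rewrite -mulrA.
  have k1 : m * (gamma * (1 - dot v z)) <= dl * (gamma * (1 - dot v z)) by rewrite ler_wpM2r.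
  have k2 : 0 <= (s - r) * (gamma * (1 - dot u z)) by rewrite mulr_ge0 // ltW.
  by move: k1 k2; keep_section; move=> *; lra.
have vu : enorm (v - u) < e1.
  have := enorm_tri v z u; rewrite (enormB z u); move: cu cv e10; keep_section; move=> *; lra.
split; first exact: lt_trans e1e.
have -> : b - c = (x - x0) - (dl - r) *: grad phi v - r *: (grad phi v - grad phi u).
  rewrite (_ : b = x - dl *: grad phi v); last by rewrite -Ev; row_ring.
  by rewrite Ex0; row_ring.
apply: le_lt_trans (enormBD _ _) _.
have := enormBD (x - x0) ((dl - r) *: grad phi v); rewrite !enormZ (gtr0_norm r0).
have gv : enorm (grad phi v) <= k' by have := hk' (grad phi v); rewrite bdW_grad // mulr1.
have n1 : `|dl - r| <= t2 by apply/ltW/(lt_trans dlr).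
have n2 : `|dl - r| * enorm (grad phi v) <= e / 4.
  apply: (@le_trans _ _ (t2 * k')); first by rewrite ler_pM ?enorm_ge0.
  move: t2e; rewrite ltr_pdivlMr ?mulr_gt0 ?addr_gt0 // => t2e.
  by move: t2e t20; keep_section; move=> *; lra.
have n3 : r * enorm (grad phi v - grad phi u) <= e / 4.
  have n4 := hd1 v (lt_trans vu e1d).
  apply: (@le_trans _ _ (r * (e / (4 * (r + 1))))); first by rewrite ler_pM2l // ltW.
  rewrite (_ : r * _ = e / 4 * (r / (r + 1))); last by field; rewrite gt_eqF // addr_gt0.
  have r1 : r / (r + 1) <= 1 by rewrite ler_pdivrMr ?addr_gt0 // mul1r lerDl.
  by rewrite -[leRHS]mulr1 ler_wpM2l // divr_ge0 // ltW.
move=> n4; apply: le_lt_trans (lerD n4 (lexx _)) _; move: n2 n3 xe e0; keep_section; move=> *; lra.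
Qed.

End AnisotropicDistance.

(** * Contact points of epigraphs *)

Section Graph.
Variables (A : set V) (a u : V) (eps del C K : R) (f : V -> R).
Hypotheses (A_closed : closed A) (u1 : enorm u = 1) (eps_gt0 : 0 < eps) (del_gt0 : 0 < del)
  (C_ge0 : 0 <= C) (K_ge0 : 0 <= K)
  (f_cv : convex_on (plane a u) (fun x => C * enorm x ^+ 2 + f x))
  (f_lip : forall x y, plane a u x -> plane a u y -> `|f x - f y| <= K * enorm (x - y))
  (fa : f a = 0) (f_diff : diff_zero f a u)
  (epiA : epif a u f `&` Ucyl a u eps del = A `&` Ucyl a u eps del).

Local Ltac keep_section := clear -phi_norm phi_C2 gamma_gt0 phi_uc A_closed u1 eps_gt0
  del_gt0 C_ge0 K_ge0 f_cv f_lip fa f_diff epiA.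

Let u_neq0 : u != 0. Proof. by rewrite -enorm_gt0 u1. Qed.

Lemma pmx_u : u *m pmx u = 0.
Proof. by rewrite mul_pmx dotxx u1 mulr1 scale1r subrr. Qed.

Lemma Ucyl_near : exists m : R, 0 < m /\ forall y, enorm (y - a) < m -> Ucyl a u eps del y.
Proof.
have [m m0 [me md]] := min_gt0 eps_gt0 del_gt0; exists m; split=> // y ya.
exists (a + (y - a) *m pmx u), (dot (y - a) u); split.
- by apply: plane_add; exact: pmxP.
- rewrite addrAC subrr add0r; apply: le_lt_trans (enorm_pmx _ u1) _.
  exact: lt_trans me.
- apply: le_lt_trans (cauchy_schwarz _ _) _; rewrite u1 mulr1; exact: lt_trans md.
by rewrite mul_pmx; row_ring.
Qed.

Lemma epiA_near : exists m : R, 0 < m /\ forall y, enorm (y - a) < m -> A y <-> epif a u f y.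
Proof.
have [m [m0 hm]] := Ucyl_near; exists m; split=> // y /hm Uy.
have E : (epif a u f `&` Ucyl a u eps del) y = (A `&` Ucyl a u eps del) y by rewrite epiA.
split=> hy; first by have : (A `&` Ucyl a u eps del) y by []; rewrite -E => -[].
by have : (epif a u f `&` Ucyl a u eps del) y by []; rewrite E => -[].
Qed.

Lemma base_in : A a.
Proof.
have [m [m0 hm]] := epiA_near; apply/hm; first by rewrite subrr enorm0.
by exists a, 0; rewrite fa lexx scale0r subr0; split=> //; exact: plane_base.
Qed.

Lemma A_neq0 : A !=set0. Proof. by exists a; exact: base_in. Qed.

Lemma base_sub : prox_sub C f a u a 0.
Proof. exact: prox_sub0. Qed.

(** A point with a proximal normal cannot lie strictly inside the epigraph: there c + t v stays in A
    for small t, giving t <= c0 t^2. On the graph [prox_sub_of_normal] applies. *)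
Lemma normal_graph : exists m : R, 0 < m /\ forall c v (c0 : R), A c -> enorm (c - a) < m ->
  enorm v = 1 -> 0 <= c0 -> (forall y, A y -> dot (y - c) v <= c0 * dot (y - c) (y - c)) ->
  exists b, [/\ plane a u b, c = b - f b *: u, 0 < dot v u &
    prox_sub C f a u b ((dot v u)^-1 *: v)].
Proof.
have [m [m0 hm]] := epiA_near; exists (m / 2); split; first by rewrite divr_gt0.
move=> c v c0 Ac cm v1 c00 nrm; have m2 : m / 2 < m by lra.
have [b [s [hb fs Ec]]] := (hm c (lt_trans cm m2)).1 Ac.
have near y : epif a u f y -> enorm (y - c) < m / 2 -> A y.
  by move=> ey yc; apply/hm => //; have := enorm_tri y c a; lra.
have vP := enorm_pmx v u1; rewrite v1 in vP.
have vu : `|dot v u| <= 1 by have := cauchy_schwarz v u; rewrite v1 u1 mulr1.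
have [fbs|sb] := ltP (f b) s.
  have K1 : 0 < K + 1 by have := K_ge0; lra.
  have sf0 : 0 < s - f b by rewrite subr_gt0.
  have [t1 t10 [t1s t1m]] := min_gt0 (divr_gt0 sf0 K1) (divr_gt0 m0 (ltr0Sn R 1)).
  have [t t0 [tt tc]] := min_gt0 t10 (divr_gt0 (@ltr01 R) (ltr_wpDl c00 (@ltr01 R))).
  exfalso; have hz : plane a u (b + t *: (v *m pmx u)).
    by apply: plane_addr => //; apply: perpZ; exact: pmxP.
  have Ay : A (c + t *: v).
    apply: near; last by rewrite addrAC subrr add0r enormZ v1 mulr1 gtr0_norm //; lra.
    exists (b + t *: (v *m pmx u)), (s - t * dot v u); split=> //.
      have := f_lip hz hb; rewrite addrAC subrr add0r enormZ (gtr0_norm t0) => h.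
      have h1 : K * (t * enorm (v *m pmx u)) <= K * t.
        by apply: ler_wpM2l => //; rewrite ler_piMr // ltW.
      have h2 : t * (K + 1) < s - f b.
        by rewrite -ltr_pdivlMr //; apply: lt_trans t1s.
      have h3 : t * dot v u <= t * 1.
        by rewrite ler_pM2l //; apply: le_trans (ler_norm _) vu.
      have := ler_norm (f (b + t *: (v *m pmx u)) - f b); lra.
    by rewrite Ec mul_pmx; row_ring.
  have := nrm _ Ay; rewrite addrAC subrr add0r !dotE dotxx v1 !mulr1.
  move: tc; rewrite ltr_pdivlMr ?ltr_wpDl // => tc.
  have k1 : t * (t * (c0 + 1)) < t * 1 by rewrite ltr_pM2l.
  have k2 : 0 < t * t by rewrite mulr_gt0.
  by move=> k3; lra.
have {fs} sE : s = f b by apply/eqP; rewrite eq_le sb.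
rewrite sE in Ec; exists b; have m20 : 0 < m / 2 by rewrite divr_gt0.
have [|vu0 sub] := @prox_sub_of_normal R n f a u C K c0 (m / 2) b v u1 v1 hb m20 K_ge0 c00 f_lip f_cv.
  by move=> y ey; rewrite -Ec => yc; apply: nrm; exact: near.
by split.
Qed.

(** The converse passage: a subgradient with the uniform parabola yields an exterior ball whose
    radius depends only on [C] and on the neighbourhood where A is the epigraph. *)
Lemma outer_ball : exists m r0 : R, [/\ 0 < m, 0 < r0 &
  forall b v r y, plane a u b -> enorm (b - f b *: u - a) < m -> enorm v = 1 -> 0 < dot v u ->
    prox_sub C f a u b ((dot v u)^-1 *: v) -> 0 <= r <= r0 -> A y ->
    r <= enorm (y - (b - f b *: u) - r *: v)].
Proof.
have [m [m0 hm]] := epiA_near.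
have C1 : 0 < 2 * C + 1 by have := C_ge0; lra.
(* r0 < m/4 disposes of the points outside the ball of radius m about [a], which are at distance at
   least m/2 from [c]; r0 (2C + 1) < 1 makes the sphere more curved than the parabola. *)
have [r0 r00 [r0m r0C]] := min_gt0 (divr_gt0 m0 (ltr0Sn R 3)) (divr_gt0 (@ltr01 R) C1).
exists (m / 2), r0; split=> //; first by rewrite divr_gt0.
move=> b v r y hb bm v1 vu sub /andP[rg rr] Ay; set c := b - _ in bm *.
have [ym|ym] := ltP (enorm (y - a)) m; last first.
  have h1 := enorm_tri y c a; have h2 := enorm_triB (y - c) (r *: v).
  by rewrite enormZ v1 mulr1 ger0_norm // in h2; lra.
have [z [t [hz ft Ey]]] := (hm y ym).1 Ay.
have -> : y - c - r *: v = - (c + r *: v - y) by row_ring.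
rewrite enormN ball_proximal //.
have E : y - c = (z - b) - (t - f b) *: u.
  by rewrite Ey /c; row_ring.
have hzb := perp_planeB hz hb.
have := sub z hz; rewrite dotZl => h1.
have h2 : dot (z - b) v <= (f z - f b + C * dot (z - b) (z - b)) * dot v u.
  by rewrite -ler_pdivrMr // mulrC (dotC (z - b)); lra.
have vu1 : dot v u <= 1 by have := dot_le v u; rewrite v1 u1 mulr1.
have h3 : dot (y - c) (y - c) = dot (z - b) (z - b) + (t - f b) ^+ 2.
  rewrite E; move: (z - b) hzb => w; rewrite /perp /= => hw.
  by rewrite !dotE (dotC u w) hw (dotxx u) u1; ring.
have h4 : dot (y - c) v <= C * dot (z - b) (z - b).
  rewrite E (dotDl _ _ v) dotNl dotZl (dotC u v).
  have q := dot_ge0 (z - b); have Cq : 0 <= C * dot (z - b) (z - b) by exact: mulr_ge0.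
  have : C * dot (z - b) (z - b) * dot v u <= C * dot (z - b) (z - b) * 1 by rewrite ler_wpM2l.
  have : f z * dot v u <= t * dot v u by rewrite ler_pM2r.
  lra.
have rC : r * (2 * C + 1) <= 1.
  by move: r0C; rewrite ltr_pdivlMr // => r0C; apply: le_trans (ltW r0C); rewrite ler_pM2r.
rewrite h3; apply: (@le_trans _ _ (dot (z - b) (z - b))); last by rewrite lerDl sqr_ge0.
have q := dot_ge0 (z - b).
apply: le_trans (ler_wpM2l (mulr_ge0 (ler0n R 2) rg) h4) _.
have : r * (2 * C + 1) * dot (z - b) (z - b) <= 1 * dot (z - b) (z - b) by rewrite ler_wpM2r.
have : 0 <= r * dot (z - b) (z - b) by rewrite mulr_ge0.
lra.
Qed.

(** With slope [p] one has v = (v.u)(u + p) and 1 - v.u <= |p|^2: unit normal and slope agree to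
    first order, so an expansion of one gives an expansion of the other. *)
Lemma normal_split v p : enorm v = 1 -> 0 < dot v u ->
  p = (dot v u)^-1 *: v *m pmx u ->
  enorm (v - u - p) <= enorm p ^+ 2 * (1 + enorm p).
Proof.
set t := dot v u => v1 vu Ep.
have t1 : t <= 1 by have := dot_le v u; rewrite v1 u1 mulr1.
have Ev : v *m pmx u = t *: p by rewrite Ep -scalemxAl scalerA mulfV ?scale1r // gt_eqF.
have E : v - u - p = - ((1 - t) *: u) - (1 - t) *: p.
  have {1}-> : v = t *: u + t *: p by rewrite -Ev mul_pmx -/t; row_ring.
  by row_ring.
have n1 : dot (v *m pmx u) (v *m pmx u) = 1 - t ^+ 2.
  by rewrite mul_pmx -/t !dotE (dotC u v) -/t (dotxx v) (dotxx u) u1 v1; ring.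
have n2 : 1 - t <= enorm p ^+ 2.
  have : t ^+ 2 * enorm p ^+ 2 = 1 - t ^+ 2.
    by rewrite -n1 Ev !dotE dotxx; ring.
  have := sqr_ge0 (enorm p); have : t ^+ 2 <= 1 by rewrite expr_le1 // ltW.
  have : t ^+ 2 <= t by rewrite expr2 ler_piMr // ltW.
  nra.
rewrite E; apply: le_trans (enormBD _ _) _; rewrite enormN !enormZ u1 mulr1.
rewrite ger0_norm ?subr_ge0 // mulrDr mulr1 lerD //.
by rewrite ler_wpM2r ?enorm_ge0.
Qed.

Lemma normal_expand (p : V) (M : 'M[R]_n.+1) : M^T = M -> twice_at f a u p M ->
  forall e, 0 < e -> exists d, 0 < d /\ forall h v, perp u h -> enorm h < d -> enorm v = 1 ->
    0 < dot v u -> prox_sub C f a u (a + h) ((dot v u)^-1 *: v) ->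
    enorm (v - u - h *m (M *m pmx u)) <= e * enorm h.
Proof.
move=> MT tw e e0; have p0 := twice_at_slope fa f_diff tw.
have [m [m0 hm]] := mulmx_bound (M *m pmx u).
have m1 : 0 < m + 1 by rewrite addr_gt0.
have m10 : 0 < 2 * (m + 1) * (m + 1) by rewrite !mulr_gt0.
have e2 : 0 < e / 2 by rewrite divr_gt0.
have [e' e'0 [e'e e'1]] := min_gt0 e2 (@ltr01 R).
have [d1 [d10 hd1]] := prox_sub_expand u1 C_ge0 MT p0 tw e'0.
have [d2 d20 [d21 d2m]] := min_gt0 d10 (divr_gt0 (@ltr01 R) m1).
have [d d0 [dd2 de]] := min_gt0 d20 (divr_gt0 e2 m10).
exists d; split=> // h v hh hdl v1 vu sub.
have := hd1 h _ hh (lt_trans hdl (lt_trans dd2 d21)) sub.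
rewrite mulmxBl -mulmxA; set q := _ *: v *m _ => hq.
have sp := normal_split v1 vu (erefl q).
have h0 := enorm_ge0 h.
have qm : enorm q <= (m + 1) * enorm h.
  have := enorm_triB q (h *m (M *m pmx u)); have := hm h.
  have : e' * enorm h <= 1 * enorm h by rewrite ler_wpM2r // ltW.
  lra.
have q1 : enorm q <= 1.
  apply: (le_trans qm); rewrite mulrC -ler_pdivlMr //.
  by apply: ltW; apply: lt_trans hdl _; apply: lt_trans dd2 d2m.
have sp2 : enorm (v - u - q) <= e / 2 * enorm h.
  apply: (le_trans sp).
  have qq := enorm_ge0 q.
  apply: (@le_trans _ _ (2 * (m + 1) * (m + 1) * enorm h * enorm h)).
    have : enorm q ^+ 2 <= (m + 1) * enorm h * ((m + 1) * enorm h) by rewrite expr2 ler_pM.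
    have := sqr_ge0 (enorm q); nra.
  rewrite ler_wpM2r // mulrC -ler_pdivlMr //; apply: ltW; exact: lt_trans de.
have -> : v - u - h *m (M *m pmx u) = (v - u - q) + (q - h *m (M *m pmx u)).
  by rewrite addrA subrK.
apply: le_trans (enormD _ _) _.
have : e' * enorm h <= e / 2 * enorm h by rewrite ler_wpM2r // ltW.
lra.
Qed.

Lemma hess_expand : forall e, 0 < e -> exists d, 0 < d /\ forall v, enorm (v - u) < d ->
  enorm (grad phi v - grad phi u - (v - u) *m (hess phi u)^T) <= e * enorm (v - u).
Proof.
move=> e e0; have [d [d0 hd]] := grad_strict u_neq0 e0; exists d; split=> // v vd.
by apply: hd => //; rewrite subrr enorm0.
Qed.

Let A0 := A_neq0.

Lemma contact_graph : exists m : R, 0 < m /\ forall y c v, 0 < deltaA phi A y ->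
  xiA phi A y c -> enorm v = 1 -> y - c = deltaA phi A y *: grad phi v -> enorm (c - a) < m ->
  exists b, [/\ plane a u b, c = b - f b *: u, enorm (b - a) <= enorm (c - a), 0 < dot v u &
    prox_sub C f a u b ((dot v u)^-1 *: v)].
Proof.
have [m [m0 hm]] := normal_graph; exists m; split=> // y c v dl0 xic v1 Ev cm.
set dl := deltaA phi A y in dl0 Ev.
have gd : 0 < 2 * gamma * dl by rewrite mulr_gt0 // mulr_gt0.
have [||b [hb Ecb vu sub]] := hm c v (2 * gamma * dl)^-1 xic.1 cm v1.
- by rewrite invr_ge0 ltW.
- move=> z Az; rewrite mulrC ler_pdivlMr // mulrC.
  exact: (xiA_proximal A_closed A0 v1 xic Ev Az).
exists b; split=> //.
have bP : b - a = (c - a) *m pmx u.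
  have -> : c - a = (b - a) - f b *: u by rewrite Ecb addrAC.
  by rewrite mulmxBl -scalemxAl pmx_u scaler0 subr0 pmx_perp.
by rewrite bP; apply: enorm_pmx.
Qed.

(** If [r] exceeds the height r' at which density is assumed, points x near a + r' eta have segments
    prolongable by the factor q = r/r', which is below [sg]. Their feet b tend to [a] by
    [contact_stable], and delta(b + q (x - b)) = q delta(x) passes to the limit. *)
Lemma rlow_contact r : 0 < r -> (r%:E < rlow phi A a (grad phi u))%E ->
  deltaA phi A (a + r *: grad phi u) = r.
Proof.
move=> r0; set eta := grad phi u.
have eta1 : phistar phi eta = 1 by exact: bdW_grad.
have Aa := base_in.
move=> /ereal_sup_gt[_ [->|[sg [r' [sg1 r'0 rphi dens ->]]]]]; first by rewrite lte_fin ltNge ltW.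
rewrite lte_fin => rsg.
have [s [s0 Es] r's] : exists2 s, 0 < s /\ deltaA phi A (a + s *: eta) = s & r' < s.
  by move: rphi => /ereal_sup_gt[_ [s [s0 Es] <-]]; rewrite lte_fin; exists s.
have [rr'|r'r] := leP r r'.
  by apply: (deltaA_segment A_closed A0 eta1 Aa Es); rewrite (ltW r0) (le_trans rr') // ltW.
have [sg' [sg'0 sg'r sg's sg'1]] : exists q : R, [/\ 0 < q, q * r' = r, q < sg & 1 < q].
  exists (r / r'); split; first exact: divr_gt0.
  - by rewrite divfK // gt_eqF.
  - by rewrite ltr_pdivrMr.
  - by rewrite ltr_pdivlMr // mul1r.
apply/eqP; rewrite eq_le; apply/andP; split.
  apply: le_trans (deltaA_le A_closed A0 _ Aa) _.
  by rewrite addrAC subrr add0r phistarZ ?eta1 ?mulr1 // ltW.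
apply/ler_addgt0Pr => e e0.
have s3 : 0 < 3 * sg' by rewrite mulr_gt0.
have [e' e'0 Ee'] : exists2 q : R, 0 < q & sg' * q = e / 3 * gamma.
  exists (e * gamma / (3 * sg')); first by rewrite divr_gt0 // mulr_gt0 // gamma_gt0.
  by field; rewrite gt_eqF.
have [e'' e''0 Ee''] : exists2 q : R, 0 < q & sg' * q = e / 3.
  by exists (e / (3 * sg')); [exact: divr_gt0|field; rewrite gt_eqF].
have [e1 e10 [e1e e1e']] := min_gt0 e'0 e''0.
have [d [d0 hd]] := contact_stable A_closed A0 u1 Aa r'0 r's Es e10.
have [d1 d10 [d1d d1e]] := min_gt0 d0 e10.
have [x [[nAx rhox] xd]] := density1_nonempty dens d10.
have [dx0 dxr hx] := hd x (lt_trans xd d1d).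
have [s' [b [xib Eb]] s's] : exists2 s' : R, exists b, xiA phi A x b /\
    deltaA phi A (b + s' *: (x - b)) = s' * deltaA phi A x & sg' < s'.
  have /ereal_sup_gt[_ [s' [s'0 [b [xib Eb]] <-]]] : (sg'%:E < rhoA phi A x)%E.
    by apply: lt_le_trans rhox; rewrite lte_fin.
  by rewrite lte_fin => h; exists s' => //; exists b.
have [Ab _] := xib.
have [v [v1 Ev]] := xiA_normal A_closed A0 dx0 xib.
have [_ bc] := hx b v xib v1 Ev.
have Es' : deltaA phi A (b + sg' *: (x - b)) = sg' * deltaA phi A x.
  rewrite Ev scalerA; apply: (deltaA_segment A_closed A0 (bdW_grad v1) Ab (s := s' * deltaA phi A x)).
    by rewrite -scalerA -Ev.
  by rewrite mulr_ge0 ?(ltW dx0) ?(ltW sg'0) //= ler_pM2r // ltW.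
have := deltaA_lip A_closed A0 (b + sg' *: (x - b)) (a + r *: eta); rewrite Es'.
have -> : b + sg' *: (x - b) - (a + r *: eta) =
    (1 - sg') *: (b - a) + sg' *: (x - (a + r' *: eta)).
  by rewrite -sg'r; row_ring.
have k1 := phistarD ((1 - sg') *: (b - a)) (sg' *: (x - (a + r' *: eta))).
have k2 : phistar phi ((1 - sg') *: (b - a)) <= e / 3.
  apply: le_trans (phistar_le_enorm _) _; rewrite enormZ ler0_norm; last first.
    by rewrite subr_le0 ltW.
  rewrite ler_pdivrMr // -Ee' opprB; apply: ler_pM; rewrite ?enorm_ge0 ?subr_ge0 ?(ltW sg'1) //.
    by rewrite lerBlDr lerDl.
  by apply: ltW; exact: lt_trans e1e.
have k3 : phistar phi (sg' *: (x - (a + r' *: eta))) <= e / 3.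
  apply: le_trans (phistar_le_enorm _) _; rewrite enormZ gtr0_norm // ler_pdivrMr // -Ee'.
  by rewrite ler_pM2l //; apply: ltW; apply: lt_trans xd _; apply: lt_trans d1e e1e.
have k4 : r - e / 3 <= sg' * deltaA phi A x.
  rewrite -sg'r -Ee'' -mulrBr ler_pM2l //.
  by move: dxr e1e'; rewrite ltr_norml; keep_section; move=> /andP[? _] ?; lra.
by move: k1 k2 k3 k4; keep_section; move=> *; lra.
Qed.

Lemma footpoint r (L : 'M[R]_n.+1) : 0 < r ->
  deltaA phi A (a + r *: grad phi u) = r ->
  is_Dnu phi A (a + r *: grad phi u) (grad phi u) L ->
  forall e, 0 < e -> exists d, 0 < d /\ forall t : V, enorm t < d ->
    let y := a + r *: grad phi u + t in exists c v, [/\ xiA phi A y c, enorm v = 1,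
      y - c = deltaA phi A y *: grad phi v, `|deltaA phi A y - r| <= enorm t / gamma &
      enorm (grad phi v - grad phi u - t *m L) <= e * enorm t].
Proof.
move=> r0 Er [_ [_ est]] e e0; have [d1 [d10 hd1]] := est e e0.
have [d d0 [dd1 dr]] := min_gt0 d10 (mulr_gt0 r0 gamma_gt0).
exists d; split=> // t td y.
have Ey : y - (a + r *: grad phi u) = t by rewrite /y addrAC subrr add0r.
have l1 := deltaA_lip A_closed A0 y (a + r *: grad phi u).
have l2 := deltaA_lip A_closed A0 (a + r *: grad phi u) y.
rewrite -opprB phistarN in l2; rewrite Er Ey in l1 l2.
have l3 := phistar_le_enorm t.
have tr : enorm t / gamma < r by rewrite ltr_pdivrMr //; exact: lt_trans dr.
have dy0 : 0 < deltaA phi A y by lra.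
have [c xic] := xiA_exists A_closed A0 y.
have [v [v1 Ev]] := xiA_normal A_closed A0 dy0 xic.
exists c, v; split=> //; first by rewrite ler_norml; apply/andP; split; lra.
have := hd1 y (grad phi v) (deltaA_gt0_notin A_closed A0 dy0); rewrite Ey; apply.
  exact: lt_trans dd1.
by exists c => //; rewrite Ev scalerA mulVf ?scale1r // gt_eqF.
Qed.

(** [u] and [v] support the Wulff shape at [grad phi u] and [grad phi v]; comparing the two, the
    boundary leaves its tangent plane only to second order. *)
Lemma normal_defect v : enorm v = 1 ->
  `|dot (grad phi v - grad phi u) u| <= enorm (grad phi v - grad phi u) * enorm (v - u).
Proof.
move=> v1; have v0 : v != 0 by rewrite -enorm_gt0 v1.
have h1 := dot_phistar (grad phi v) u; have h2 := dot_phistar (grad phi u) v.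
rewrite bdW_grad // mul1r in h1; rewrite bdW_grad // mul1r in h2.
have h3 := dot_ge (grad phi v - grad phi u) (u - v); rewrite (enormB u v) in h3.
move: h3; rewrite !dotE (euler v0) (euler u_neq0) ler_norml => h3.
have h4 : 0 <= enorm (grad phi v - grad phi u) * enorm (v - u) by rewrite mulr_ge0 ?enorm_ge0.
by apply/andP; split; lra.
Qed.

Lemma normal_rate v (l : R) (t x : V) e : enorm v = 1 -> enorm x <= l * enorm t -> e <= 1 ->
  enorm (grad phi v - grad phi u - x) <= e * enorm t ->
  enorm (grad phi v - grad phi u) <= (l + 1) * enorm t /\
  enorm (v - u) <= (l + 1) / gamma * enorm t.
Proof.
move=> v1 xl e1 h; have t0 := enorm_ge0 t.
have k1 : enorm (grad phi v - grad phi u) <= (l + 1) * enorm t.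
  have := enorm_triB (grad phi v - grad phi u) x.
  have : e * enorm t <= 1 * enorm t by rewrite ler_wpM2r.
  lra.
split=> //; rewrite mulrAC ler_pdivlMr // mulrC.
by apply: le_trans k1; exact: grad_expand.
Qed.

(** The component of grad phi v - grad phi u along [u] is quadratic in the displacement, so the
    linearisation has none. Increments s t with s tending to 0 make this precise. *)
Lemma Dnu_tangent r (L : 'M[R]_n.+1) : 0 < r ->
  deltaA phi A (a + r *: grad phi u) = r ->
  is_Dnu phi A (a + r *: grad phi u) (grad phi u) L ->
  forall t : V, perp u (t *m L).
Proof.
move=> r0 Er dnu t; rewrite /perp /=; apply/eqP; rewrite -normr_le0.
apply/ler_addgt0Pr => e e0; rewrite add0r.
have [l [l0 hl]] := mulmx_bound L; have l1 : 0 < l + 1 by rewrite addr_gt0.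
pose N := enorm t + 1; have N0 : 0 < N by rewrite ltr_wpDl // enorm_ge0.
have tN : enorm t <= N by rewrite /N; lra.
have k0 : 0 < (l + 1) * ((l + 1) / gamma) * N ^+ 2 by exact: mulr_gt0 (mulr_gt0 l1 (divr_gt0 l1 gamma_gt0)) (exprn_gt0 2 N0).
have [e1 e10 [e1e e11]] := min_gt0 (divr_gt0 e0 (mulr_gt0 (ltr0Sn R 1) N0)) (@ltr01 R).
have [d [d0 hd]] := footpoint r0 Er dnu e10.
have [s s0 [sd se]] := min_gt0 (divr_gt0 d0 N0) (divr_gt0 (divr_gt0 e0 (ltr0Sn R 1)) k0).
have sn : enorm (s *: t) = s * enorm t by rewrite enormZ gtr0_norm.
have sN : s * enorm t <= s * N by rewrite ler_pM2l.
have st : enorm (s *: t) < d.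
  by rewrite sn; apply: (le_lt_trans sN); rewrite -ltr_pdivlMr.
have [c [v [_ v1 _ _ est]]] := hd _ st.
have [k1 k2] := normal_rate v1 (hl _) (ltW e11) est.
have k3 := normal_defect v1.
rewrite -scalemxAl sn in est k1 k2.
have k4 := cauchy_schwarz (grad phi v - grad phi u - s *: (t *m L)) u.
rewrite u1 mulr1 dotDl dotNl dotZl in k4.
have k5 : enorm (grad phi v - grad phi u) * enorm (v - u) <=
    s * (s * ((l + 1) * ((l + 1) / gamma) * N ^+ 2)).
  apply: (@le_trans _ _ ((l + 1) * (s * N) * ((l + 1) / gamma * (s * N)))).
    rewrite ler_pM ?enorm_ge0 //.
      by apply: (le_trans k1); rewrite ler_pM2l.
    by apply: (le_trans k2); rewrite ler_pM2l // divr_gt0.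
  by rewrite le_eqVlt expr2; apply/orP; left; apply/eqP; ring.
have k6 : e1 * (s * enorm t) <= s * (e / 2).
  apply: (@le_trans _ _ (s * (e1 * N))); first by rewrite mulrCA ler_pM2l // ler_pM2l.
  rewrite ler_pM2l //; move: e1e; rewrite ltr_pdivlMr ?mulr_gt0 //; lra.
have k7 : s * (s * ((l + 1) * ((l + 1) / gamma) * N ^+ 2)) <= s * (e / 2).
  by rewrite ler_pM2l //; move: se; rewrite ltr_pdivlMr // => /ltW.
rewrite -(ler_pM2l s0) -{1}(gtr0_norm s0) -normrM.
move: (le_trans k3 (le_trans k5 k7)) (le_trans k4 (le_trans est k6)).
rewrite !ler_norml; keep_section.
by move=> /andP[? ?] /andP[? ?]; apply/andP; split; lra.
Qed.

Lemma prox_sub_pmx b g : plane a u b -> prox_sub C f a u b g -> prox_sub C f a u b (g *m pmx u).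
Proof.
by move=> hb sub z hz; rewrite dot_pmx; [exact: sub|exact: perp_planeB hz hb].
Qed.

(* [hess phi u] is only definite on the tangent space, so its normal direction is filled in. *)
Definition hess_full : 'M[R]_n.+1 := (hess phi u)^T + u^T *m u.

Lemma mul_hess_full x : x *m hess_full = x *m (hess phi u)^T + dot x u *: u.
Proof.
rewrite mulmxDr; congr (_ + _); have := mul_pmx u x; rewrite mulmxBr mulmx1.
by move/(can_inj (addKr x))/oppr_inj.
Qed.

Lemma hess_full_unit : hess_full \in unitmx.
Proof.
apply: unitmx_inj => x; rewrite mul_hess_full => E.
have xu : dot x u = 0.
  by have := congr1 (fun z : V => dot z u) E; rewrite /= dotDl dotZl hess_range // dotxx u1 dot0l; lra.
rewrite xu scale0r addr0 in E; have := hess_coercive u1 xu; rewrite E dot0l => h.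
apply: dot_eq0; apply/eqP; rewrite eq_le dot_ge0 andbT.
by rewrite -(ler_pM2l (divr_gt0 gamma_gt0 (ltr0Sn R 1))) mulr0.
Qed.

(* First-order expansion of the footpoint [b] and of the subgradient [g] at it, as the
   point [a + r eta + t] moves tangentially. *)
Lemma contact_expansion r (L : 'M[R]_n.+1) : 0 < r ->
  deltaA phi A (a + r *: grad phi u) = r ->
  is_Dnu phi A (a + r *: grad phi u) (grad phi u) L ->
  forall e, 0 < e -> exists d, 0 < d /\
    forall t : V, perp u t -> enorm t < d -> exists b g, [/\ plane a u b, prox_sub C f a u b g,
      enorm (b - a - (t - r *: (t *m L))) <= e * enorm t &
      enorm (g - t *m (L *m invmx hess_full *m pmx u)) <= e * enorm t].
Proof.
move=> r0 Er dnu e e0; have g0 := gamma_gt0; have Aa := base_in.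
have [l [l0 hl]] := mulmx_bound L; have [j [j0 hj]] := mulmx_bound (invmx hess_full).
have LP := Dnu_tangent r0 Er dnu.
set eta := grad phi u in Er dnu *.
pose nn := (l + 1) / gamma; have nn0 : 0 < nn by rewrite divr_gt0 // addr_gt0.
pose kc := 1 + enorm eta / gamma + 2 * r * (l + 1).
have ke : 0 <= enorm eta / gamma by rewrite divr_ge0 ?enorm_ge0 // ltW.
have rl : 0 < r * (l + 1) by rewrite mulr_gt0 // addr_gt0.
have kc0 : 0 < kc by rewrite /kc; lra.
pose k2 := (l + 1) * nn; have k20 : 0 < k2 by rewrite mulr_gt0 // addr_gt0.
have pu : 0 < phi u by exact: phi_gt0.
pose he := enorm eta + (l + 1); have he0 : 0 < he by rewrite ltr_wpDl ?enorm_ge0 ?addr_gt0.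
(* [e2] is the accuracy for the change of distance, [e1] that for [f b], [e3] that for linearising
   [grad phi], [e4] that for the differential [L]. *)
pose e2 := e / (2 * he); have e20 : 0 < e2 by rewrite divr_gt0 // mulr_gt0.
pose e1 := e2 * phi u / (2 * kc).
have e10 : 0 < e1 by rewrite divr_gt0 // mulr_gt0.
pose e3 := e / (4 * (nn * j)).
have e30 : 0 < e3 by exact: divr_gt0 e0 (mulr_gt0 (ltr0Sn R 3) (mulr_gt0 nn0 j0)).
have [e4 e40 [e4e e41]] := min_gt0 (divr_gt0 e0 (mulr_gt0 (ltr0Sn R 3) (addr_gt0 r0 j0))) (@ltr01 R).
have [d1 [d10 hd1]] := footpoint r0 Er dnu e40.
have [m [m0 hm]] := contact_graph.
have [d2 [d20 hd2]] := f_diff e10.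
have [d3 [d30 hd3]] := hess_expand e30.
have c1 : 0 < 4 * r * k2 by exact: mulr_gt0 (mulr_gt0 (ltr0Sn R 3) r0) k20.
have c2 : 0 < 12 * nn ^+ 2 + j * nn ^+ 2 by exact: addr_gt0 (mulr_gt0 (ltr0Sn R 11) (exprn_gt0 2 nn0)) (mulr_gt0 j0 (exprn_gt0 2 nn0)).
have [|d d0 /= /and5P[dd1 dm dd2 dd3 /and5P[dnn d_1 dr dk /andP[dc _]]]] :=
  @lt_all R [:: d1; m / kc; d2 / kc; d3 / nn; nn^-1; 1; r * gamma;
    e2 * phi u / (4 * r * k2); e / 4 / (12 * nn ^+ 2 + j * nn ^+ 2)].
  by rewrite /= d10 (divr_gt0 m0 kc0) (divr_gt0 d20 kc0) (divr_gt0 d30 nn0) invr_gt0 nn0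
    ltr01 (mulr_gt0 r0 g0) (divr_gt0 (mulr_gt0 e20 pu) c1) (divr_gt0 (divr_gt0 e0 (ltr0Sn R 3)) c2).
exists d; split=> // t ht td; have t0 := enorm_ge0 t.
have [c [v [xic v1 Ev dlt est]]] := hd1 t (lt_trans td dd1).
set y := a + r *: eta + t in xic Ev dlt; set dl := deltaA phi A y in Ev dlt.
have [w_t v_t] := normal_rate v1 (hl t) (ltW e41) est; rewrite -/eta -/nn in w_t v_t est.
have tr : enorm t / gamma < r by rewrite ltr_pdivrMr //; exact: lt_trans dr.
have [dl0 dl2] : 0 < dl /\ dl < 2 * r.
  by move: dlt tr; rewrite ler_norml; keep_section; move=> /andP[? ?] ?; split; lra.
set w := grad phi v in Ev est w_t *.
have Ec : c - a = t - (dl - r) *: eta - dl *: (w - eta).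
  have -> : c = y - dl *: w by rewrite -Ev opprB addrC subrK.
  by rewrite /y; row_ring.
have ca : enorm (c - a) <= kc * enorm t.
  rewrite Ec; apply: le_trans (enormBD _ _) _.
  have n1 := enormBD t ((dl - r) *: eta); rewrite !enormZ in n1 *.
  rewrite (gtr0_norm dl0).
  have n2 : `|dl - r| * enorm eta <= enorm eta / gamma * enorm t.
    have -> : enorm eta / gamma * enorm t = enorm t / gamma * enorm eta by ring.
    by rewrite ler_wpM2r ?enorm_ge0.
  have n3 : dl * enorm (w - eta) <= 2 * r * ((l + 1) * enorm t).
    by rewrite ler_pM ?enorm_ge0 //; exact: ltW.
  by move: n1 n2 n3; rewrite /kc; keep_section; move=> *; lra.
have scale (k q : R) : 0 < k -> d < q / k -> k * enorm t < q.
  by move=> kp; rewrite ltr_pdivlMr // mulrC; apply: le_lt_trans; rewrite ler_pM2l // ltW.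
have cm : enorm (c - a) < m by apply: le_lt_trans ca (scale _ _ kc0 dm).
have [b [hb Ecb bca vu sub]] := hm y c v dl0 xic v1 Ev cm.
have bP : b - a = (c - a) *m pmx u.
  have -> : c - a = (b - a) - f b *: u by rewrite Ecb addrAC.
  by rewrite mulmxBl -scalemxAl pmx_u scaler0 subr0 pmx_perp.
have ba : enorm (b - a) <= kc * enorm t by exact: le_trans bca ca.
have fb : `|f b| <= e1 * (kc * enorm t).
  have bd : enorm (b - a) < d2 by apply: le_lt_trans ba (scale _ _ kc0 dd2).
  have Eb : a + (b - a) = b by rewrite addrC subrK.
  have := hd2 (b - a) hb bd; rewrite Eb fa subr0 => /le_trans; apply.
  by rewrite ler_pM2l.
have wu : `|dot (w - eta) u| <= k2 * enorm t * enorm t.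
  apply: le_trans (normal_defect v1) _.
  apply: (@le_trans _ _ ((l + 1) * enorm t * (nn * enorm t))); first by rewrite ler_pM ?enorm_ge0.
  by rewrite /k2 le_eqVlt; apply/orP; left; apply/eqP; ring.
(* The component of [Ec] along [u] reads (dl - r) phi u = f b - dl (w - eta).u. Both terms on the
   right are o(|t|), the first because Df(a) = 0, the second by [normal_defect]. *)
have dlr : `|dl - r| <= e2 * enorm t.
  have E : (dl - r) * phi u = f b - dl * dot (w - eta) u.
    have := congr1 (fun z : V => dot z u) Ec; rewrite /= -(euler u_neq0) -/eta.
    have -> : c - a = (b - a) - f b *: u by rewrite Ecb addrAC.
    rewrite (dotDl (b - a)) (dotDl (t - _)) (dotDl t) !dotNl !dotZl (dotxx u) u1.
    by rewrite (ht : dot t u = 0) (hb : dot (b - a) u = 0); keep_section; move=> *; lra.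
  rewrite -(ler_pM2r pu) -{1}(gtr0_norm pu) -normrM E; apply: le_trans (ler_normB _ _) _.
  have n1 : e1 * (kc * enorm t) = e2 * phi u / 2 * enorm t.
    by rewrite /e1; field; rewrite gt_eqF.
  have n2 : `|dl * dot (w - eta) u| <= e2 * phi u / 2 * enorm t.
    rewrite normrM (gtr0_norm dl0); apply: (@le_trans _ _ (2 * r * (k2 * enorm t * enorm t))).
      by rewrite ler_pM // ltW.
    have := scale _ _ c1 dk => n3.
    by rewrite mulrA ler_wpM2r //; move: n3; keep_section; move=> *; lra.
  by move: fb n2; rewrite n1; keep_section; move=> *; lra.
exists b, ((dot v u)^-1 *: v *m pmx u); split=> //; first exact: prox_sub_pmx.
  have -> : b - a - (t - r *: (t *m L)) =
      - ((dl - r) *: ((eta + (w - eta)) *m pmx u)) - r *: ((w - eta - t *m L) *m pmx u).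
    have tP := pmx_perp ht; have LtP := pmx_perp (LP t).
    have D1 : (eta + (w - eta)) *m pmx u = eta *m pmx u + (w - eta) *m pmx u by exact: mulmxDl.
    have D2 : (w - eta - t *m L) *m pmx u = (w - eta) *m pmx u - t *m L by rewrite mulmxBl LtP.
    have D3 : (t - (dl - r) *: eta - dl *: (w - eta)) *m pmx u =
        t - (dl - r) *: (eta *m pmx u) - dl *: ((w - eta) *m pmx u).
      by rewrite mulmxBl mulmxBl tP -!scalemxAl.
    rewrite bP Ec D1 D2 D3; move: (t *m L) (eta *m pmx u) ((w - eta) *m pmx u) => q1 q2 q3.
    by row_ring.
  apply: le_trans (enormBD _ _) _; rewrite enormN !enormZ (gtr0_norm r0).
  have n1 := enorm_pmx (eta + (w - eta)) u1; have n2 := enorm_pmx (w - eta - t *m L) u1.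
  have n3 : enorm (eta + (w - eta)) <= he.
    apply: le_trans (enormD _ _) _; rewrite lerD2l; apply: (le_trans w_t).
    rewrite -[leRHS]mulr1 ler_wpM2l ?ltW //; last exact: lt_trans d_1.
    by rewrite addr_gt0.
  have n4 : `|dl - r| * enorm ((eta + (w - eta)) *m pmx u) <= e2 * enorm t * he.
    by rewrite ler_pM ?enorm_ge0 // (le_trans n1).
  have n5 : e2 * enorm t * he = e / 2 * enorm t by rewrite /e2; field; rewrite gt_eqF.
  have n6 : r * enorm ((w - eta - t *m L) *m pmx u) <= r * (e4 * enorm t).
    by rewrite ler_pM2l // (le_trans n2).
  have n7 : (r + j) * e4 <= e / 4.
    by move: e4e; rewrite ltr_pdivlMr ?mulr_gt0 ?addr_gt0 //; keep_section; move=> *; lra.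
  have n8 : 0 <= j * e4 by rewrite mulr_ge0 // ltW.
  have n9 : r * (e4 * enorm t) <= e / 4 * enorm t.
    by rewrite mulrA ler_wpM2r //; move: n7 n8; keep_section; move=> *; lra.
  have n10 : 0 <= e * enorm t by rewrite mulr_ge0 // ltW.
  by move: n4 n5 n6 n9 n10; keep_section; move=> *; lra.
have vn1 : enorm (v - u) <= 1.
  by apply: (le_trans v_t); rewrite mulrC -ler_pdivlMr // div1r; apply: ltW; exact: lt_trans dnn.
have vd : dot (v - u) (v - u) = 2 * (1 - dot v u) by exact: dot_unit_dist.
set g := (dot v u)^-1 *: v *m pmx u.
have sp := normal_split v1 vu (erefl g).
have gv : enorm g <= 2 * enorm (v - u).
  rewrite /g -scalemxAl enormZ gtr0_norm ?invr_gt0 //.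
  have -> : v *m pmx u = (v - u) *m pmx u by rewrite mulmxBl pmx_u subr0.
  have n1 : (dot v u)^-1 <= 2.
    rewrite -[2]invrK lef_pV2 ?posrE ?invr_gt0 //.
    by move: vd vn1 (enorm_ge0 (v - u)); rewrite dotxx; keep_section; move=> *; nra.
  rewrite ler_pM ?enorm_ge0 ?invr_ge0 ?(ltW vu) //; exact: enorm_pmx.
have vn0 := enorm_ge0 (v - u).
have sp2 : enorm (v - u - g) <= 12 * enorm (v - u) ^+ 2.
  apply: (le_trans sp); have gg := enorm_ge0 g.
  have g4 : enorm g ^+ 2 <= 4 * enorm (v - u) ^+ 2.
    by move: gv vn0 gg; rewrite !expr2; keep_section; move=> *; nra.
  move: gv vn0 gg vn1 g4 (sqr_ge0 (enorm g)); keep_section; move=> *; nra.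
have Eg : g - t *m (L *m invmx hess_full *m pmx u) =
    - ((v - u - g) *m pmx u) + ((v - u) - t *m L *m invmx hess_full) *m pmx u.
  have gP : g *m pmx u = g by apply: pmx_perp; exact: pmxP.
  rewrite !mulmxA -{1}gP !mulmxBl.
  by row_ring.
(* The normal is recovered by inverting [hess_full]; the added part (v - u).u is quadratic in v - u,
   both vectors being of unit length. *)
have Ej : (v - u) - t *m L *m invmx hess_full = ((v - u) *m hess_full - t *m L) *m invmx hess_full.
  by rewrite mulmxBl mulmxK // hess_full_unit.
have Eh : (v - u) *m hess_full - t *m L = - (w - eta - (v - u) *m (hess phi u)^T) +
    (w - eta - t *m L) + dot (v - u) u *: u.
  rewrite mul_hess_full; move: (_ *m (hess phi u)^T) (t *m L) (dot (v - u) u) => q1 q2 q3.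
  by row_ring.
have n1 : enorm (w - eta - (v - u) *m (hess phi u)^T) <= e3 * enorm (v - u).
  by apply: hd3; apply: le_lt_trans v_t (scale _ _ nn0 dd3).
have n2 : enorm (dot (v - u) u *: u) <= enorm (v - u) ^+ 2 / 2.
  rewrite enormZ u1 mulr1 dotDl dotNl (dotxx u) u1 mulr1 expr2 -dotxx vd.
  move: (dot_ge0 (v - u)); rewrite vd; keep_section; move=> *.
  by rewrite ler0_norm; lra.
have n3 : enorm ((v - u) *m hess_full - t *m L) <=
    e3 * enorm (v - u) + e4 * enorm t + enorm (v - u) ^+ 2 / 2.
  rewrite Eh; apply: le_trans (enormD _ _) _; apply: lerD n2.
  by apply: le_trans (enormD _ _) _; rewrite enormN lerD.
rewrite Eg; apply: le_trans (enormD _ _) _; rewrite enormN Ej.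
have n4 := enorm_pmx (v - u - g) u1.
have n5 := enorm_pmx (((v - u) *m hess_full - t *m L) *m invmx hess_full) u1.
have n6 := hj ((v - u) *m hess_full - t *m L).
have n7 : enorm (v - u) ^+ 2 <= nn ^+ 2 * enorm t * enorm t.
  apply: (@le_trans _ _ (nn * enorm t * (nn * enorm t))); first by rewrite expr2 ler_pM.
  by rewrite le_eqVlt; apply/orP; left; apply/eqP; ring.
have n8 : (12 * nn ^+ 2 + j * nn ^+ 2) * enorm t * enorm t <= e / 4 * enorm t.
  by rewrite ler_wpM2r // ltW // (scale _ _ c2 dc).
have n9 : j * (e3 * enorm (v - u)) <= e / 4 * enorm t.
  apply: (@le_trans _ _ (j * (e3 * (nn * enorm t)))); first by rewrite ler_pM2l // ler_pM2l.
  by rewrite /e3 le_eqVlt; apply/orP; left; apply/eqP; field; rewrite !gt_eqF.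
have n10 : (r + j) * e4 <= e / 4.
  by move: e4e; rewrite ltr_pdivlMr ?mulr_gt0 ?addr_gt0 //; keep_section; move=> *; lra.
have n11 : 0 <= r * e4 by rewrite mulr_ge0 // ltW.
have n12 : j * (e4 * enorm t) <= e / 4 * enorm t.
  by rewrite mulrA ler_wpM2r //; move: n10 n11; keep_section; move=> *; lra.
have n13 : j * enorm (v - u) ^+ 2 <= j * (nn ^+ 2 * enorm t * enorm t) by rewrite ler_pM2l.
have n14 := ler_wpM2l (ltW j0) n3.
have n15 : 0 <= e * enorm t by exact: mulr_ge0 (ltW e0) t0.
have n16 : 0 <= j * (nn ^+ 2 * enorm t * enorm t).
  exact: mulr_ge0 (ltW j0) (mulr_ge0 (mulr_ge0 (sqr_ge0 nn) t0) t0).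
move: n4 n5 n6 n7 n8 n9 n12 n13 n14 n15 n16 sp2.
keep_section; move=> *; lra.
Qed.

Lemma ntilde_twice : Ntilde_n phi A (a, grad phi u) -> ptw_twice_diff f a u.
Proof.
move=> [/= _ [r [r0 [rl [v [L [dnu inj]]]]]]].
have Ea := rlow_contact r0 rl; have Aa := base_in.
(* At a + r eta the point [a] is nearest, so the single value of the normal map there is eta. *)
have v_eta : v = grad phi u.
  case: dnu => _ [nuE _]; have : nuA phi A (a + r *: grad phi u) (grad phi u).
    exists a; last by rewrite Ea addrAC subrr add0r scalerA mulVf ?scale1r // gt_eqF.
    by split=> //; rewrite Ea addrAC subrr add0r phistarZ ?(ltW r0) // bdW_grad // mulr1.
  by rewrite nuE.
rewrite v_eta in dnu inj.
have LP := Dnu_tangent r0 Ea dnu; have hN := contact_expansion r0 Ea dnu.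
set N := _ *m pmx u in hN.
pose Q : 'M[R]_n.+1 := 1%:M - r *: (pmx u *m L).
have QE x : x *m Q = x - r *: (x *m pmx u *m L).
  by rewrite mulmxBr mulmx1 -scalemxAr mulmxA.
(* A kernel vector of [Q] is r times a vector in the range of [L], hence tangential, and then an
   eigenvector of [L] for 1/r: exactly what finite curvatures forbid. *)
have Qu : Q \in unitmx.
  apply: unitmx_inj => x; rewrite QE => /eqP; rewrite subr_eq0 => /eqP xE.
  have hx : perp u x by rewrite xE; apply: perpZ; apply: LP.
  rewrite (pmx_perp hx) in xE.
  apply: (inj u); [by apply/ext_normal_grad|exact: hx|].
  by rewrite {2}xE scalerA mulVf ?scale1r // gt_eqF.
have [q [q0 hq]] := mulmx_bound (invmx Q).
exists 0, (2^-1 *: (invmx Q *m N + (invmx Q *m N)^T)); split.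
  by rewrite linearZ /= linearD /= trmxK addrC.
apply: (@twice_of_subgradients R n f a u C K) => //.
- exact: semiconvex_ineq.
- exact: base_sub.
move=> e e0; have [d [d0 hd]] := hN _ (divr_gt0 e0 q0).
exists (d / q); split; first by rewrite divr_gt0.
(* Solve t - r t L = h: the contact seen from a + r eta + t has its foot within e|h| of a + h. *)
move=> h hh hdl; pose t := h *m invmx Q.
have tQ : t *m Q = h by rewrite /t mulmxKV.
have ht : perp u t.
  have : perp u (t *m Q) by rewrite tQ.
  rewrite QE => /(perpD (perpZ r (LP (t *m pmx u)))).
  by rewrite addrC subrK.
have tE : t - r *: (t *m L) = h by rewrite -tQ QE (pmx_perp ht).
have tq : enorm t <= q * enorm h by exact: hq.
have td : enorm t < d by apply: (le_lt_trans tq); rewrite mulrC -ltr_pdivlMr.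
have eq : e / q * enorm t <= e * enorm h.
  by apply: le_trans (ler_wpM2l (ltW (divr_gt0 e0 q0)) tq) _; rewrite mulrA divfK // gt_eqF.
have [b [g [hb sb bE gE]]] := hd t ht td; exists b, g; split=> //.
  by apply: le_trans eq; rewrite opprD addrA -{1}tE.
by apply: le_trans eq; rewrite mulmxA.
Qed.

(** Euclidean exterior balls of radius [r0] contain anisotropic ones of radius r0/rho, with the same
    constants for all contacts near (a, u). This gives the contact at [a] itself and the
    prolongation by the factor 2 behind the density condition. *)
Lemma contact_persists : exists m s0 : R, [/\ 0 < m, 0 < s0 & forall b v s, plane a u b ->
  enorm (b - f b *: u - a) < m -> enorm v = 1 -> enorm (v - u) < m -> 0 < dot v u ->
  prox_sub C f a u b ((dot v u)^-1 *: v) -> 0 <= s <= s0 ->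
  deltaA phi A (b - f b *: u + s *: grad phi v) = s].
Proof.
have [m1 [r0 [m10 r00 ball]]] := outer_ball; have [m2 [m20 hm2]] := epiA_near.
have [rho [e [rho0 e0 hr]]] := grad_wulff_bound A_closed A0 u1.
have [|m m0 /= /and4P[mm1 mm2 me _]] := @lt_all R [:: m1; m2; e]; first by rewrite /= m10 m20 e0.
exists m, (r0 / rho); split=> //; first exact: divr_gt0.
move=> b v s hb bm v1 vm vu sub /andP[s0 sr].
apply: (deltaA_outer_ball A_closed A0 v1 rho0 s0) => [z z1||y Ay].
- by apply: hr => //; exact: lt_trans vm me.
- by apply/hm2; [exact: lt_trans bm mm2|exists b, (f b)].
apply: ball => //; first exact: lt_trans bm mm1.
by rewrite mulr_ge0 ?(ltW rho0) //= -ler_pdivlMr.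
Qed.

Lemma twice_ntilde : ptw_twice_diff f a u -> Ntilde_n phi A (a, grad phi u).
Proof.
move=> [p [M [MT tw]]]; set eta := grad phi u; have Aa := base_in.
have eta1 : phistar phi eta = 1 by exact: bdW_grad.
have pu : 0 < phi u by exact: phi_gt0.
have [m1 [s0 [m10 s00 pers]]] := contact_persists.
have [m2 [m20 graph]] := contact_graph.
have Es0 : deltaA phi A (a + s0 *: eta) = s0.
  have := pers a u s0 (plane_base a u); rewrite fa scale0r subr0 !subrr enorm0 (dotxx u) u1 mulr1.
  move=> /(_ m10 erefl m10 ltr01); apply; last by rewrite lexx ltW.
  by move=> z hz; have := base_sub hz; rewrite !dot0l dotZl (dotC u) (hz : dot (z - a) u = 0) mulr0.
pose B := M *m pmx u *m (hess phi u)^T.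
have [k [k0 hk]] := mulmx_bound B.
(* r < s0/4 leaves room to double the contacts near a + r eta, whose distance is below 2r; r <
   1/(2k) makes [E] an invertible perturbation of the identity. *)
have [r r0 [rs rk]] := min_gt0 (divr_gt0 s00 (ltr0Sn R 3)) (divr_gt0 (@ltr01 R) (mulr_gt0 (ltr0Sn R 1) k0)).
have {}rk : r * k < 2^-1.
  move: rk; rewrite ltr_pdivlMr ?mulr_gt0 // => rk; rewrite -(ltr_pM2l (ltr0Sn R 1)) mulfV //; lra.
have rs0 : r < s0 by lra.
have Er : deltaA phi A (a + r *: eta) = r.
  by apply: (deltaA_segment A_closed A0 eta1 Aa Es0); rewrite !ltW.
have stab := contact_stable A_closed A0 u1 Aa r0 rs0 Es0.
pose E : 'M[R]_n.+1 := 1%:M + r *: B.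
have EE x : x *m E = x + r *: (x *m B) by rewrite mulmxDr mulmx1 -scalemxAr.
have Eu : E \in unitmx.
  apply: unitmx_inj => x; rewrite EE => /eqP; rewrite addr_eq0 => /eqP xE.
  have : enorm x <= r * (k * enorm x) by rewrite {1}xE enormN enormZ gtr0_norm // ler_pM2l.
  have := enorm_ge0 x; move=> x0 h; apply/enorm0_eq0/eqP; rewrite eq_le x0 andbT.
  have : r * k * enorm x <= 2^-1 * enorm x by rewrite ler_wpM2r // ltW.
  lra.
(* Projection onto [perp u] along eta, the direction in which the normal does not change. To first
   order x T = h E and w - eta = h B for the foot a + h, so the candidate differential is T E^-1
   B. *)
pose T : 'M[R]_n.+1 := 1%:M - (phi u)^-1 *: (u^T *m eta).
have TE x : x *m T = x - (dot x u / phi u) *: eta.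
  rewrite mulmxBr mulmx1 -scalemxAr mulmxA; congr (_ - _).
  rewrite [x *m u^T]mx11_scalar mul_scalar_mx scalerA mulrC; congr ((_ / _) *: _).
  by rewrite mxE; apply: eq_bigr => i _; rewrite !mxE.
have Tperp x : dot x u = 0 -> x *m T = x by rewrite TE => ->; rewrite mul0r scale0r subr0.
have Teta : eta *m T = 0 by rewrite TE euler // divff ?gt_eqF // scale1r subrr.
have Bperp x : dot (x *m B) u = 0 by rewrite /B mulmxA hess_range.
pose L := T *m invmx E *m B.
have LE x : x *m L = x *m T *m invmx E *m B.
  by rewrite /L (mulmxA x (T *m invmx E) B) (mulmxA x T).
split; first by split=> //; split=> //; exists r.
exists r; split=> //; split.
  apply: (@lt_le_trans _ _ (2 * r)%:E); first by rewrite lte_fin; lra.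
  apply: ereal_sup_ubound; right; exists 2, r; split=> //=.
  - by rewrite ltr1n.
  - apply: (@lt_le_trans _ _ s0%:E); first by rewrite lte_fin.
    by apply: ereal_sup_ubound; exists s0.
  have [|q q0 /= /andP[q1 /andP[q2 /andP[q3 _]]]] := @lt_all R [:: m1; m2; r].
    by rewrite /= m10 m20 r0.
  have [d [d0 hd]] := stab q q0; apply: (density1_near d0) => x xd.
  have [dx dxr hx] := hd x xd; split; first exact: deltaA_gt0_notin.
  have [c xic] := xiA_exists A_closed A0 x.
  have [v [v1 Ev]] := xiA_normal A_closed A0 dx xic.
  have [vq cq] := hx c v xic v1 Ev.
  have [b [hb Ec _ vu sub]] := graph x c v dx xic v1 Ev (lt_trans cq q2).
  apply: ereal_sup_ubound; exists 2 => //; split=> //; exists c; split=> //.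
  rewrite Ev scalerA Ec; apply: pers => //.
  - by rewrite -Ec; exact: lt_trans cq q1.
  - exact: lt_trans vq q1.
  move: dxr; rewrite ltr_norml => /andP[_ dxr]; apply/andP; split; first by rewrite mulr_ge0 // ltW.
  by move: dxr q3 rs; keep_section; move=> *; lra.
exists eta, L; split; last first.
  (* With w = z E = z + r z B the eigenvalue equation z B = w/r reads z = 0. *)
  move=> nn /ext_normal_grad -/(_ u1) -> w wu.
  rewrite LE (Tperp w wu); set z := w *m invmx E => zB.
  have wz : w = z *m E by rewrite /z mulmxKV.
  have z0 : z = 0.
    move: zB; rewrite {1}wz EE scalerDr scalerA mulVf ?gt_eqF // scale1r => /eqP.
    rewrite -subr_eq0 opprD addrCA subrr addr0 oppr_eq0 scaler_eq0 invr_eq0 gt_eqF //= => /eqP //.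
  by rewrite wz z0 mul0mx.
rewrite /=; split; first by apply: (deltaA_gt0_notin A_closed A0); rewrite Er.
have far c : xiA phi A (a + r *: eta) c -> c = a.
  move=> xic; have dr : 0 < deltaA phi A (a + r *: eta) by rewrite Er.
  have [v [v1 Ev]] := xiA_normal A_closed A0 dr xic.
  apply/eqP; rewrite -subr_eq0; apply/eqP/enorm0_eq0/eqP; rewrite eq_le enorm_ge0 andbT.
  apply/ler_addgt0Pr => e e0; rewrite add0r; have [d [d0 hd]] := stab e e0.
  have [|_ _ hx] := hd (a + r *: eta); first by rewrite subrr enorm0.
  by have [_ /ltW] := hx c v xic v1 Ev.
have xia : xiA phi A (a + r *: eta) a.
  by split=> //; rewrite Er addrAC subrr add0r phistarZ ?(ltW r0) // eta1 mulr1.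
have aE : r^-1 *: (a + r *: eta - a) = eta.
  by rewrite addrAC subrr add0r scalerA mulVf ?scale1r // gt_eqF.
split.
  apply/seteqP; split=> [w [c /far -> <-]|w ->]; first by rewrite /= Er.
  by exists a => //; rewrite Er.
move=> e e0.
have [j [j0 hj]] := mulmx_bound (invmx E); have [tT [tT0 hT]] := mulmx_bound T.
have [mm [mm0 hmm]] := mulmx_bound (M *m pmx u); have [hh [hh0 hhh]] := mulmx_bound (hess phi u)^T.
pose W3 := mm + 1 + hh; have W30 : 0 < W3 by rewrite !addr_gt0.
pose W4 := tT * (1 + (k + 1) + r * W3).
have W40 : 0 < W4 by rewrite mulr_gt0 // !addr_gt0 // mulr_gt0.
have W50 : 0 < (W3 + k * (j * W4)) * (2 * (j * tT)).
  by exact: mulr_gt0 (addr_gt0 W30 (mulr_gt0 k0 (mulr_gt0 j0 W40))) (mulr_gt0 (ltr0Sn R 1) (mulr_gt0 j0 tT0)).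
have half0 : 0 < 2^-1 :> R by lra.
have [|q q0 /= /and5P[q1 qW3 qW4 qW5 _]] := @lt_all R [:: 1; W3^-1; 2^-1 / (j * W4);
    e / ((W3 + k * (j * W4)) * (2 * (j * tT)))].
  by rewrite /= ltr01 invr_gt0 W30 (divr_gt0 half0 (mulr_gt0 j0 W40)) (divr_gt0 e0 W50).
have [d1 [d10 hd1]] := normal_expand MT tw q0.
have [d2 [d20 hd2]] := f_diff q0.
have [d3 [d30 hd3]] := hess_expand q0.
have [|s sg0 /= /and5P[sm2 sd1 sd2 sd3 /andP[sq _]]] := @lt_all R [:: m2; d1; d2; d3; q].
  by rewrite /= m20 d10 d20 d30 q0.
have [d [d0 hd]] := stab s sg0; exists d; split=> // y w nAy yd [c xic Ew].
have [dy dyr hx] := hd y yd.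
have [v [v1 Ev]] := xiA_normal A_closed A0 dy xic.
have [vs cs] := hx c v xic v1 Ev.
have [b [hb Ec bc vu sub]] := graph y c v dy xic v1 Ev (lt_trans cs sm2).
have {}Ew : w = grad phi v by rewrite -Ew Ev scalerA mulVf ?scale1r // gt_eqF.
rewrite -Ew in Ev; set dl := deltaA phi A y in dy dyr Ev.
pose h := b - a; have hh' : perp u h by exact: hb.
have Eb : a + h = b by rewrite /h addrC subrK.
have hs : enorm h < s by exact: le_lt_trans bc cs.
have h0 := enorm_ge0 h.
have n1 : enorm (v - u - h *m (M *m pmx u)) <= q * enorm h.
  by apply: hd1 => //; rewrite ?Eb //; exact: lt_trans hs sd1.
have n2 : `|f b| <= q * enorm h.
  by have := hd2 h hh' (lt_trans hs sd2); rewrite Eb fa subr0.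
have n3 : enorm (w - eta - (v - u) *m (hess phi u)^T) <= q * enorm (v - u).
  by rewrite Ew; apply: hd3; exact: lt_trans vs sd3.
have n4 : enorm (v - u) <= (mm + 1) * enorm h.
  have := enorm_triB (v - u) (h *m (M *m pmx u)); have := hmm h.
  have : q * enorm h <= 1 * enorm h by rewrite ler_wpM2r // ltW.
  by move: n1; keep_section; move=> *; lra.
have n5 : enorm (w - eta - h *m B) <= q * W3 * enorm h.
  have -> : w - eta - h *m B = (w - eta - (v - u) *m (hess phi u)^T) +
      (v - u - h *m (M *m pmx u)) *m (hess phi u)^T.
    by rewrite (mulmxBl _ (h *m _)) /B !mulmxA addrA subrK.
  apply: le_trans (enormD _ _) _.
  have k1 := hhh (v - u - h *m (M *m pmx u)).
  have k2 : hh * enorm (v - u - h *m (M *m pmx u)) <= hh * (q * enorm h) by rewrite ler_pM2l.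
  have k3 : q * enorm (v - u) <= q * ((mm + 1) * enorm h) by rewrite ler_pM2l.
  by rewrite /W3; move: n3 k1 k2 k3; keep_section; move=> *; lra.
have qW31 : q * W3 <= 1.
  by move: qW3; rewrite -[W3^-1]div1r ltr_pdivlMr // => /ltW.
have n6 : enorm (w - eta) <= (k + 1) * enorm h.
  have := enorm_triB (w - eta) (h *m B); have := hk h.
  have : q * W3 * enorm h <= 1 * enorm h by rewrite ler_wpM2r.
  by move: n5; keep_section; move=> *; lra.
set x := y - _ in yd *.
have Ex : x = h - f b *: u + dl *: w - r *: eta.
  rewrite /x (_ : y = c + dl *: w); last by rewrite -Ev addrC subrK.
  by rewrite Ec /h; row_ring.
(* What remains is of higher order: the height [f b], a product of two small differences, and the
   linearisation error of [grad phi]. *)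
have n7 : x *m T - h *m E = - (f b *: (u *m T)) + (dl - r) *: ((w - eta) *m T) +
    r *: ((w - eta - h *m B) *m T).
  have wT : (w - eta) *m T = w *m T by rewrite mulmxBl Teta subr0.
  rewrite (mulmxBl (w - eta)) (Tperp (h *m B)) ?Bperp // wT Ex EE.
  rewrite mulmxBl mulmxDl mulmxBl -!scalemxAl Teta (Tperp h hh').
  by row_ring.
have n8 : enorm (x *m T - h *m E) <= q * W4 * enorm h.
  have k1 : enorm (f b *: (u *m T)) <= q * enorm h * tT.
    by rewrite enormZ ler_pM ?enorm_ge0 //; have := hT u; rewrite u1 mulr1.
  have k2 : enorm ((dl - r) *: ((w - eta) *m T)) <= q * (tT * ((k + 1) * enorm h)).
    rewrite enormZ ler_pM ?enorm_ge0 //; first by apply: ltW; exact: lt_trans dyr sq.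
    by apply: le_trans (hT _) _; rewrite ler_pM2l.
  have k3 : enorm (r *: ((w - eta - h *m B) *m T)) <= r * (tT * (q * W3 * enorm h)).
    rewrite enormZ gtr0_norm // ler_pM2l //.
    by apply: le_trans (hT _) _; rewrite ler_pM2l.
  rewrite n7; apply: le_trans (enormD _ _) _.
  have k4 := enormD (- (f b *: (u *m T))) ((dl - r) *: ((w - eta) *m T)); rewrite enormN in k4.
  by rewrite /W4; move: k1 k2 k3 k4; keep_section; move=> *; lra.
pose g := h - x *m T *m invmx E.
have n9 : enorm g <= q * (j * W4) * enorm h.
  have -> : g = - ((x *m T - h *m E) *m invmx E) by rewrite mulmxBl mulmxK // opprB.
  rewrite enormN; apply: le_trans (hj _) _.
  have : j * enorm (x *m T - h *m E) <= j * (q * W4 * enorm h) by rewrite ler_pM2l.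
  by keep_section; move=> *; lra.
(* The error [g] is at most half of |h|, so it is absorbed and |h| is controlled by |x|. *)
have n10 : enorm h <= 2 * (j * tT) * enorm x.
  have k1 : enorm h <= enorm (x *m T *m invmx E) + enorm g by exact: enorm_triB.
  have k2 : enorm (x *m T *m invmx E) <= j * (tT * enorm x).
    by apply: le_trans (hj _) _; rewrite ler_pM2l.
  have k3 : q * (j * W4) * enorm h <= 2^-1 * enorm h.
    rewrite ler_wpM2r // ltW //; move: qW4; rewrite ltr_pdivlMr //; exact: mulr_gt0.
  by move: k1 k2 k3 n9; keep_section; move=> *; lra.
have -> : w - eta - x *m L = (w - eta - h *m B) + g *m B.
  have -> : g *m B = h *m B - x *m L by rewrite LE (mulmxBl h).
  by move: (h *m B) (x *m L) => z1 z2; rewrite addrA subrK.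
apply: le_trans (enormD _ _) _.
have k1 := hk g.
have k2 : k * enorm g <= k * (q * (j * W4) * enorm h) by rewrite ler_pM2l.
have k3 : q * (W3 + k * (j * W4)) * enorm h <= q * (W3 + k * (j * W4)) * (2 * (j * tT) * enorm x).
  rewrite ler_wpM2l // mulr_ge0 ?(ltW q0) //.
  exact: ltW (addr_gt0 W30 (mulr_gt0 k0 (mulr_gt0 j0 W40))).
have k4 : q * ((W3 + k * (j * W4)) * (2 * (j * tT))) * enorm x <= e * enorm x.
  by rewrite ler_wpM2r ?enorm_ge0 // ltW //; move: qW5; rewrite ltr_pdivlMr.
by move: n5 k1 k2 k3 k4; keep_section; move=> *; lra.
Qed.

Lemma nu_expand (p : V) (M : 'M[R]_n.+1) (nu : V -> V) : M^T = M -> twice_at f a u p M ->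
  (forall b, plane a u b -> Neuc_fib (epif a u f) (b - f b *: u) (nu b)) ->
  plane_deriv nu a u (M *m pmx u) /\
  plane_deriv (grad phi \o nu) a u (M *m pmx u *m (hess phi u)^T).
Proof.
move=> MT tw hnu.
have nrm b : plane a u b -> [/\ enorm (nu b) = 1, 0 < dot (nu b) u &
    prox_sub C f a u b ((dot (nu b) u)^-1 *: nu b)].
  move=> hb; have [v1 [r [r0 hr]]] := Neuc_proximal (hnu b hb); split=> //.
    have [] // := @prox_sub_of_normal R n f a u C K (2 * r)^-1 1 b _ u1 v1 hb ltr01 K_ge0 _ f_lip f_cv.
      by rewrite invr_ge0 mulr_ge0 // ltW.
    by move=> y ey _; rewrite mulrC ler_pdivlMr ?mulr_gt0 // mulrC; exact: hr.
  have [] // := @prox_sub_of_normal R n f a u C K (2 * r)^-1 1 b _ u1 v1 hb ltr01 K_ge0 _ f_lip f_cv.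
    by rewrite invr_ge0 mulr_ge0 // ltW.
  by move=> y ey _; rewrite mulrC ler_pdivlMr ?mulr_gt0 // mulrC; exact: hr.
have ex := normal_expand MT tw.
have nua : nu a = u.
  have [d [d0 hd]] := ex 1 ltr01; have [v1 vu sub] := nrm a (plane_base a u).
  have z0 : perp u 0 by rewrite /perp /= dot0l.
  have := hd 0 (nu a) z0; rewrite enorm0 addr0 mul0mx subr0 mulr0 => /(_ d0 v1 vu sub) h.
  apply/eqP; rewrite -subr_eq0; apply/eqP/enorm0_eq0/eqP.
  by rewrite eq_le h enorm_ge0.
have D1 : plane_deriv nu a u (M *m pmx u).
  move=> e e0; have [d [d0 hd]] := ex e e0; exists d; split=> // h hh hdl.
  have [v1 vu sub] := nrm (a + h) (plane_add a hh).
  by rewrite nua; apply: hd.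
split=> // e e0.
have [k [k0 hk]] := mulmx_bound (hess phi u)^T.
have [m [m0 hm]] := mulmx_bound (M *m pmx u).
have m1 : 0 < m + 1 by rewrite addr_gt0.
have e1 : 0 < e / (2 * (m + 1)) by rewrite divr_gt0 // mulr_gt0.
have e2 : 0 < e / (2 * k) by rewrite divr_gt0 // mulr_gt0.
have [d1 [d10 hd1]] := hess_expand e1.
have [e3 e30 [e3e e31]] := min_gt0 e2 (@ltr01 R).
have [d2 [d20 hd2]] := D1 e3 e30.
have [d d0 [dd2 ddm]] := min_gt0 d20 (divr_gt0 d10 m1).
exists d; split=> // h hh hdl; rewrite /= nua.
have := hd2 h hh (lt_trans hdl dd2); rewrite nua => k1.
have h0 := enorm_ge0 h.
have k2 : enorm (nu (a + h) - u) <= (m + 1) * enorm h.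
  have := enorm_triB (nu (a + h) - u) (h *m (M *m pmx u)); have := hm h.
  have : e3 * enorm h <= 1 * enorm h by rewrite ler_wpM2r // ltW.
  lra.
have k3 : enorm (nu (a + h) - u) < d1.
  apply: (le_lt_trans k2); rewrite mulrC -ltr_pdivlMr //; exact: lt_trans ddm.
have k4 := hd1 _ k3.
have -> : grad phi (nu (a + h)) - grad phi u - h *m (M *m pmx u *m (hess phi u)^T) =
    (grad phi (nu (a + h)) - grad phi u - (nu (a + h) - u) *m (hess phi u)^T) +
    (nu (a + h) - u - h *m (M *m pmx u)) *m (hess phi u)^T.
  by rewrite (mulmxBl _ (h *m _)) !mulmxA addrA subrK.
apply: le_trans (enormD _ _) _.
have k5 : e / (2 * (m + 1)) * enorm (nu (a + h) - u) <= e / 2 * enorm h.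
  apply: le_trans (ler_wpM2l (ltW e1) k2) _; rewrite mulrA.
  by rewrite (_ : e / (2 * (m + 1)) * (m + 1) = e / 2) //; field; rewrite gt_eqF.
have k6 : k * enorm (nu (a + h) - u - h *m (M *m pmx u)) <= e / 2 * enorm h.
  apply: le_trans (ler_wpM2l (ltW k0) k1) _.
  apply: (@le_trans _ _ (k * (e / (2 * k) * enorm h))).
    by rewrite ler_pM2l // ler_wpM2r // ltW.
  by rewrite mulrA (_ : k * (e / (2 * k)) = e / 2) //; field; rewrite gt_eqF.
have := hk (nu (a + h) - u - h *m (M *m pmx u)); lra.
Qed.

Lemma plane_deriv_unique (g : V -> V) (L L' : 'M[R]_n.+1) :
  plane_deriv g a u L -> plane_deriv g a u L' -> forall t : V, perp u t -> t *m L = t *m L'.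
Proof.
move=> D D' t ht; apply/eqP; rewrite -subr_eq0; set x := _ - _.
apply: contraT; rewrite -enorm_gt0 => x0.
pose N := enorm t + 1; have N0 : 0 < N by rewrite ltr_wpDl // enorm_ge0.
have e0 : 0 < enorm x / (4 * N) by rewrite divr_gt0 // mulr_gt0.
have [d1 [d10 h1]] := D _ e0; have [d2 [d20 h2]] := D' _ e0.
have [d d0 [dd1 dd2]] := min_gt0 d10 d20.
pose s := d / N; have s0 : 0 < s by rewrite divr_gt0.
have st : enorm (s *: t) < d.
  rewrite enormZ gtr0_norm // /s mulrAC ltr_pdivrMr // ltr_pM2l // /N; lra.
have := h1 _ (perpZ s ht) (lt_trans st dd1); have := h2 _ (perpZ s ht) (lt_trans st dd2).
rewrite -!scalemxAl !enormZ (gtr0_norm s0); set G := g _ - g a => k2 k1.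
have : enorm (s *: x) <= enorm (G - s *: (t *m L')) + enorm (G - s *: (t *m L)).
  have -> : s *: x = (G - s *: (t *m L')) - (G - s *: (t *m L)).
    by rewrite /x scalerBr opprB addrCA addrAC -addrA; rewrite addrA addrAC addrC; row_ring.
  exact: enormBD.
rewrite enormZ (gtr0_norm s0) => k3.
have k4 : enorm x / (4 * N) * (s * enorm t) <= s * (enorm x / 4).
  rewrite (_ : _ * _ = s * (enorm x / 4) * (enorm t / N)); last by field; rewrite gt_eqF.
  have r1 : enorm t / N <= 1 by rewrite ler_pdivrMr // mul1r /N; lra.
  rewrite -[leRHS]mulr1 ler_wpM2l // mulr_ge0 ?(ltW s0) // divr_ge0 //; exact: enorm_ge0.
have : 0 < s * enorm x by rewrite mulr_gt0.
lra.
Qed.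

(** [L] is determined only on [perp u], where it agrees with the derivative of [nu_expand]. The
    Hessian is symmetric with range in [perp u], which removes the projection. *)
Lemma nu_formula (p : V) (M L : 'M[R]_n.+1) (nu : V -> V) : M^T = M -> twice_at f a u p M ->
  (forall b, plane a u b -> Neuc_fib (epif a u f) (b - f b *: u) (nu b)) ->
  plane_deriv (grad phi \o nu) a u L ->
  forall t1 t2 : V, perp u t1 -> perp u t2 ->
    dot (t1 *m M) (t2 *m (hess phi u)^T) = dot (t1 *m L) t2.
Proof.
move=> MT tw hnu DL t1 t2 h1 h2; have [_ D] := nu_expand MT tw hnu.
rewrite (plane_deriv_unique DL D h1) !mulmxA [RHS]dot_mulmx_tr trmxK.
rewrite dot_pmx; last by rewrite /perp /= -(hess_sym u_neq0) hess_range.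
by rewrite hess_sym.
Qed.

End Graph.
End UniformlyConvexNorm.

(** * Extension of semiconvex functions *)

Section SemiconvexExtension.
Local Set Default Proof Using "All".
Variables (R : realType) (n : nat).
Local Notation V := 'rV[R]_n.+1.
Variables (a : V) (eps C L : R) (D : set V) (f : V -> R) (g : V -> V).
Hypotheses (Da : D a) (eps_gt0 : 0 < eps) (C_ge0 : 0 <= C)
  (D_ball : forall x, D x -> enorm (x - a) < eps)
  (g_le : forall x, D x -> enorm (g x) <= L)
  (g_sub : forall x z, D x -> D z ->
     f x + dot (g x) (z - x) - C * dot (z - x) (z - x) <= f z).
Implicit Types (x y z : V) (t : R).

(** A subgradient of f + C|. - a|^2 at [x]. *)
Let slope x := g x + (2 * C) *: (x - a).
Let aff x z := f x + C * dot (x - a) (x - a) + dot (slope x) (z - x).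
Let hull z := sup [set aff x z | x in D].
Let kink z := Num.max 0 (enorm (z - a) - eps).
Let M := L + 2 * C * eps.

(* [C |x - a|^2] makes [f] convex on [D], hence a supremum of affine functions; outside the
   ball the correction [C kink^2] keeps the extension Lipschitz without spoiling convexity. *)
Definition semiconvex_ext z := hull z - C * dot (z - a) (z - a) + C * kink z ^+ 2.

Let slope_le x : D x -> enorm (slope x) <= M.
Proof.
move=> Dx; apply: le_trans (enormD _ _) _; rewrite enormZ ger0_norm ?mulr_ge0 //.
by rewrite lerD ?g_le // ler_wpM2l ?mulr_ge0 // ltW // D_ball.
Qed.

Let aff_lip x y z : D x -> aff x z <= aff x y + M * enorm (z - y).
Proof.
move=> Dx; rewrite /aff; have -> : z - x = (y - x) + (z - y) 
  by row_ring.
rewrite (dotDr (y - x)) addrA lerD2l; apply: le_trans (dot_le _ _) _.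
by rewrite ler_wpM2r ?enorm_ge0 // slope_le.
Qed.

Let aff_le x z : D x -> D z -> aff x z <= f z + C * dot (z - a) (z - a).
Proof.
move=> Dx Dz; have := g_sub Dx Dz; rewrite /aff /slope (dotDl (g x)) dotZl.
have -> : z - a = (z - x) + (x - a) by rewrite subrKA.
move: (z - x) (x - a) => p q; rewrite !dotE (dotC q p); lra.
Qed.

Let hull_ub x z : D x -> aff x z <= hull z.
Proof.
move=> Dx; apply: ub_le_sup; last by exists x.
exists (f a + M * enorm (z - a)) => _ [y Dy <-]; apply: le_trans (aff_lip a z Dy) _.
by rewrite lerD2r; have := aff_le Dy Da; rewrite subrr dot0l mulr0 addr0.
Qed.

Let hull_le z t : (forall x, D x -> aff x z <= t) -> hull z <= t.
Proof.
move=> h; apply: ge_sup; first by exists (aff a z), a.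
by move=> _ [x Dx <-]; exact: h.
Qed.

Let hull_lip y z : hull z <= hull y + M * enorm (z - y).
Proof.
apply: hull_le => x Dx; apply: le_trans (aff_lip y z Dx) _.
by rewrite lerD2r hull_ub.
Qed.

Let hull_convex : convex_on setT hull.
Proof.
move=> y z t _ _ /andP[t0 t1]; apply: hull_le => x Dx.
have -> : aff x (t *: y + (1 - t) *: z) = t * aff x y + (1 - t) * aff x z.
  rewrite /aff.
  have -> : t *: y + (1 - t) *: z - x = t *: (y - x) + (1 - t) *: (z - x).
    by row_ring.
  by rewrite !dotE; ring.
by rewrite lerD // ler_wpM2l ?hull_ub ?subr_ge0.
Qed.

Let kink_ge0 z : 0 <= kink z.
Proof. by rewrite le_max lexx. Qed.

Let kink_convex : convex_on setT kink.
Proof.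
move=> y z t _ _ /andP[t0 t1]; have t1' : 0 <= 1 - t by lra.
rewrite ge_max addr_ge0 ?(mulr_ge0 _ (kink_ge0 _)) //=.
have k1 : enorm (y - a) - eps <= kink y by rewrite le_max lexx orbT.
have k2 : enorm (z - a) - eps <= kink z by rewrite le_max lexx orbT.
have -> : t *: y + (1 - t) *: z - a = t *: (y - a) + (1 - t) *: (z - a).
  by row_ring.
have := enormD (t *: (y - a)) ((1 - t) *: (z - a)).
rewrite !enormZ (ger0_norm t0) (ger0_norm t1').
have := ler_wpM2l t0 k1; have := ler_wpM2l t1' k2; lra.
Qed.

Lemma semiconvex_ext_eq z : D z -> semiconvex_ext z = f z.
Proof.
move=> Dz; have k0 : kink z = 0 by apply/max_idPl; rewrite subr_le0 ltW // D_ball.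
have hz : hull z = f z + C * dot (z - a) (z - a).
  apply/eqP; rewrite eq_le hull_le /=; last by move=> x Dx; exact: aff_le.
  by have := hull_ub z Dz; rewrite /aff subrr dot0r addr0.
by rewrite /semiconvex_ext k0 hz expr0n mulr0 addr0 addrK.
Qed.

Lemma semiconvex_ext_convex : convex_on setT (fun z => C * enorm z ^+ 2 + semiconvex_ext z).
Proof.
have E z : C * enorm z ^+ 2 + semiconvex_ext z =
    hull z + C * kink z ^+ 2 + (2 * C * dot z a - C * dot a a).
  by rewrite /semiconvex_ext enorm_sqr !dotE (dotC a z); ring.
move=> y z t _ _ t01; rewrite !E; have [t0 t1] := andP t01.
have h1 := @hull_convex y z t I I t01; have h2 := @kink_convex y z t I I t01.
have h3 : C * kink (t *: y + (1 - t) *: z) ^+ 2 <=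
    C * (t * kink y ^+ 2 + (1 - t) * kink z ^+ 2).
  apply: ler_wpM2l => //; have := kink_ge0 (t *: y + (1 - t) *: z).
  move: (kink (_ + _)) (kink y) (kink z) h2 => p q r h2 p0.
  have h4 : p * p <= (t * q + (1 - t) * r) * (t * q + (1 - t) * r) by exact: ler_pM.
  have := mulr_ge0 (mulr_ge0 t0 (_ : 0 <= 1 - t)) (sqr_ge0 (q - r)).
  rewrite subr_ge0 => /(_ t1); rewrite !expr2; lra.
by rewrite !dotE; lra.
Qed.

Lemma semiconvex_ext_lip x y : `|semiconvex_ext x - semiconvex_ext y| <=
  (M + 2 * C * eps) * enorm (x - y).
Proof.
have key p q : semiconvex_ext p - semiconvex_ext q <= (M + 2 * C * eps) * enorm (p - q).
  have h1 := hull_lip q p.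
  (* As a function of the radius r, r^2 - kink^2 is r^2 up to [eps] and 2 eps r - eps^2 beyond,
     hence Lipschitz with constant 2 eps. The four cases locate the two radii. *)
  have h2 : (dot (q - a) (q - a) - kink q ^+ 2) - (dot (p - a) (p - a) - kink p ^+ 2) <=
      2 * eps * enorm (p - q).
    have := enorm_triB (q - a) (p - a); have -> : q - a - (p - a) = q - p 
      by row_ring.
    rewrite (enormB q p) !dotxx /kink.
    have := enorm_ge0 (q - a); have := enorm_ge0 (p - a); have := enorm_ge0 (p - q).
    move: (enorm (q - a)) (enorm (p - a)) (enorm (p - q)) => r s d d0 s0 r0 rs.
    have k : 0 <= s + d - r by lra.
    have := mulr_ge0 (ltW eps_gt0) k => ek.
    have [es|es] := leP eps s; have [er|er] := leP eps r.
    - rewrite !max_r ?subr_ge0 // !expr2; lra.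
    - rewrite max_l ?subr_le0 ?(ltW er) // max_r ?subr_ge0 // !expr2.
      have := mulr_ge0 (_ : 0 <= eps - r) (addr_ge0 (ltW eps_gt0) r0); rewrite subr_ge0 => /(_ (ltW er)).
      have := mulr_ge0 (ltW eps_gt0) (_ : 0 <= s - eps); rewrite subr_ge0 => /(_ es).
      have := mulr_ge0 (ltW eps_gt0) d0; lra.
    - rewrite max_r ?subr_ge0 // max_l ?subr_le0 ?(ltW es) // !expr2.
      have := sqr_ge0 (eps - s); rewrite expr2; lra.
    - rewrite !max_l ?subr_le0 ?(ltW es) ?(ltW er) // !expr2.
      have := mulr_ge0 (addr_ge0 r0 s0) k.
      have := mulr_ge0 d0 (_ : 0 <= 2 * eps - r - s) => /(_ ltac:(lra)); lra.
  have := ler_wpM2l C_ge0 h2; rewrite /semiconvex_ext; lra.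
have := key x y; have := key y x; rewrite (enormB y x) ler_norml => h1 h2.
by apply/andP; split; lra.
Qed.

End SemiconvexExtension.

(** * Sets of positive reach *)

Section PositiveReach.
Local Set Default Proof Using "All".
Variables (R : realType) (n : nat).
Local Notation V := 'rV[R]_n.+1.
Variables (A : set V) (rho : R).
Hypotheses (A_closed : closed A) (A_neq0 : A !=set0) (rho_gt0 : 0 < rho)
  (near_uniq : forall x, dist A x < rho -> exists! c, A c /\ enorm (x - c) = dist A x).
Implicit Types (x y z c p q v w : V) (e r s t : R).

Lemma dist_ge0 x : 0 <= dist A x.
Proof. by apply: dist_ge => // c _; exact: enorm_ge0. Qed.

Lemma dist_lip x y : dist A x <= dist A y + enorm (x - y).
Proof.
rewrite -lerBlDr; apply: dist_ge => // c Ac.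
by have := dist_le x Ac; have := enorm_tri x y c; lra.
Qed.

Lemma nearest x : dist A x < rho -> exists2 c, A c & enorm (x - c) = dist A x.
Proof. by move=> /near_uniq[c [[Ac Ec] _]]; exists c. Qed.

Lemma nearest_uniq x c c' : dist A x < rho -> A c -> enorm (x - c) = dist A x ->
  A c' -> enorm (x - c') = dist A x -> c = c'.
Proof.
move=> /near_uniq[q [_ hq]] Ac Ec Ac' Ec'.
by rewrite -(hq c (conj Ac Ec)); exact: hq.
Qed.

Lemma dist_gt0 x : dist A x < rho -> ~ A x -> 0 < dist A x.
Proof.
move=> xr nAx; have [c Ac Ec] := nearest xr; rewrite -Ec enorm_gt0 subr_eq0.
by apply: contra_notN nAx => /eqP ->.
Qed.

Lemma nearest_normal x c : 0 < dist A x -> A c -> enorm (x - c) = dist A x ->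
  exists v, [/\ enorm v = 1, x - c = dist A x *: v & Neuc A (c, v)].
Proof.
move=> d0 Ac Ec; have dn : dist A x != 0 by rewrite gt_eqF.
have v1 : enorm ((dist A x)^-1 *: (x - c)) = 1.
  by rewrite enormZ Ec gtr0_norm ?invr_gt0 // mulVf.
exists ((dist A x)^-1 *: (x - c)); split=> //; first by rewrite scalerA mulfV // scale1r.
split=> //; split=> //; exists (dist A x); split=> //=.
by rewrite scalerA mulfV // scale1r addrC subrK.
Qed.

Lemma dist_segment c v r t : A c -> enorm v = 1 -> dist A (c + r *: v) = r ->
  0 <= t <= r -> dist A (c + t *: v) = t.
Proof.
move=> Ac v1 Er /andP[t0 tr]; apply/eqP; rewrite eq_le; apply/andP; split.
  have := dist_le (c + t *: v) Ac.
  by rewrite addrAC subrr add0r enormZ v1 mulr1 ger0_norm.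
have := dist_lip (c + r *: v) (c + t *: v).
have -> : c + r *: v - (c + t *: v) = (r - t) *: v by row_ring.
by rewrite Er enormZ v1 ger0_norm ?subr_ge0 //; lra.
Qed.

(** Nearest points of points tending to [y] accumulate only at nearest points of [y], and there is
    just one. *)
Lemma nearest_cont y q e : dist A y < rho -> A q -> enorm (y - q) = dist A y -> 0 < e ->
  exists d, 0 < d /\ forall z c, enorm (z - y) < d -> A c -> enorm (z - c) = dist A z ->
    enorm (c - q) < e.
Proof.
move=> yr Aq Eq e0; apply: contrapT => /forallNP H.
have step (k : nat) : exists c, [/\ A c, enorm (y - c) <= dist A y + k.+1%:R^-1 & e <= enorm (c - q)].
  have k0 : 0 < k.+1%:R^-1 :> R by rewrite invr_gt0.
  apply: contrapT => h; apply: (H (k.+1%:R^-1 / 2)); split; first by rewrite divr_gt0.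
  move=> z c zy Ac Ez; rewrite ltNge; apply/negP => ec; apply: h; exists c; split=> //.
  move: k.+1%:R^-1 zy => i zy.
  by have := enorm_tri y z c; have := dist_lip z y; rewrite (enormB y z) Ez; lra.
have [c hc] := choice step.
have [k|p [h [hk hp]]] := @bounded_subseq R n c (enorm y + (dist A y + 1)).
  have [_ yc _] := hc k; have i1 : k.+1%:R^-1 <= 1 :> R by rewrite invf_le1 // ler1n.
  move: k.+1%:R^-1 yc i1 => i yc i1.
  by have := enorm_triB (c k) y; rewrite enormB; lra.
have small e' : 0 < e' -> exists k, [/\ A (c k), enorm (c k - p) < e',
    enorm (y - c k) <= dist A y + e' & e <= enorm (c k - q)].
  move=> e'0; have [k ke] := inv_archi e'0; exists (h k); have [h1 h2 h3] := hc (h k).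
  split=> //; first exact: lt_trans (hp k) ke.
  have : (h k).+1%:R^-1 <= k.+1%:R^-1 :> R by rewrite lef_pV2 ?posrE // ler_nat ltnS.
  by move: k.+1%:R^-1 (h k).+1%:R^-1 ke h2 => i j; lra.
have Ap : A p.
  by apply: closed_enorm => // d d0; have [k [Ak kp _ _]] := small d d0; exists (c k).
have Ep : enorm (y - p) = dist A y.
  apply/eqP; rewrite eq_le dist_le // andbT; apply/ler_addgt0Pr => e' e'0.
  have e2 : 0 < e' / 2 by rewrite divr_gt0.
  have [k [_ kp ky _]] := small _ e2; have := enorm_tri y (c k) p; lra.
have [k [_ kp _]] := small e e0.
by rewrite (nearest_uniq yr Aq Eq Ap Ep) leNgt kp.
Qed.

(* At a point [y] where the distance is maximal on a ball around [c + s v], the gradient of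
   the distance is radial, so the segment from [y] to its nearest point passes through the
   centre. *)
Lemma normal_extend c v s : A c -> enorm v = 1 -> 0 < s < rho -> dist A (c + s *: v) = s ->
  exists2 s', s < s' & dist A (c + s' *: v) = s'.
Proof.
move=> Ac v1 /andP[s0 sr] Es; set x := c + s *: v in Es.
have rs : 0 < rho - s by rewrite subr_gt0.
have [d d0 [ds dr]] := min_gt0 s0 rs.
have [|||y] := @EVT_max_rV R n.+1 (dist A) (setT `&` [set y | enorm (y - x) <= d]).
- by exists x; split=> //=; rewrite subrr enorm0 ltW.
- by apply: compact_eball; exact: closedT.
- apply: within_continuousW => z _; apply/cvg_enorm => e e0; exists e; split=> // w.
  have := dist_lip z w; have := dist_lip w z; rewrite (enormB z w) ltr_norml => h1 h2 h3.
  by apply/andP; split; lra.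
rewrite inE => -[_ /= yx] ymax.
have dy_lb : s <= dist A y.
  by rewrite -Es; apply: ymax; rewrite inE; split=> //=; rewrite subrr enorm0 ltW.
have dy_ub : dist A y < rho by have := dist_lip y x; rewrite Es; lra.
have dy0 : 0 < dist A y by exact: lt_le_trans dy_lb.
have [q Aq Eq] := nearest dy_ub.
have [w [w1 Ew _]] := nearest_normal dy0 Aq Eq.
pose e := d *: w - (y - x).
(* [e] points from [y] to x + d w, so moving along it stays in the ball by convexity; if e.w > 0 the
   distance would increase, since the nearest point moves continuously. *)
have ew : dot e w <= 0.
  rewrite leNgt; apply/negP => ew.
  have eN : 0 < enorm e + 1 by rewrite ltr_wpDl // enorm_ge0.
  have [|m [m0 hm]] := @nearest_cont y q (dist A y * dot e w / (enorm e + 1)) dy_ub Aq Eq.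
    exact: divr_gt0 (mulr_gt0 dy0 ew) eN.
  have [t t0 [tm t1]] := min_gt0 (divr_gt0 m0 eN) (@ltr01 R).
  have tE : enorm (y + t *: e - y) < m.
    rewrite addrAC subrr add0r enormZ gtr0_norm //.
    by move: tm; rewrite ltr_pdivlMr //; apply: le_lt_trans; rewrite ler_pM2l // lerDl.
  have le_y : dist A (y + t *: e) <= dist A y.
    apply: ymax; rewrite inE; split=> //=.
    have -> : y + t *: e - x = (1 - t) *: (y - x) + (t * d) *: w.
      by rewrite /e; row_ring.
    apply: le_trans (enormD _ _) _; rewrite !enormZ w1 mulr1 !gtr0_norm ?mulr_gt0 ?subr_gt0 //.
    by have := @ler_wpM2l _ (1 - t) (_ : 0 <= 1 - t) _ _ yx; rewrite subr_ge0 => /(_ (ltW t1)); lra.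
  have [b Ab Eb] := nearest (le_lt_trans le_y dy_ub).
  have bq := hm _ _ tE Ab Eb.
  have k1 : dist A y ^+ 2 <= enorm (y - b) ^+ 2.
    by rewrite ler_pXn2r ?nnegrE ?dist_ge0 ?enorm_ge0 // dist_le.
  have k2 : enorm (y + t *: e - b) ^+ 2 <= dist A y ^+ 2.
    by rewrite Eb ler_pXn2r ?nnegrE ?dist_ge0.
  rewrite enorm_sqr in k1; rewrite enorm_sqr in k2.
  have Ee : y + t *: e - b = (y - b) + t *: e by rewrite addrAC.
  have Eyb : y - b = dist A y *: w - (b - q).
    by rewrite -Ew; row_ring.
  have k3 : 0 < dot e (y - b).
    rewrite Eyb dotDr dotNr dotZr subr_gt0; apply: le_lt_trans (dot_le _ _) _.
    move: bq; rewrite ltr_pdivlMr //; apply: le_lt_trans.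
    by rewrite mulrC ler_wpM2l ?enorm_ge0 // lerDl.
  have k4 : 0 < t * dot e (y - b) by rewrite mulr_gt0.
  have k5 : 0 <= t * (t * dot e e) by rewrite !mulr_ge0 ?dot_ge0 // ltW.
  move: k1 k2 k4 k5; rewrite Ee; move: (y - b) (e) => z e'.
  by rewrite !dotE (dotC z e'); lra.
(* Expanding, |e|^2 = 2 d (e.w) - (d^2 - |y - x|^2) <= 0, so [e] vanishes. *)
have yE : y = x + d *: w.
  apply/eqP; rewrite -subr_eq0 opprD addrA -oppr_eq0 opprB -/e; apply/eqP/dot_eq0.
  apply/eqP; rewrite eq_le dot_ge0 andbT.
  have e2 : dot e e = 2 * (d * dot e w) - (d * d - dot (y - x) (y - x)).
    by rewrite /e; move: (y - x) => z; rewrite !dotE (dotxx w) w1 (dotC z w); ring.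
  have : dot (y - x) (y - x) <= d * d by rewrite dotxx ler_pM ?enorm_ge0.
  have : d * dot e w <= 0 by rewrite pmulr_rle0.
  by rewrite e2; lra.
have xq : x - q = (dist A y - d) *: w by rewrite scalerBl -Ew yE; row_ring.
have nxq : enorm (x - q) = dist A y - d.
  by rewrite xq enormZ w1 mulr1 gtr0_norm //; lra.
(* [q] lies at distance dist A y - d from [x], which is at least [s]; the Lipschitz bound gives the
   reverse. Hence [q] is also nearest to [x], and uniqueness identifies it with [c]. *)
have dys : dist A y = s + d.
  have := dist_le x Aq; have := dist_lip y x; rewrite nxq Es.
  have -> : y - x = d *: w by rewrite yE addrAC subrr add0r.
  by rewrite enormZ w1 gtr0_norm //; lra.
have qc : q = c.
  apply: (@nearest_uniq x) => //; rewrite ?Es //; first by rewrite nxq dys addrK.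
  by rewrite /x addrAC subrr add0r enormZ v1 gtr0_norm ?mulr1.
have wv : w = v.
  have : s *: w = s *: v.
    by have := xq; rewrite qc dys addrK /x addrAC subrr add0r.
  by move/(congr1 (fun z : V => s^-1 *: z)); rewrite !scalerA mulVf ?gt_eqF // !scale1r.
exists (s + d); first by rewrite ltrDl.
by rewrite -[RHS]dys yE /x wv scalerDl addrA.
Qed.

(** Continuation: the supremum of the admissible lengths up to [rho] is attained, and
    [normal_extend] contradicts a maximum below [rho]. *)
Lemma normal_rho c v : Neuc A (c, v) -> dist A (c + rho *: v) = rho.
Proof.
move=> [/= Ac [v1 [r [r0 Er]]]].
pose S := [set t : R | 0 <= t <= rho /\ dist A (c + t *: v) = t].
have S_ub : ubound S rho by move=> t [/andP[]].
have [r1 r10 [r1r r1rho]] := min_gt0 r0 rho_gt0.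
have Sr1 : S r1.
  split; first by rewrite (ltW r10) ltW.
  by apply: (dist_segment Ac v1 Er); rewrite (ltW r10) ltW.
have hS : has_sup S by split; [exists r1|exists rho].
set m := sup S; have r1m : r1 <= m by apply: ub_le_sup => //; exists rho.
have m_rho : m <= rho by apply: ge_sup => //; exists r1.
have m0 : 0 < m by exact: lt_le_trans r1m.
have Em : dist A (c + m *: v) = m.
  apply/eqP; rewrite eq_le; apply/andP; split.
    have := dist_le (c + m *: v) Ac.
    by rewrite addrAC subrr add0r enormZ v1 mulr1 gtr0_norm.
  apply/ler_addgt0Pr => e e0; have e2 : 0 < e / 2 by rewrite divr_gt0.
  have [t [St Et] mt] := sup_adherent e2 hS.
  have tm : t <= m by apply: ub_le_sup; [exists rho|split].
  have := dist_lip (c + t *: v) (c + m *: v).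
  have -> : c + t *: v - (c + m *: v) = (t - m) *: v by row_ring.
  by rewrite Et enormZ v1 mulr1 ler0_norm ?subr_le0 // -/m in mt *; move: mt tm; clear; lra.
have [<- //|/eqP mr] := eqVneq m rho.
have {}mr : m < rho by rewrite lt_neqAle m_rho andbT; apply/eqP.
have [|s ms Es] := @normal_extend c v m Ac v1 _ Em; first by rewrite m0.
have [t mt [ts tr]] : exists2 t, m < t & t <= s /\ t <= rho.
  by exists (Num.min s rho); rewrite ?lt_min ?ms // !ge_min !lexx orbT.
have : S t.
  by split; [|apply: (dist_segment Ac v1 Es)]; rewrite ?ts ?tr andbT ltW // (lt_trans m0).
by move=> /(ub_le_sup (ex_intro _ rho S_ub)); rewrite -/m leNgt mt.
Qed.

Lemma normal_proximal c v y : Neuc A (c, v) -> A y ->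
  2 * rho * dot (y - c) v <= dot (y - c) (y - c).
Proof.
move=> cv Ay; have [_ [v1 _]] := cv.
by rewrite -(ball_proximal c y v1 (ltW rho_gt0)) -{1}(normal_rho cv); exact: dist_le.
Qed.

Lemma proximal_normal c v : A c -> enorm v = 1 ->
  (forall y, A y -> 2 * rho * dot (y - c) v <= dot (y - c) (y - c)) -> Neuc A (c, v).
Proof.
move=> Ac v1 h; split=> //; split=> //; exists rho; split=> //=.
apply/eqP; rewrite eq_le; apply/andP; split.
  have := dist_le (c + rho *: v) Ac.
  by rewrite addrAC subrr add0r enormZ v1 mulr1 gtr0_norm.
by apply: dist_ge => // y Ay; rewrite (ball_proximal c y v1 (ltW rho_gt0)); exact: h.
Qed.

(** Unit vectors subconverge, and the proximal inequality survives the limit because its constant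
    [rho] is fixed. [P] records what is known of the approximating normals. *)
Lemma normal_limit c (P : V -> Prop) : A c ->
  (forall s, 0 < s -> exists q v, [/\ Neuc A (q, v), enorm (q - c) < s & P v]) ->
  exists p, Neuc A (c, p) /\ forall e, 0 < e -> exists v, P v /\ enorm (v - p) < e.
Proof.
move=> Ac H.
have step (k : nat) : exists qv : V * V,
    [/\ Neuc A qv, enorm (qv.1 - c) < k.+1%:R^-1 & P qv.2].
  have [|q [v [h1 h2 h3]]] := H k.+1%:R^-1; first by rewrite invr_gt0.
  by exists (q, v).
have [g hg] := choice step.
have [k|p [h [hk hp]]] := @bounded_subseq R n (fun k => (g k).2) 1.
  by have [[_ [-> _]] _ _] := hg k.
have small e : 0 < e -> exists q v, [/\ Neuc A (q, v), enorm (q - c) < e, P v & enorm (v - p) < e].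
  move=> e0; have [k ke] := inv_archi e0; have [h1 h2 h3] := hg (h k).
  exists (g (h k)).1, (g (h k)).2; split=> //.
    apply: lt_trans h2 _; apply: le_lt_trans ke.
    by rewrite lef_pV2 ?posrE // ler_nat ltnS.
  exact: lt_trans (hp k) ke.
have p1 : enorm p = 1.
  apply/eqP; rewrite eq_le; apply/andP; split; apply/ler_addgt0Pr => e e0.
    have [q [v [[_ [/= v1 _]] _ _ vp]]] := small e e0.
    by have := enorm_triB p v; rewrite enormB v1; lra.
  have [q [v [[_ [/= v1 _]] _ _ vp]]] := small e e0.
  by have := enorm_triB v p; rewrite v1; lra.
exists p; split; last by move=> e /small[q [v [_ _ ? ?]]]; exists v.
apply: proximal_normal => // y Ay; apply/ler_addgt0Pr => e e0.
have N0 := enorm_ge0 (y - c); set N := enorm (y - c) in N0.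
have D0 : 0 < 2 * N + 1 + 2 * rho * (1 + N).
  by have := mulr_ge0 (ltW rho_gt0) N0; have := rho_gt0; lra.
have [m m0 [me m1]] := min_gt0 (divr_gt0 e0 D0) (@ltr01 R).
have [q [v [qv qc _ vp]]] := small m m0; have [_ [/= v1 _]] := qv.
have k1 := normal_proximal qv Ay.
have k2 : dot (y - c) p = dot (y - q) v + dot (q - c) v - dot (y - c) (v - p).
  by rewrite !dotE; ring.
have k3 : dot (q - c) v <= m.
  by apply: le_trans (dot_le _ _) _; rewrite v1 mulr1 ltW.
have k4 : - (N * m) <= dot (y - c) (v - p).
  by apply: le_trans (dot_ge _ _); rewrite lerN2 ler_wpM2l // ltW.
have k5 : dot (y - q) (y - q) <= (N + m) * (N + m).
  have yq : enorm (y - q) <= N + m by have := enorm_tri y c q; rewrite (enormB c q) -/N; lra.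
  by rewrite dotxx ler_pM ?enorm_ge0.
have k6 : dot (y - c) (y - c) = N * N by rewrite dotxx.
have k7 : m * (2 * N + 1 + 2 * rho * (1 + N)) <= e by rewrite -ler_pdivlMr // ltW.
have k8 : m * m <= m * 1 by rewrite ler_pM2l // ltW.
have k9 : 2 * rho * dot (y - c) p <= 2 * rho * dot (y - q) v + 2 * rho * (m + N * m).
  by rewrite -mulrDr ler_pM2l ?mulr_gt0 // k2; lra.
rewrite k6; lra.
Qed.

Lemma bdry_normal c : bdry A c -> exists v, Neuc A (c, v).
Proof.
move=> /(bdryP _ A_closed)[Ac hc].
have [s s0|v [cv _]] := @normal_limit c (fun=> True) Ac; last by exists v.
have [d d0 [ds dr]] := min_gt0 (divr_gt0 s0 (ltr0Sn R 1)) rho_gt0.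
have [y [yc nAy]] := hc d d0; have dy := dist_le y Ac.
have yr : dist A y < rho by lra.
have [q Aq Eq] := nearest yr; have [v [_ _ qv]] := nearest_normal (dist_gt0 yr nAy) Aq Eq.
exists q, v; split=> //.
by have := enorm_tri q y c; rewrite (enormB q y) Eq; lra.
Qed.

(** * Normals and inner cones near the base point *)

Section BasePoint.
Variables (a u : V).
Hypotheses (a_in : A a) (a_fib : Neuc_fib A a = [set u]).

Lemma normals_near e : 0 < e -> exists s, 0 < s /\
  forall c v, Neuc A (c, v) -> enorm (c - a) < s -> enorm (v - u) < e.
Proof.
move=> e0; apply: contrapT => /forallNP H.
have [s s0|p [ap hp]] := @normal_limit a (fun v => e <= enorm (v - u)) a_in.
  apply: contrapT => h; apply: (H s); split=> // c v cv ca.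
  by rewrite ltNge; apply/negP => ev; apply: h; exists c, v.
have pu : p = u by have : Neuc_fib A a p by []; rewrite a_fib.
by have [v [ev]] := hp e e0; rewrite pu ltNge ev.
Qed.

Lemma inner_cone t : 0 < t -> exists s, 0 < s /\ forall c (e : V), A c -> enorm (c - a) < s ->
  enorm e < s -> dot e u <= - (t * enorm e) -> A (c + e).
Proof.
move=> t0; have t2 : 0 < t / 2 by rewrite divr_gt0.
have [s1 [s10 hs1]] := normals_near t2.
(* s1/3, as the foot of c + e is within |c - a| + 2|e| of [a]; rho t/4, as then 4|e|^2 < rho t |e|,
   against the proximal inequality at the foot. *)
have [|s sg0 /= /and4P[ss1 srho st _]] := @lt_all R [:: s1 / 3; rho; rho * t / 4].
  by rewrite /= (divr_gt0 s10 (ltr0Sn R 2)) rho_gt0 (divr_gt0 (mulr_gt0 rho_gt0 t0) (ltr0Sn R 3)).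
exists s; split=> // c e Ac ca es eu; apply: contrapT => nA.
have d_le := dist_le (c + e) Ac; rewrite addrAC subrr add0r in d_le.
have dr : dist A (c + e) < rho by lra.
have d0 := dist_gt0 dr nA; have [q Aq Eq] := nearest dr.
have [w [w1 Ew qw]] := nearest_normal d0 Aq Eq; set d := dist _ _ in d_le dr d0 Eq Ew.
have wu : enorm (w - u) < t / 2.
  apply: (hs1 q) => //; have := enorm_tri q (c + e) a; rewrite (enormB q (c + e)) Eq.
  have : enorm (c + e - a) <= enorm (c - a) + enorm e by rewrite addrAC enormD.
  by lra.
have ew : dot e w <= - (t / 2 * enorm e).
  have -> : w = u + (w - u) by rewrite addrC subrK.
  rewrite dotDr; have := dot_le e (w - u).
  have : enorm e * enorm (w - u) <= enorm e * (t / 2) by rewrite ler_wpM2l ?enorm_ge0 // ltW.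
  lra.
have Ecq : c - q = d *: w - e by rewrite -Ew; row_ring.
have k1 := normal_proximal qw Ac; rewrite Ecq in k1.
have k2 : d + t / 2 * enorm e <= dot (d *: w - e) w by rewrite !dotE (dotxx w) w1; lra.
have k3 : dot (d *: w - e) (d *: w - e) <= 4 * (enorm e * enorm e).
  have h : enorm (d *: w - e) <= 2 * enorm e.
    by apply: le_trans (enormBD _ _) _; rewrite enormZ w1 gtr0_norm //; lra.
  have -> : 4 * (enorm e * enorm e) = 2 * enorm e * (2 * enorm e) by ring.
  by rewrite dotxx ler_pM ?enorm_ge0.
have e_gt0 : 0 < enorm e by exact: lt_le_trans d_le.
have k4 : 2 * rho * (d + t / 2 * enorm e) <= 2 * rho * dot (d *: w - e) w.
  by rewrite ler_pM2l ?mulr_gt0.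
have k5 : enorm e * (4 * enorm e) < enorm e * (rho * t) by rewrite ltr_pM2l //; lra.
have k6 := mulr_gt0 rho_gt0 d0.
lra.
Qed.

End BasePoint.

Lemma plane_decomp (a u x x' : V) s s' : enorm u = 1 -> plane a u x -> plane a u x' ->
  x - s *: u = x' - s' *: u -> x = x' /\ s = s'.
Proof.
move=> u1 hx hx' E; have ss : s = s'.
  have := congr1 (fun y : V => dot (y - a) u) E; rewrite /= ![_ - _ - a]addrAC.
  rewrite (dotDl (x - a)) (dotDl (x' - a)) !dotNl !dotZl (dotxx u) u1.
  by rewrite (hx : dot (x - a) u = 0) (hx' : dot (x' - a) u = 0); lra.
by split=> //; move: E; rewrite ss => /addIr.
Qed.

(** * The boundary as a graph over a disc *)

Section Chart.
Variables (a u : V) (s : R).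
Hypotheses (a_bd : bdry A a) (u1 : enorm u = 1) (s_gt0 : 0 < s)
  (cone : forall c (e : V), A c -> enorm (c - a) < s -> enorm e < s ->
     dot e u <= - (2^-1 * enorm e) -> A (c + e))
  (thin_cone : forall t, 0 < t -> exists r, 0 < r /\ forall c (e : V), A c ->
     enorm (c - a) < r -> enorm e < r -> dot e u <= - (t * enorm e) -> A (c + e))
  (normals : forall c v, Neuc A (c, v) -> enorm (c - a) < s -> enorm (v - u) < 2^-1).

(** Chart values over the disc stay within [eps], well inside the depth window [del], so that every
    point and vector to which [cone] is applied stays in its range [s]. *)
Let eps := s / 32.
Let del := s / 4.
Let disc z := plane a u z /\ enorm (z - a) < eps.
(** 1/rho comes from the proximal inequality when the vertical increment is at most the horizontal
    one, and the factor 2 from division by v.u > 1/2. *)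
Let C := 2 / rho.

Let eps_gt0 : 0 < eps. Proof. exact: divr_gt0. Qed.
Let disc_a : disc a. Proof. by split; [exact: plane_base|rewrite subrr enorm0]. Qed.

(** Increasing [t] moves along -u, into A: such a displacement with slope at least 1 has length at
    most 2 (t' - t), so it lies in the cone with constant 1/2. *)
Lemma cone_climb z t z' t' : plane a u z -> plane a u z' -> A (z - t *: u) ->
  enorm (z - a) + `|t| < s -> enorm (z' - z) <= t' - t -> 2 * (t' - t) < s -> A (z' - t' *: u).
Proof.
move=> hz hz' Az zt zz ts; have tt : 0 <= t' - t by exact: le_trans (enorm_ge0 _) zz.
have zzu : dot (z' - z) u = 0 by exact: perp_planeB hz' hz.
have -> : z' - t' *: u = (z - t *: u) + ((z' - z) - (t' - t) *: u).
  by row_ring.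
have e_le : enorm ((z' - z) - (t' - t) *: u) <= 2 * (t' - t).
  by apply: le_trans (enormBD _ _) _; rewrite enormZ u1 ger0_norm //; lra.
apply: cone => //.
- rewrite addrAC; apply: le_lt_trans (enormBD _ _) _.
  by rewrite enormZ u1 mulr1.
- exact: le_lt_trans ts.
by rewrite dotDl zzu dotNl dotZl (dotxx u) u1; lra.
Qed.

Lemma cone_interior c t : A c -> enorm (c - a) < s -> 0 < t -> 2 * t < s ->
  interior A (c - t *: u).
Proof.
move=> Ac ca t0 ts; apply/interior_enorm; exists (t / 4); split; first exact: divr_gt0.
move=> y yc; set k := y - _ in yc.
have -> : y = c + (k - t *: u) by rewrite /k; row_ring.
have e_le : enorm (k - t *: u) <= 5 * t / 4.
  by apply: le_trans (enormBD _ _) _; rewrite enormZ u1 gtr0_norm //; lra.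
apply: cone => //; first by lra.
have := dot_le k u; rewrite u1 (dotDl k) dotNl dotZl (dotxx u) u1; lra.
Qed.

(** Otherwise a climb from z - t u to the axis reaches a point a - t' u of A with t' < 0, and the
    cone from there has [a] in its interior, although [a] is a boundary point. *)
Lemma chart_lb z t : plane a u z -> A (z - t *: u) -> enorm (z - a) <= s / 8 ->
  `|t| <= s / 4 -> - enorm (z - a) <= t.
Proof.
move=> hz Az za ts; rewrite leNgt; apply/negP => tz.
have z0 := enorm_ge0 (z - a); move: ts; rewrite ler_norml => /andP[ts ts'].
pose t' := t + enorm (z - a); have t'0 : t' < 0 by rewrite /t'; lra.
have Aa : A (a - t' *: u).
  apply: (@cone_climb z t) => //; first exact: plane_base.
  - by rewrite ltr0_norm; lra.
  - by rewrite /t' enormB; lra.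
  - by rewrite /t'; lra.
case: a_bd => _; apply; have -> : a = (a - t' *: u) - (- t') *: u.
  by rewrite scaleNr opprK subrK.
apply: cone_interior => //; last by rewrite /t'; lra.
  by rewrite addrAC subrr add0r enormN enormZ u1 mulr1 ltr0_norm // /t'; lra.
by rewrite oppr_gt0.
Qed.

(** The infimum runs over a bounded window because A may have further sheets on the same line. *)
Definition chart z := inf [set t : R | `|t| <= del /\ A (z - t *: u)].

Let a_in : A a. Proof. by have [] := (bdryP a A_closed).1 a_bd. Qed.

Lemma chart_spec z : disc z -> [/\ `|chart z| <= enorm (z - a), A (z - chart z *: u) &
  forall t, `|t| <= del -> A (z - t *: u) -> chart z <= t].
Proof.
move=> [hz ze]; rewrite /eps in ze; have z0 := enorm_ge0 (z - a); have s0 := s_gt0.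
set S := [set t : R | `|t| <= del /\ A (z - t *: u)].
have lbS t : S t -> - enorm (z - a) <= t by move=> [ts Az]; apply: chart_lb => //; lra.
have hlb : has_lbound S by exists (- enorm (z - a)).
have Sz : S (enorm (z - a)).
  split; first by rewrite ger0_norm // /del; lra.
  apply: (@cone_climb a 0) => //; rewrite ?subr0 //; first exact: plane_base.
  - by rewrite scale0r subr0.
  - by rewrite subrr enorm0 normr0 addr0.
  - by lra.
have hS : has_inf S by split=> //; exists (enorm (z - a)).
have h1 : chart z <= enorm (z - a) by exact: ge_inf.
have h2 : - enorm (z - a) <= chart z by apply: lb_le_inf => //; exists (enorm (z - a)).
split; first by rewrite ler_norml h1 h2.
  apply: closed_enorm => // d d0; have [t [ts Az] td] := inf_adherent d0 hS.
  exists (z - t *: u); split=> //.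
  have -> : z - t *: u - (z - chart z *: u) = (chart z - t) *: u.
    by row_ring.
  have tc : chart z <= t by exact: ge_inf.
  by rewrite enormZ u1 mulr1 ler0_norm ?subr_le0 // opprB ltrBlDl.
by move=> t ts Az; apply: ge_inf.
Qed.

Lemma chart_up z t : disc z -> chart z <= t -> `|t| <= del -> A (z - t *: u).
Proof.
move=> hz; have [c1 c2 _] := chart_spec hz; case: hz => hz; rewrite /eps /del => ze ct ts.
have s0 := s_gt0; have z0 := enorm_ge0 (z - a).
move: ts c1; rewrite ler_norml ler_norml => /andP[_ ts] /andP[c3 c4].
apply: (@cone_climb z (chart z)) => //.
- have : `|chart z| <= enorm (z - a) by rewrite ler_norml c3 c4.
  by lra.
- by rewrite subrr enorm0 subr_ge0.
- by lra.
Qed.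

Lemma chart_lip z z' : disc z -> disc z' -> chart z' <= chart z + enorm (z' - z).
Proof.
move=> hz hz'; have [c1 c2 _] := chart_spec hz; have [_ _ c3] := chart_spec hz'.
case: hz hz' => hz ze [hz' ze']; rewrite /eps in ze ze'.
have s0 := s_gt0; have z0 := enorm_ge0 (z - a); have zz0 := enorm_ge0 (z' - z).
have zz : enorm (z' - z) < s / 16 by have := enorm_tri z' a z; rewrite (enormB a z); lra.
apply: c3.
  move: c1; rewrite !ler_norml /del => /andP[c1 c1']; apply/andP; split; lra.
apply: (@cone_climb z (chart z)) => //; rewrite ?[_ + _ - _]addrAC ?subrr ?add0r //; lra.
Qed.

Lemma chart_bdry z : disc z -> bdry A (z - chart z *: u).
Proof.
move=> hz; have [c1 c2 c3] := chart_spec hz; apply/(bdryP _ A_closed); split=> // d d0.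
case: hz => hz; rewrite /eps => ze; have s0 := s_gt0.
have s8 : 0 < s / 8 by exact: divr_gt0.
have [t t0 [td ts]] := min_gt0 d0 s8.
exists (z - (chart z - t) *: u); split.
  have -> : z - (chart z - t) *: u - (z - chart z *: u) = t *: u.
    by row_ring.
  by rewrite enormZ u1 mulr1 gtr0_norm.
have td' : `|chart z - t| <= del.
  by move: c1; rewrite !ler_norml /del => /andP[? ?]; apply/andP; split; lra.
by move=> /(c3 _ td'); lra.
Qed.

(** The boundary point over [z] has a normal close to [u]; its proximal inequality, divided by v.u,
    is the subgradient inequality. The chart is 1-Lipschitz, which bounds the vertical part of the
    quadratic term. *)
Lemma chart_sub z : disc z -> exists g, enorm g <= 2 /\
  forall z', disc z' -> chart z + dot g (z' - z) - C * dot (z' - z) (z' - z) <= chart z'.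
Proof.
move=> hz; have [v zv] := bdry_normal (chart_bdry hz); have [_ [/= v1 _]] := zv.
have [c1 _ _] := chart_spec hz; have ze := hz.2; rewrite /eps in ze.
have vu : enorm (v - u) < 2^-1.
  apply: normals zv _; rewrite addrAC; apply: le_lt_trans (enormBD _ _) _.
  by rewrite enormZ u1 mulr1; have := s_gt0; lra.
have vd := dot_unit_dist v1 u1; rewrite dotxx in vd.
have vu2 : 2^-1 < dot v u.
  have h : enorm (v - u) * enorm (v - u) <= 2^-1 * 2^-1.
    by rewrite ler_pM ?enorm_ge0 // ltW.
  by lra.
have vu0 : 0 < dot v u by lra.
have i2 : (dot v u)^-1 <= 2 by rewrite -[2]invrK lef_pV2 ?posrE ?invr_gt0 // ltW.
have i0 : 0 < (dot v u)^-1 by rewrite invr_gt0.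
exists ((dot v u)^-1 *: v); split; first by rewrite enormZ v1 mulr1 gtr0_norm.
move=> z' hz'; have [_ Az' _] := chart_spec hz'.
have := normal_proximal zv Az'; set k := chart z' - chart z.
have -> : z' - chart z' *: u - (z - chart z *: u) = (z' - z) - k *: u.
  by rewrite /k; row_ring.
have hu : dot (z' - z) u = 0 by exact: perp_planeB hz'.1 hz.1.
move Eh : (z' - z) hu => h hu.
have kh : k * k <= dot h h.
  rewrite dotxx -[k * k]ger0_norm ?normrM ?ler_pM //; last by rewrite -expr2 sqr_ge0.
  1,2: have := chart_lip hz hz'; have := chart_lip hz' hz; rewrite (enormB z) Eh ler_norml /k;
       by move=> ? ?; apply/andP; split; lra.
have -> : dot (h - k *: u) (h - k *: u) = dot h h + k * k.
  by rewrite !dotE (dotC u h) hu (dotxx u) u1; ring.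
have -> : dot (h - k *: u) v = dot v h - k * dot v u by rewrite !dotE (dotC h) (dotC u).
move=> E; have {}E : dot v h - k * dot v u <= rho^-1 * dot h h.
  rewrite -(ler_pM2l rho_gt0) mulrA mulfV ?gt_eqF // mul1r.
  by move: E; lra.
have h0 := dot_ge0 h.
have E2 : (dot v u)^-1 * (dot v h - k * dot v u) <= 2 * (rho^-1 * dot h h).
  apply: le_trans (ler_wpM2l (ltW i0) E) _.
  by rewrite ler_wpM2r // mulr_ge0 // invr_ge0 ltW.
have E3 : (dot v u)^-1 * (k * dot v u) = k by rewrite mulrCA mulVf ?mulr1 // gt_eqF.
rewrite mulrBr E3 in E2; rewrite dotZl /C; move: E2; rewrite /k; lra.
Qed.

(** Thin cones are used both ways: from [a] towards a + v for the upper bound, and from the graph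
    point over a + v back to the axis for the lower one, where [chart_lb] at [a] allows no negative
    depth. *)
Lemma chart_diff e : 0 < e -> exists d, 0 < d /\
  forall v, perp u v -> enorm v < d -> `|chart (a + v)| <= e * enorm v.
Proof.
move=> e0; have e1 : 0 < 1 + e by rewrite addr_gt0.
(* The vector v - e|v|u has length at most (1 + e)|v| and drops by e|v|, whence the constant e/(1 +
   e). *)
have [r [r0 hr]] := thin_cone (divr_gt0 e0 e1); have s0 := s_gt0.
have [|d d0 /= /and5P[d_eps d_r d_e d_s _]] := @lt_all R [:: eps; r / 2; r / (1 + e); del / e].
  by rewrite /= (divr_gt0 r0 (ltr0Sn R 1)) (divr_gt0 r0 e1) (divr_gt0 _ e0) ?eps_gt0 // divr_gt0.
exists d; split=> // v hv vd; have v0 := enorm_ge0 v.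
have Da : a + v - a = v by rewrite addrAC subrr add0r.
have hz : disc (a + v).
  by split; [exact: plane_add|rewrite Da; exact: lt_trans d_eps].
have [c1 c2 c3] := chart_spec hz; rewrite Da in c1.
have ed : e * enorm v <= del.
  rewrite -ler_pdivlMl // mulrC ltW //; exact: lt_trans d_s.
have step (w : V) : enorm w = enorm v -> dot w u = 0 -> forall c, A c -> enorm (c - a) < r ->
    A (c + (w - (e * enorm v) *: u)).
  move=> wv wu c Ac ca; have w_le : enorm (w - (e * enorm v) *: u) <= (1 + e) * enorm v.
    apply: le_trans (enormBD _ _) _; rewrite enormZ u1 wv ger0_norm ?mulr_ge0 ?(ltW e0) //; lra.
  apply: hr => //.
    apply: (le_lt_trans w_le); rewrite mulrC -ltr_pdivlMr //; exact: lt_trans d_e.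
  rewrite dotDl wu dotNl dotZl (dotxx u) u1 !mulr1 add0r lerN2.
  apply: le_trans (ler_wpM2l (ltW (divr_gt0 e0 e1)) w_le) _.
  by rewrite mulrA divfK // gt_eqF.
rewrite ler_norml; apply/andP; split; last first.
  apply: c3; first by rewrite ger0_norm // mulr_ge0 // ltW.
  rewrite -addrA; apply: step => //.
  by rewrite subrr enorm0.
rewrite leNgt; apply/negP => lt_c.
have := step (- v) (enormN v) _ _ c2; rewrite dotNl (hv : dot v u = 0) oppr0 => /(_ erefl).
have -> : a + v - chart (a + v) *: u + (- v - (e * enorm v) *: u) =
    a - (chart (a + v) + e * enorm v) *: u by row_ring.
have ca : enorm (a + v - chart (a + v) *: u - a) < r.
  rewrite addrAC Da; apply: le_lt_trans (enormBD _ _) _; rewrite enormZ u1 mulr1; lra.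
move=> /(_ ca) Az; have := chart_lb (plane_base a u) Az; rewrite subrr enorm0 oppr0.
move: c1; rewrite ler_norml => /andP[c1 _]; have ev := mulr_ge0 (ltW e0) v0; rewrite /eps in d_eps.
suff : `|chart (a + v) + e * enorm v| <= s / 4.
  by move=> h1 /(_ _ h1); rewrite (_ : 0 <= s / 8) ?divr_ge0 ?(ltW s0) // => /(_ erefl); lra.
by rewrite ler0_norm; lra.
Qed.

Lemma chart_graph_rep : exists f, graph_rep A a u eps del f.
Proof.
have [|g hg] := @choice V V (fun z g => disc z -> enorm g <= 2 /\ forall z', disc z' ->
    chart z + dot g (z' - z) - C * dot (z' - z) (z' - z) <= chart z').
  move=> z; have [hz|nz] := pselect (disc z); last by exists 0 => /nz.
  by have [g hg] := chart_sub hz; exists g.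
have C_ge0 : 0 <= C by rewrite divr_ge0 // ltW.
have disc_lt x : disc x -> enorm (x - a) < eps by case.
have g_le x : disc x -> enorm (g x) <= 2 by move=> /hg[].
have g_sub x z : disc x -> disc z -> chart x + dot (g x) (z - x) - C * dot (z - x) (z - x) <= chart z.
  by move=> /hg[_]; apply.
pose f := semiconvex_ext a eps C disc chart g; exists f.
have fE z : disc z -> f z = chart z.
  exact: (semiconvex_ext_eq disc_a eps_gt0 C_ge0 disc_lt g_le g_sub).
have fcv := semiconvex_ext_convex disc_a eps_gt0 C_ge0 disc_lt g_le g_sub.
have flip := semiconvex_ext_lip disc_a eps_gt0 C_ge0 disc_lt g_le g_sub.
have ca : chart a = 0.
  by have [] := chart_spec disc_a; rewrite subrr enorm0 normr_le0 => /eqP.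
have fa : f a = 0 by rewrite fE.
have cyl y : Ucyl a u eps del y -> exists z t, [/\ disc z, `|t| < del & y = z - t *: u].
  move=> [z [t [hz ze td ->]]]; exists z, (- t); split=> //; first by rewrite normrN.
  by rewrite scaleNr opprK.
split=> //; first exact: divr_gt0.
- by exists C; split=> // x y t _ _ t01; exact: fcv.
- by eexists => x y _ _; exact: flip.
split=> //.
- move=> e e0; have [d [d0 hd]] := chart_diff e0.
  have [d1 d10 [d1d d1e]] := min_gt0 d0 eps_gt0; exists d1; split=> // v hv vd.
  rewrite fa subr0 fE; last first.
    by split; [exact: plane_add|rewrite addrAC subrr add0r (lt_trans vd)].
  by apply: hd => //; exact: lt_trans d1d.
- apply/seteqP; split=> y [hy Uy]; split=> //; have [z [t [hz td yE]]] := cyl y Uy.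
    move: hy => [x [hx]]; rewrite yE => /(plane_decomp u1 hz.1 hx)[<- ->].
    by rewrite fE //; exact: chart_bdry.
  exists z; split; first exact: hz.1.
  have [Ay _] := (bdryP y A_closed).1 hy; have [c1 c2 c3] := chart_spec hz.
  have := c3 t (ltW td); rewrite -yE => /(_ Ay); rewrite fE // le_eqVlt => /orP[/eqP -> //|ct].
  (* A point strictly deeper than the chart is interior by the cone, so it is not a boundary
     point. *)
  case: hy => _ []; have -> : y = (z - chart z *: u) - (t - chart z) *: u.
    by rewrite yE; row_ring.
  have ze := hz.2; rewrite /eps in ze; rewrite /del ltr_norml in td; case/andP: td => _ td.
  have s0 := s_gt0; apply: cone_interior => //; last 2 first.
  - by rewrite subr_gt0.
  - by move: c1; rewrite ler_norml => /andP[? ?]; lra.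
  rewrite addrAC; apply: le_lt_trans (enormBD _ _) _; rewrite enormZ u1 mulr1; lra.
apply/seteqP; split=> y [hy Uy]; split=> //; have [z [t [hz td yE]]] := cyl y Uy.
  move: hy => [x [r [hx fr]]]; rewrite yE => /(plane_decomp u1 hz.1 hx)[E1 E2].
  by apply: chart_up => //; [rewrite -fE // E1 E2|exact: ltW].
exists z, t; split=> //; first exact: hz.1.
by rewrite fE //; have [_ _ ] := chart_spec hz; apply; [exact: ltW|rewrite -yE].
Qed.

End Chart.
End PositiveReach.

(** * Graph representation and the equivalence *)

Lemma reach_graph_rep (R : realType) (n : nat) (A : set 'rV[R]_n.+1) (a u : 'rV[R]_n.+1) :
  closed A -> (0 < reach A)%E -> bdry A a -> Neuc_fib A a = [set u] ->
  exists (eps del : R) (f : 'rV[R]_n.+1 -> R), graph_rep A a u eps del f.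
Proof.
move=> Acl reach_gt0 a_bd fib.
have [Aa _] := (bdryP a Acl).1 a_bd; have A0 : A !=set0 by exists a.
have u1 : enorm u = 1.
  by have : Neuc_fib A a u; [rewrite fib|case=> _ []].
have [rho [rho0 uniq]] : exists rho : R, 0 < rho /\
    forall x, dist A x < rho -> exists! c, A c /\ enorm (x - c) = dist A x.
  move: reach_gt0 => /ereal_sup_gt[_ [rho [_ uniq] <-]]; rewrite lte_fin => rho0.
  by exists rho.
have h0 : 0 < 2^-1 :> R by rewrite invr_gt0.
have [s1 [s10 cone]] := inner_cone Acl A0 rho0 uniq Aa fib h0.
have [s2 [s20 nrm]] := normals_near Acl A0 rho0 uniq Aa fib h0.
have [s s0 [ss1 ss2]] := min_gt0 s10 s20.
exists (s / 32), (s / 4).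
apply: (chart_graph_rep Acl A0 rho0 uniq a_bd u1 s0).
- by move=> c e Ac ca es; apply: cone => //; exact: lt_trans ss1.
- by move=> t t0; exact: (inner_cone Acl A0 rho0 uniq Aa fib t0).
- by move=> c v cv ca; apply: (nrm c v cv); exact: lt_trans ss2.
Qed.

Theorem theorem5p7 (R : realType) (n : nat) (phi : 'rV[R]_(n.+1) -> R)
  (A : set 'rV[R]_(n.+1)) (a u : 'rV[R]_(n.+1)) :
  is_norm phi -> C2_on [set x | x != 0] phi -> unif_convex phi ->
  closed A -> (0 < reach A)%E ->
  bdry A a -> Neuc_fib A a = [set u] ->
  (exists (eps del : R) (f : 'rV[R]_(n.+1) -> R), graph_rep A a u eps del f) /\
  (forall (eps del : R) (f : 'rV[R]_(n.+1) -> R), graph_rep A a u eps del f ->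
     (Ntilde_n phi A (a, grad phi u) <-> ptw_twice_diff f a u) /\
     (ptw_twice_diff f a u ->
        forall nu : 'rV[R]_(n.+1) -> 'rV[R]_(n.+1),
          (forall b, plane a u b -> Neuc_fib (epif a u f) (b - f b *: u) (nu b)) ->
          [/\ plane_diff nu a u,
              plane_diff (grad phi \o nu) a u
            & forall L p M, plane_deriv (grad phi \o nu) a u L ->
                M^T = M -> twice_at f a u p M ->
                forall t1 t2, perp u t1 -> perp u t2 ->
                  dot (t1 *m M) (t2 *m (hess phi u)^T) = dot (t1 *m L) t2])).
Proof.
move=> pn pC2 [gamma [g0 uc]] Acl reach_gt0 a_bd fib.
split; first exact: reach_graph_rep.
move=> eps del f [e0 d0 [C [C0 cv]] [K lip] [fa df _ epiA]].
have u1 : enorm u = 1 by have : Neuc_fib A a u; [rewrite fib|case=> _ []].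
(* The Lipschitz constant carries no sign, hence the absolute value. *)
have lipK x y : plane a u x -> plane a u y -> `|f x - f y| <= `|K| * enorm (x - y).
  move=> hx hy; apply: le_trans (lip x y hx hy) _.
  by rewrite ler_wpM2r ?enorm_ge0 // ler_norm.
have K0 := normr_ge0 K.
split; first split.
- exact: (ntilde_twice pn pC2 g0 uc Acl u1 e0 d0 C0 K0 cv lipK fa df epiA).
- exact: (twice_ntilde pn pC2 g0 uc Acl u1 e0 d0 C0 K0 cv lipK fa df epiA).
move=> [p [M [MT tw]]] nu hnu.
have [D1 D2] := nu_expand pn pC2 g0 uc Acl u1 e0 d0 C0 K0 cv lipK fa df epiA MT tw hnu.
split; [by exists (M *m pmx u)|by exists (M *m pmx u *m (hess phi u)^T)|].
move=> L q N DL NT twN t1 t2 h1 h2.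
exact: (nu_formula pn pC2 g0 uc Acl u1 e0 d0 C0 K0 cv lipK fa df epiA NT twN hnu DL).
Qed.
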